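(* Let $n\ge2$. The estimate $\|p\|_{\dot B^{2s}_{\infty,\infty}}\lesssim\|u\|_{\dot B^s_{\infty,\infty}}^2$ (over divergence-free $u\in\mathcal S(\mathbb R^n;\mathbb R^n)$ with associated pressure $p=\sum_{l,k=1}^n(-\Delta)^{-1}\partial_l\partial_k(u_lu_k)$) fails in the cases $s=0$ and $s=1$. More specifically: (s=1) For any $\varepsilon>0$ there exists divergence-free $u\in\mathcal S(\mathbb R^n;\mathbb R^n)$ with $$\|u\|_{\dot B^1_{\infty,\infty}}+\|u\|_{L^2}\le1\quad\text{but}\quad \|p\|_{\dot B^2_{\infty,\infty}}>\frac1\varepsilon .$$ (s=0) For any $\varepsilon>0$ there exists divergence-free $u\in\mathcal S(\mathbb R^n;\mathbb R^n)$ with $$\|u\|_{\dot B^0_{\infty,\infty}}+\|u\|_{L^2}\le1\quad\text{but}\quad \|p\|_{\dot B^0_{\infty,\infty}}>\frac1\varepsilon .$$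
   Context: $\mathcal S$ denotes Schwartz functions; divergence-free means $\sum_k\partial_ku_k=0$. $(-\Delta)^{-1}\partial_l\partial_k$ is the Fourier multiplier with symbol $-\xi_l\xi_k/|\xi|^2$, so $-\Delta p=\sum_{k,l}\partial_k\partial_l(u_ku_l)$. Besov (semi)norm: $\|f\|_{\dot B^s_{\infty,\infty}}=\sup_{j\in\mathbb Z}2^{js}\|P_jf\|_{L^\infty}$, where $\widehat{P_jf}(\xi)=\phi_c(2^{-j}\xi)\hat f(\xi)$, $\phi_c(\xi)=\tilde\phi(\xi)-\tilde\phi(2\xi)$, and $\tilde\phi\in C_c^\infty(\mathbb R^n)$ is fixed with $\tilde\phi=1$ for $|\xi|\le1$ and $\tilde\phi=0$ for $|\xi|>7/6$. *)

(* Defs.v *)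
From HB Require Import structures.
From mathcomp Require Import all_boot all_order all_algebra.
From mathcomp Require Import all_classical all_reals all_analysis.
From mathcomp Require Import complex.

Set SsrOldRewriteGoalsOrder.
Set Implicit Arguments.
Unset Strict Implicit.
Unset Printing Implicit Defensive.
Import Order.TTheory GRing.Theory Num.Theory.
Import numFieldNormedType.Exports.

Local Open Scope classical_set_scope.
Local Open Scope ring_scope.
Local Open Scope complex_scope.

(* The product (= Borel) sigma-algebra on R^n = 'rV[R]_n, generated by the
   coordinate functions. *)
Definition measure_rV_display : measure_display.
Proof. exact: default_measure_display. Qed.

Section measurable_rV.
Context {R : realType} (n : nat).

Definition rV_coord (i : 'I_n) (x : 'rV[R]_n) : measurableTypeR R := x 0 i.

Let rV_set0 : g_sigma_preimage rV_coord set0.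
Proof. exact: sigma_algebra0. Qed.

Let rV_setC A : g_sigma_preimage rV_coord A -> g_sigma_preimage rV_coord (~` A).
Proof. exact: sigma_algebraC. Qed.

Let rV_bigcup (F : (set 'rV[R]_n)^nat) :
  (forall i, g_sigma_preimage rV_coord (F i)) ->
  g_sigma_preimage rV_coord (\bigcup_i (F i)).
Proof. exact: sigma_algebra_bigcup. Qed.

HB.instance Definition _ :=
  @isMeasurable.Build measure_rV_display
  'rV[R]_n (g_sigma_preimage rV_coord) rV_set0 rV_setC rV_bigcup.

End measurable_rV.

Section measurable_rV_lemmas.
Context {R : realType}.

Lemma measurable_rV_coord n (i : 'I_n) :
  measurable_fun [set: 'rV[R]_n] (rV_coord i).
Proof.
move=> _ Y mY; rewrite setTI; apply: sub_sigma_algebra => /=.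
rewrite -bigcup_seq/=; exists i => /=; first by rewrite mem_index_enum.
by exists Y => //; rewrite setTI.
Qed.

Lemma measurable_fun_rVP d (T : measurableType d) n (f : T -> 'rV[R]_n) :
  measurable_fun [set: T] f <->
  forall i, measurable_fun [set: T] (rV_coord i \o f).
Proof.
split=> [mf i|mf].
  exact: measurableT_comp (measurable_rV_coord i) mf.
move=> _ A mA; rewrite setTI.
pose F' := [set B | measurable (f @^-1` B)].
suff : F' A by [].
move: A mA; apply: smallest_sub.
  split; first by rewrite /F'/= preimage_set0.
    by move=> B FB; rewrite /F'/= setTD preimage_setC; exact: measurableC.
  move=> G FG; rewrite /F'/= preimage_bigcup.
  by apply: bigcup_measurable => k _; exact: FG.
move=> A; rewrite -bigcup_seq/= => -[i _ [B mB <-]].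
rewrite /F'/= setTI; have := mf i measurableT B mB.
by rewrite setTI.
Qed.

Definition consrV n (p : measurableTypeR R * 'rV[R]_n) : 'rV[R]_n.+1 :=
  \row_i (if unlift ord0 i is Some j then p.2 0 j else p.1).

Definition unconsrV n (x : 'rV[R]_n.+1) : measurableTypeR R * 'rV[R]_n :=
  (x 0 0, \row_i x 0 (lift ord0 i)).

Lemma consrVK n : cancel (@consrV n) (@unconsrV n).
Proof.
move=> [a v]; rewrite /consrV /unconsrV/=; congr pair.
  by rewrite mxE unlift_none.
by apply/rowP => i; rewrite !mxE liftK.
Qed.

Lemma measurable_consrV n : measurable_fun setT (@consrV n).
Proof.
apply/measurable_fun_rVP => i; case: (unliftP ord0 i) => [j ->|->].
  rewrite (_ : _ \o _ = rV_coord j \o snd).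
    exact: measurableT_comp (measurable_rV_coord j) measurable_snd.
  by apply/funext => p; rewrite /rV_coord/= mxE liftK.
rewrite (_ : _ \o _ = fst); first exact: measurable_fst.
by apply/funext => p; rewrite /rV_coord/= mxE unlift_none.
Qed.

Lemma measurable_unconsrV n : measurable_fun setT (@unconsrV n).
Proof.
apply/measurable_fun_pairP; split.
  exact: (measurable_rV_coord (ord0 : 'I_n.+1)).
apply/measurable_fun_rVP => i.
rewrite (_ : _ \o _ = rV_coord (lift ord0 i)).
  exact: measurable_rV_coord.
by apply/funext => x; rewrite /rV_coord/= mxE.
Qed.

End measurable_rV_lemmas.

Section lebesgue_step.
Context {R : realType} {n : nat}.
Variable mu : {sigma_finite_measure set 'rV[R]_n -> \bar R}.

Definition lebesgue_rV_step : set 'rV[R]_n.+1 -> \bar R :=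
  pushforward (@lebesgue_measure R \x mu)%E (@consrV R n).

Let step0 : lebesgue_rV_step set0 = 0%E.
Proof. by rewrite /lebesgue_rV_step /pushforward preimage_set0 measure0. Qed.

Let step_ge0 A : (0 <= lebesgue_rV_step A)%E.
Proof. by rewrite /lebesgue_rV_step /pushforward; exact: measure_ge0. Qed.

Let step_sigma_additive : semi_sigma_additive lebesgue_rV_step.
Proof.
move=> F mF tF mUF; rewrite /lebesgue_rV_step /pushforward preimage_bigcup.
apply: measure_semi_sigma_additive.
- by move=> k; rewrite -[X in measurable X]setTI; exact: measurable_consrV.
- apply/trivIsetP => /= i j _ _ ij; rewrite -preimage_setI.
  by move/trivIsetP : tF => /(_ _ _ _ _ ij) ->//; rewrite preimage_set0.
- by rewrite -preimage_bigcup -[X in measurable X]setTI; exact: measurable_consrV.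
Qed.

HB.instance Definition _ := isMeasure.Build _ _ _
  lebesgue_rV_step step0 step_ge0 step_sigma_additive.

Let step_sigma_finite : sigma_finite setT lebesgue_rV_step.
Proof.
have /sigma_finiteP[F [TF ndF Foo]] := sigma_finiteT (@lebesgue_measure R).
have /sigma_finiteP[G [TG ndG Goo]] := sigma_finiteT mu.
exists (fun k => @unconsrV R n @^-1` (F k `*` G k)).
  apply/esym/seteqP; split => // x _.
  have [k _ Fk] : (\bigcup_k F k) (unconsrV x).1 by rewrite -TF.
  have [l _ Gl] : (\bigcup_k G k) (unconsrV x).2 by rewrite -TG.
  exists (maxn k l) => //; split.
  - by move: Fk; exact/subsetPset/ndF/leq_maxl.
  - by move: Gl; exact/subsetPset/ndG/leq_maxr.
move=> k; have [mF Fk] := Foo k; have [mG Gk] := Goo k; split.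
  rewrite -[X in measurable X]setTI; apply: measurable_unconsrV => //.
  exact: measurableX.
rewrite /lebesgue_rV_step /pushforward (_ : _ @^-1` _ = F k `*` G k); last first.
  by rewrite -comp_preimage (_ : _ \o _ = id)//; apply/funext; exact: consrVK.
by rewrite product_measure1E// lte_mul_pinfty// ge0_fin_numE.
Qed.

HB.instance Definition _ := Measure_isSigmaFinite.Build _ _ _
  lebesgue_rV_step step_sigma_finite.

End lebesgue_step.

(* n-dimensional Lebesgue measure: a unit mass for n = 0, and
   R^(n+1) = R x R^n as an iterated product. *)
Fixpoint lebesgue_rV {R : realType} (n : nat) :
    {sigma_finite_measure set 'rV[R]_n -> \bar R} :=
  match n with
  | 0 => dirac (0 : 'rV[R]_0)
  | n'.+1 => lebesgue_rV_step (lebesgue_rV n')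
  end.

Section schwartz.
Context {R : realType} {n : nat}.
Implicit Types (f : 'rV[R]_n -> R) (u : 'rV[R]_n -> 'rV[R]_n).

Definition dotr (x y : 'rV[R]_n) : R := \sum_(i < n) x 0 i * y 0 i.

(* The Euclidean norm; the library norm `|x| on 'rV[R]_n is the max norm. *)
Definition enorm (x : 'rV[R]_n) : R := Num.sqrt (dotr x x).

Definition partial (k : 'I_n) f : 'rV[R]_n -> R :=
  fun x => 'D_(delta_mx 0 k) f x.

Definition partials (ks : seq 'I_n) f : 'rV[R]_n -> R := foldr partial f ks.

(* Since 'D_v is total, the existence of each partial derivative is required
   separately. *)
Definition smooth f : Prop :=
  forall ks : seq 'I_n, continuous (partials ks f) /\
    forall k x, derivable (partials ks f) x (delta_mx 0 k).

Definition schwartz f : Prop :=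
  smooth f /\
  forall (ks : seq 'I_n) (N : nat), exists C : R,
    forall x, (1 + enorm x) ^+ N * `|partials ks f x| <= C.

Definition schwartz_field u : Prop :=
  forall k, schwartz (fun x => u x 0 k).

Definition divergence_free u : Prop :=
  forall x, \sum_(k < n) partial k (fun y => u y 0 k) x = 0.

End schwartz.

Section fourier.
Context {R : realType} {n : nat}.
Implicit Types (f g m : 'rV[R]_n -> R[i]) (x xi : 'rV[R]_n).

Definition cexpi (t : R) : R[i] := cos t +i* sin t.

Definition cintegral f : R[i] :=
  (\int[lebesgue_rV n]_x complex.Re (f x)) +i*
  (\int[lebesgue_rV n]_x complex.Im (f x)).

Definition fourier f : 'rV[R]_n -> R[i] :=
  fun xi => cintegral (fun x => f x * cexpi (- dotr x xi)).

Definition inv_fourier g : 'rV[R]_n -> R[i] :=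
  fun x => ((2 * pi) ^- n)%:C * cintegral (fun xi => g xi * cexpi (dotr x xi)).

Definition fourier_multiplier m f : 'rV[R]_n -> R[i] :=
  inv_fourier (fun xi => m xi * fourier f xi).

(* The pressure is bounded and square integrable but in general not
   integrable, so that its Fourier transform is understood, as usual, in the
   sense of tempered distributions, here functionals on test functions. *)
Definition distribution : Type := ('rV[R]_n -> R[i]) -> R[i].

Definition distr_of_fun f : distribution :=
  fun psi => cintegral (fun x => f x * psi x).

Definition fourier_distr (T : distribution) : distribution :=
  fun psi => T (fourier psi).

Definition mul_distr m (T : distribution) : distribution :=
  fun psi => T (fun xi => m xi * psi xi).

(* The inverse Fourier transform of a compactly supported distribution T is the
   function x |-> (2 pi)^-n <T, e^(i x . xi)>. *)
Definition inv_fourier_distr (T : distribution) : 'rV[R]_n -> R[i] :=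
  fun x => ((2 * pi) ^- n)%:C * T (fun xi => cexpi (dotr x xi)).

End fourier.

Section besov.
Context {R : realType} {n : nat}.
Variable phi : 'rV[R]_n -> R.

Definition lp_cutoff (xi : 'rV[R]_n) : R := phi xi - phi (2 *: xi).

Definition lp_proj (j : int) (f : 'rV[R]_n -> R[i]) : 'rV[R]_n -> R[i] :=
  inv_fourier_distr
    (mul_distr (fun xi => (lp_cutoff ((2 : R) ^ (- j) *: xi))%:C)
      (fourier_distr (distr_of_fun f))).

Definition cvec_norm (m : nat) (z : 'I_m -> R[i]) : R :=
  Num.sqrt (\sum_(k < m) Normc.normc (z k) ^+ 2).

Definition besov_norm (s : R) (m : nat) (f : 'I_m -> 'rV[R]_n -> R[i]) :
    \bar R :=
  ereal_sup [set ((2 `^ (j%:~R * s))%:E *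
    'N[lebesgue_rV n]_+oo[EFin \o (fun x => cvec_norm (fun k => lp_proj j (f k) x))])%E
    | j in [set: int]].

Definition besov_scalar (s : R) (p : 'rV[R]_n -> R[i]) : \bar R :=
  besov_norm s (fun _ : 'I_1 => p).

Definition besov_field (s : R) (u : 'rV[R]_n -> 'rV[R]_n) : \bar R :=
  besov_norm s (fun k x => (u x 0 k)%:C).

End besov.

Definition L2_norm (R : realType) (n : nat) (u : 'rV[R]_n -> 'rV[R]_n) :
    \bar R := 'N[lebesgue_rV n]_(2%:E)[EFin \o (enorm \o u)]%E.

Definition pressure (R : realType) (n : nat) (u : 'rV[R]_n -> 'rV[R]_n) :
    'rV[R]_n -> R[i] :=
  fun x => \sum_(l < n) \sum_(k < n)
    fourier_multiplier (fun xi => (- (xi 0 l * xi 0 k / enorm xi ^+ 2))%:C)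
      (fun y => (u y 0 l * u y 0 k)%:C) x.

Definition pressure_estimate (R : realType) (n : nat) (phi : 'rV[R]_n -> R)
    (s : R) : Prop :=
  exists2 C : R, 0 < C &
    forall u : 'rV[R]_n -> 'rV[R]_n, schwartz_field u -> divergence_free u ->
      (besov_scalar phi (2 * s) (pressure u) <=
       C%:E * besov_field phi s u ^+ 2)%E.

(* Main.v *)
(* The pressure is quadratic in u, so a velocity made of many plane waves of very
   different frequencies can have a bounded Besov norm, since each dyadic shell sees
   boundedly many of them, while all the pairs of waves send their interaction to one
   and the same shell.  Take u = curl psi in the plane of two coordinates e0, e1, where
   psi is a wide smooth cutoff of Theta = sum_i c_i cos(k_i . x).  As the cutoff widens,
   the unit-shell part of the pressure at the origin tends, up to sign, to
     1/2 sum_(i,j) c_i c_j (k_i x k_j)^2 (m(k_i - k_j) + m(k_i + k_j)),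
   m = (Littlewood-Paley cutoff) / |.|^2, and this sum can be made larger than any N:
   - s = 0: k = g e0 and k = g e0 + e1 with c = 1/g, g = 16, 16^2, ..., 16^N: only the
     differences e1 land in the unit shell, each with weight of order one;
   - s = 1: low frequencies k = e1/g with c = g^2, together with the single high
     frequency k = (3/4) e0 with c = 1, so that all sums and differences of a low and the
     high frequency land in the unit shell.
   A final dilation by a large factor preserves the Besov norms (up to the
   normalisation) and makes the L^2 norm small. *)
Require Import Defs.
From mathcomp Require Import all_boot all_order all_algebra.
From mathcomp Require Import all_classical all_reals all_analysis.
From mathcomp Require Import complex.
From mathcomp Require Import measurable_realfun.
From mathcomp Require Import ring lra.
Import Order.TTheory GRing.Theory Num.Theory.
Import numFieldNormedType.Exports.
Local Open Scope classical_set_scope.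
Local Open Scope ring_scope.

Set Implicit Arguments.
Unset Strict Implicit.
Unset Printing Implicit Defensive.

(** * Lebesgue measure on R^n *)

Section rV_measure.
Context {R : realType}.

(** The cutoff multiplies the stream function, not the velocity, so the field is divergence-free
    exactly. A windowed wave leaks into all dyadic shells, by an amount of order d times its
    amplitude when the window has width 1/d. Requiring d sum_i |c_i| <= 1 bounds the total leak
    independently of the number N of scales, so that the amplitudes can be normalised before N is
    chosen.

    The pressure is in general not integrable, and its Littlewood-Paley pieces are defined by
    duality. It is however the inverse transform of an integrable function, so Fubini and Fourier
    inversion turn its pieces into absolutely convergent integrals. At the origin such a piece is
    rewritten with the Fourier transform on the fixed smooth symbol and none on the velocity. In
    that form it suffices that the velocities converge pointwise and boundedly to a trigonometric
    field, which is itself not integrable. Since the sup norm is an essential supremum, the value at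
    the origin is a lower bound only through continuity. *)

Lemma open_measurable_rV n (A : set 'rV[R]_n) : open A -> measurable A.
Proof.
move=> oA.
(* Cubes with rational centre and radius 1/(k+1) form a countable measurable family, and those
   contained in A exhaust it. Cubes suit both the coordinate sigma-algebra and the max norm. *)
pose B (p : 'rV[rat]_n * nat) : set 'rV[R]_n :=
  [set x | forall i, x 0 i \in
    `](ratr (p.1 0 i) - p.2.+1%:R^-1), (ratr (p.1 0 i) + p.2.+1%:R^-1)[].
have mB p : measurable (B p).
  rewrite (_ : B p = \bigcap_(i in [set: 'I_n])
    (@rV_coord R n i @^-1` [set` `](ratr (p.1 0 i) - p.2.+1%:R^-1), (ratr (p.1 0 i) + p.2.+1%:R^-1)[])).
    apply: fin_bigcap_measurable => [|i _]; first exact: finite_finset.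
    by rewrite -[X in measurable X]setTI; exact: measurable_rV_coord.
  by apply/seteqP; split => x /= h i; [move=> _|]; exact: h.
rewrite (_ : A = \bigcup_p (if `[< B p `<=` A >] then B p else set0)).
  apply: countable_bigcupT_measurable => [|p]; first exact: countableP.
  by case: ifPn => // _; exact: mB.
apply/seteqP; split => [x Ax|x [p _]]; last by case: asboolP => // h /h.
have /nbhs_ballP[e /= e0 he] : nbhs x A by exact: open_nbhs_nbhs.
have [k hk] : exists k : nat, k.+1%:R^-1 < e / 2.
  have e20 : 0 < e / 2 by rewrite divr_gt0.
  exists (Num.trunc (e / 2)^-1); by rewrite -[X in _ < X]invrK ltf_pV2 ?posrE ?invr_gt0// truncnS_gt.
have k0 : 0 < k.+1%:R^-1 :> R by rewrite invr_gt0.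
have [q hq] : exists q : 'rV[rat]_n, forall i, ratr (q 0 i) \in `](x 0 i - k.+1%:R^-1), (x 0 i + k.+1%:R^-1)[.
  have h i : exists r : rat, ratr r \in `](x 0 i - k.+1%:R^-1), (x 0 i + k.+1%:R^-1)[.
    by apply: rat_in_itvoo; move: k0; move: (k.+1%:R^-1) => d; lra.
  have [g hg] := choice h.
  by exists (\row_i g i) => i; rewrite mxE.
exists (q, k) => //=; case: asboolP => [_ i /=|[]].
  by move: (hq i); rewrite !in_itv/=; move: (k.+1%:R^-1) => d; lra.
move=> y hy; apply: he; split=> // i j; rewrite (ord1 i)//.
move: hk k0 (hq j) (hy j); rewrite !in_itv/= /ball/= ltr_norml.
move: (k.+1%:R^-1) => d; lra.
Qed.

Lemma continuous_measurable_rV n (f : 'rV[R]_n -> R) :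
  continuous f -> measurable_fun setT f.
Proof.
move=> cf; apply: (measurability (@measurable_realfun.RGenOInfty.G R)).
  exact: measurable_realfun.RGenOInfty.measurableE.
move=> _ [_ [a ->] <-]; rewrite setTI; apply: open_measurable_rV.
by apply: open_comp => // x _; exact: cf.
Qed.

Lemma ge0_integral_rVS n (f : 'rV[R]_n.+1 -> \bar R) :
  measurable_fun setT f -> (forall x, 0 <= f x)%E ->
  (\int[lebesgue_rV n.+1]_x f x =
   \int[lebesgue_measure]_t \int[lebesgue_rV n]_v f (consrV (t, v)))%E.
Proof.
move=> mf f0; rewrite /= ge0_integral_pushforward//; last exact: measurable_consrV.
rewrite preimage_setT fubini_tonelli1//.
  by apply: measurableT_comp => //; exact: measurable_consrV.
by move=> x /=.
Qed.

Lemma measurable_affine1 (a b : R) : measurable_fun setT (fun t : measurableTypeR R => (a * t + b : measurableTypeR R)).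
Proof.
apply: continuous_measurable_fun => t; apply: cvgD; last exact: cvg_cst.
by apply: cvgM; [exact: cvg_cst|exact: cvg_id].
Qed.


(** The image of Lebesgue measure under t |-> a t + b, multiplied by a, agrees with Lebesgue measure
    on half-open intervals, hence on all measurable sets. *)
Lemma ge0_integral_affine1 (a b : R) (f : R -> \bar R) : 0 < a ->
  measurable_fun setT f -> (forall t, 0 <= f t)%E ->
  (\int[lebesgue_measure]_t f (a * t + b)%R = a^-1%:E * \int[lebesgue_measure]_t f t)%E.
Proof.
move=> a0 mf f0.
pose nu := measure_function_pushforward__canonical__measure_function_Measure
   lebesgue_measure (measurable_affine1 a b).
have h (A : set (measurableTypeR R)) : measurable A -> @lebesgue_measure R A = mscale (NngNum (ltW a0)) nu A.
  revert A; apply: (@lebesgue_measure_unique R (mscale (NngNum (ltW a0)) nu)) => _ [[c d] _ <-] /=.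
  rewrite /mscale /= /pushforward/=.
  rewrite (_ : _ @^-1` _ = `](c - b) / a, (d - b) / a]%classic); last first.
    apply/seteqP; split => x /=; rewrite !in_itv/= ltr_pdivrMr// ler_pdivlMr// (mulrC x) ltrBlDr lerBrDr//.
  rewrite !lebesgue_measure_itv/= !lte_fin ltr_pM2r ?invr_gt0// ltrD2r.
  case: ifPn => _; last by rewrite mule0.
  by rewrite -!EFinD -EFinM; congr EFin; field; lra.
have -> : (\int[lebesgue_measure]_t f t)%E = (\int[mscale (NngNum (ltW a0)) nu]_t f t)%E.
  apply: (@eq_measure_integral _ _ _ _ (mscale (NngNum (ltW a0)) nu)) => A mA _.
  exact: h.
rewrite ge0_integral_mscale//= ge0_integral_pushforward//; last exact: measurable_affine1.
by rewrite muleA -EFinM mulVf ?gt_eqF// mul1e preimage_setT.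
Qed.

Lemma measurable_affine_rV n (a : R) (b : 'rV[R]_n) :
  measurable_fun setT (fun x : 'rV[R]_n => a *: x + b).
Proof.
apply/measurable_fun_rVP => i.
rewrite (_ : _ \o _ = (fun t : R => a * t + b 0 i) \o rV_coord i); last first.
  by apply/funext => x /=; rewrite /rV_coord !mxE.
by apply: measurableT_comp; [exact: measurable_affine1|exact: measurable_rV_coord].
Qed.

Lemma consrV_affine n (a : R) (b : 'rV[R]_n.+1) t v :
  a *: consrV (t, v) + b = consrV (a * t + b 0 0, a *: v + \row_i b 0 (lift ord0 i)).
Proof.
apply/rowP => i; rewrite !mxE/=; case: (unliftP ord0 i) => [j ->|->] //.
by rewrite !mxE.
Qed.

Lemma ge0_integral_affine n (a : R) (b : 'rV[R]_n) (f : 'rV[R]_n -> \bar R) : 0 < a ->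
  measurable_fun setT f -> (forall t, 0 <= f t)%E ->
  (\int[lebesgue_rV n]_x f (a *: x + b)%R = (a ^- n)%:E * \int[lebesgue_rV n]_x f x)%E.
Proof.
move=> a0; elim: n b f => [|n ih] b f mf f0.
  rewrite expr0 invr1 mul1e; apply: eq_integral => x _; congr f.
  by apply/rowP => -[].
rewrite !ge0_integral_rVS//; last first.
  by apply: measurableT_comp => //; exact: measurable_affine_rV.
under eq_integral => t _.
  under eq_integral do rewrite consrV_affine.
  rewrite (ih (\row_i b 0 (lift ord0 i)) (fun v => f (consrV (a * t + b 0 0, v))%R))//; last first.
    apply: measurableT_comp => //.
    apply: measurableT_comp; first exact: measurable_consrV.
    exact: pair1_measurable.
  over.
have mF : measurable_fun setT (fun t : R => \int[lebesgue_rV n]_v f (consrV (t, v)))%E.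
  apply: (measurable_fun_fubini_tonelli_F (f \o @consrV R n)) => //=.
  by apply: measurableT_comp => //; exact: measurable_consrV.
rewrite ge0_integralZl//; last 3 first.
- by apply: (measurableT_comp mF); exact: measurable_affine1.
- by move=> t _; apply: integral_ge0.
- by rewrite lee_fin invr_ge0 exprn_ge0// ltW.
rewrite (@ge0_integral_affine1 _ _ (fun t => \int[lebesgue_rV n]_v f (consrV (t, v)))%E)//; last first.
  by move=> t; exact: integral_ge0.
by rewrite muleA -EFinM -invfM exprSr.
Qed.

End rV_measure.

(** * Real and complex integrals *)

Notation intR mu f := (mu.-integrable setT (EFin \o f)).

Section real_integrals.
Context {R : realType}.

Section one_measure.
Context d (T : measurableType d) (mu : {measure set T -> \bar R}).
Implicit Types f g : T -> R.

Lemma intR_measurable f : intR mu f -> measurable_fun setT f.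
Proof. by move=> /measurable_int /measurable_EFinP. Qed.

Lemma intR_le f g : measurable_fun setT f -> (forall x, `|f x| <= g x) ->
  intR mu g -> intR mu f.
Proof.
move=> mf fg; apply: le_integrable => //; first exact/measurable_EFinP.
by move=> x _ /=; rewrite lee_fin (le_trans (fg x))// ler_norm.
Qed.

Lemma intRD f g : intR mu f -> intR mu g -> intR mu (fun x => f x + g x).
Proof. by move=> fi gi; have := integrableD measurableT fi gi; apply: eq_integrable. Qed.

Lemma intRZ k f : intR mu f -> intR mu (fun x => k * f x).
Proof.
move=> fi; have := integrableZl measurableT k fi.
by apply: eq_integrable.
Qed.

Lemma intRN f : intR mu f -> intR mu (fun x => - f x).
Proof. by move=> fi; have := integrableN fi; apply: eq_integrable. Qed.

Lemma intR_norm f : intR mu f -> intR mu (fun x => `|f x|).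
Proof. by move=> fi; exact: integrable_norm. Qed.

Lemma intR0 : intR mu (fun=> 0).
Proof. exact: integrable0. Qed.

Lemma intR_sum (I : Type) (s : seq I) (P : pred I) (h : I -> T -> R) :
  (forall i, P i -> intR mu (h i)) -> intR mu (fun x => \sum_(i <- s | P i) h i x).
Proof.
move=> hi; elim: s => [|i s ih].
  by under [fun=> _]eq_fun do rewrite big_nil; exact: intR0.
case Pi : (P i).
  under [fun=> _]eq_fun do rewrite big_cons Pi.
  by apply: intRD => //; exact: hi.
by under [fun=> _]eq_fun do rewrite big_cons Pi.
Qed.

Lemma Rint_sum (I : Type) (s : seq I) (P : pred I) (h : I -> T -> R) :
  (forall i, P i -> intR mu (h i)) ->
  \int[mu]_x (\sum_(i <- s | P i) h i x) = \sum_(i <- s | P i) \int[mu]_x h i x.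
Proof.
move=> hi; elim: s => [|i s ih].
  under eq_Rintegral do rewrite big_nil.
  by rewrite big_nil Rintegral_cst// mul0r.
case Pi : (P i).
  under eq_Rintegral do rewrite big_cons Pi.
  rewrite big_cons Pi RintegralD//; first by rewrite ih.
    exact: hi.
  by apply: (@intR_sum I s P h).
under eq_Rintegral do rewrite big_cons Pi.
by rewrite big_cons Pi.
Qed.

Lemma EFin_Rint f : intR mu f -> (\int[mu]_x f x)%:E = (\int[mu]_x (f x)%:E)%E.
Proof. by move=> fi; rewrite /Rintegral fineK//; exact: integrable_fin_num. Qed.

Lemma Rint_dct (f_ : nat -> T -> R) f g :
  (forall m, measurable_fun setT (f_ m)) ->
  (forall x, f_ m x @[m --> \oo] --> f x) ->
  intR mu g -> (forall m x, `|f_ m x| <= g x) ->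
  intR mu f /\ \int[mu]_x f_ m x @[m --> \oo] --> \int[mu]_x f x.
Proof.
move=> mf cf ig fg.
have mfl : measurable_fun setT f.
  by apply: (@measurable_fun_cvg _ _ _ _ f_) => // x _; exact: cf.
have fgx x : `|f x| <= g x.
  have h : `|f_ m x| @[m --> \oo] --> `|f x| by apply: cvg_norm; exact: cf.
  rewrite -(cvg_lim _ h)//; apply: limr_le; first by apply/cvg_ex; exists (`|f x|).
  by apply: nearW => m; exact: fg.
have fi : intR mu f by apply: intR_le fgx ig.
split => //.
have fmi m : intR mu (f_ m) by apply: (intR_le _ (fg m)).
apply: fine_cvg; rewrite -/(\int[mu]_x f x) EFin_Rint//.
apply: (@dominated_cvg _ _ _ _ _ _ (fun m => EFin \o f_ m) (EFin \o f) (EFin \o g)) => //.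
- by move=> m; exact/measurable_EFinP.
- by move=> x _; apply: cvg_EFin; [exact: nearW|exact: cf].
- by move=> m x _ /=; rewrite lee_fin.
Qed.

End one_measure.

(** Domination by a product G(x) H(y) stands in for integrability on the product space. Every
    exchange of integrals below has this shape, because characters have modulus one. The
    integrability of the partial integrals is also how Fourier transforms are seen to be
    measurable. *)
Lemma fubini_dom d1 d2 (T1 : measurableType d1) (T2 : measurableType d2)
    (m1 : {sigma_finite_measure set T1 -> \bar R})
    (m2 : {sigma_finite_measure set T2 -> \bar R})
    (h : T1 * T2 -> R) (G : T1 -> R) (H : T2 -> R) :
  measurable_fun setT h -> intR m1 G -> intR m2 H ->
  (forall x y, `|h (x, y)| <= G x * H y) ->
  [/\ intR m1 (fun x => \int[m2]_y h (x, y)),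
      intR m2 (fun y => \int[m1]_x h (x, y)) &
      \int[m1]_x \int[m2]_y h (x, y) = \int[m2]_y \int[m1]_x h (x, y)].
Proof.
move=> mh iG iH hGH.
have iy x : intR m2 (fun y => h (x, y)).
  apply: (intR_le _ (hGH x)); last exact: intRZ.
  by apply: measurableT_comp => //; exact: pair1_measurable.
have ix y : intR m1 (fun x => h (x, y)).
  apply: (@intR_le _ _ _ _ (fun x => H y * G x)); last exact: intRZ.
    by apply: measurableT_comp => //; exact: pair2_measurable.
  by move=> x; rewrite mulrC.
have ih : (m1 \x m2)%E.-integrable setT (EFin \o h).
  apply/integrable12ltyP; first exact/measurable_EFinP.
  apply: (@le_lt_trans _ _ (\int[m1]_x (`|G x| * \int[m2]_y `|H y|)%:E)%E).
    apply: ge0_le_integral => //.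
    - by move=> x _; exact: integral_ge0.
    - apply: (measurable_fun_fubini_tonelli_F (fun z => `|(h z)%:E|%E)) => //=.
      by apply/measurable_EFinP; exact: measurableT_comp.
    - apply/measurable_EFinP; apply: measurable_funM => //.
      by apply: measurableT_comp => //; exact: intR_measurable iG.
    - move=> x _; rewrite -RintegralZl//; last exact: intR_norm.
      rewrite EFin_Rint; last by apply: intRZ; exact: intR_norm.
      apply: ge0_le_integral => //.
      + apply/measurable_EFinP; apply: measurableT_comp => //.
        exact: intR_measurable (iy x).
      + apply/measurable_EFinP; apply: measurable_funM => //.
        by apply: measurableT_comp => //; exact: intR_measurable iH.
      + by move=> y _; rewrite lee_fin -normrM (le_trans (hGH x y))// ler_norm.
  have iGH : intR m1 (fun x => \int[m2]_y `|H y| * `|G x|).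
    by apply: intRZ; exact: intR_norm.
  under eq_integral do rewrite mulrC.
  rewrite -EFin_Rint//; exact: ltry.
split.
- have := integrable_fubini_F ih; apply: eq_integrable => // x _.
  by rewrite /fubini_F /= EFin_Rint.
- apply: (@intR_le _ _ _ _ (fun y => (\int[m1]_x G x) * H y)); last exact: intRZ.
    apply/measurable_EFinP; move: (measurable_fubini_G ih); apply: eq_measurable_fun => y _.
    by rewrite /fubini_G /= EFin_Rint.
  move=> y; apply: le_trans (le_normr_Rintegral _ _) _ => //.
  rewrite -RintegralZr//; apply: le_Rintegral => //; first exact: intR_norm.
  by under eq_fun do rewrite mulrC; exact: intRZ.
- have := Fubini ih; rewrite /= /Rintegral => e.
  congr fine.
  under eq_integral do rewrite -/(\int[m2]_y h (_, y)) EFin_Rint//.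
  rewrite e.
  by under [RHS]eq_integral do rewrite -/(\int[m1]_x h (x, _)) EFin_Rint//.
Qed.

Lemma Rint_affine n (a : R) (b : 'rV[R]_n) (f : 'rV[R]_n -> R) : 0 < a ->
  intR (lebesgue_rV n) f ->
  intR (lebesgue_rV n) (fun x : 'rV[R]_n => f (a *: x + b)) /\
  \int[lebesgue_rV n]_x f (a *: x + b) = a ^- n * \int[lebesgue_rV n]_x f x.
Proof.
move=> a0 fi.
have mf := intR_measurable fi.
have mfa : measurable_fun setT (fun x : 'rV[R]_n => f (a *: x + b)).
  by apply: measurableT_comp => //; exact: measurable_affine_rV.
have fai : intR (lebesgue_rV n) (fun x : 'rV[R]_n => f (a *: x + b)).
  apply/integrableP; split; first exact/measurable_EFinP.
  rewrite (@ge0_integral_affine _ _ _ b (fun x => `|(f x)%:E|%E))//; last first.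
    by apply: measurableT_comp => //; exact/measurable_EFinP.
  case/integrableP : fi => _ fi; rewrite lte_mul_pinfty ?lee_fin ?invr_ge0 ?exprn_ge0 ?ltW//.
split => //; apply: EFin_inj; rewrite EFinM !EFin_Rint//.
have ep : (\int[lebesgue_rV n]_x (EFin \o f)^\+ (a *: x + b)%R =
    (a ^- n)%:E * \int[lebesgue_rV n]_x (EFin \o f)^\+ x)%E.
  apply: ge0_integral_affine => //.
  by apply: measurable_funepos; exact/measurable_EFinP.
have en : (\int[lebesgue_rV n]_x (EFin \o f)^\- (a *: x + b)%R =
    (a ^- n)%:E * \int[lebesgue_rV n]_x (EFin \o f)^\- x)%E.
  apply: ge0_integral_affine => //.
  by apply: measurable_funeneg; exact/measurable_EFinP.
rewrite [LHS]integralE; transitivity ((a ^- n)%:E * \int[lebesgue_rV n]_x (EFin \o f)^\+ x -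
  (a ^- n)%:E * \int[lebesgue_rV n]_x (EFin \o f)^\- x)%E.
  by apply: (f_equal2 (fun x y => x - y)%E); [rewrite -ep|rewrite -en];
    apply: eq_integral => x _; rewrite !unlock.
rewrite -muleBr//; first by rewrite -integralE.
apply: fin_num_adde_defr; apply: integrable_fin_num => //.
exact: integrable_funepos.
Qed.

End real_integrals.

Section complex_integrals.
Context {R : realType}.
Local Open Scope complex_scope.
Local Notation normc := (@Normc.normc R).
Local Notation Re := (@complex.Re R).
Local Notation Im := (@complex.Im R).

Lemma cReM (x y : R[i]) : Re (x * y) = Re x * Re y - Im x * Im y.
Proof. by case: x y => [a b] [c d]. Qed.
Lemma cImM (x y : R[i]) : Im (x * y) = Re x * Im y + Im x * Re y.
Proof. by case: x y => [a b] [c d]. Qed.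
Lemma cReD (x y : R[i]) : Re (x + y) = Re x + Re y.
Proof. by case: x y => [a b] [c d]. Qed.
Lemma cImD (x y : R[i]) : Im (x + y) = Im x + Im y.
Proof. by case: x y => [a b] [c d]. Qed.
Lemma complex_ReIm_eq (x y : R[i]) : Re x = Re y -> Im x = Im y -> x = y.
Proof. by case: x y => [a b] [c d] /= -> ->. Qed.

Lemma normc_ge0 (z : R[i]) : 0 <= normc z.
Proof. by case: z => a b; exact: sqrtr_ge0. Qed.

Lemma normc_real (x : R) : normc x%:C = `|x|.
Proof. by rewrite /= expr0n addr0 sqrtr_sqr. Qed.

Lemma Re_le_normc (z : R[i]) : `|Re z| <= normc z.
Proof.
case: z => a b /=; rewrite -sqrtr_sqr ler_sqrt ?addr_ge0 ?sqr_ge0//.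
by rewrite lerDl sqr_ge0.
Qed.

Lemma Im_le_normc (z : R[i]) : `|Im z| <= normc z.
Proof.
case: z => a b /=; rewrite -sqrtr_sqr ler_sqrt ?addr_ge0 ?sqr_ge0//.
by rewrite lerDr sqr_ge0.
Qed.

Lemma normc_le_ReIm (z : R[i]) : normc z <= `|Re z| + `|Im z|.
Proof.
case: z => a b /=; rewrite -[leRHS]ger0_norm ?addr_ge0// -sqrtr_sqr ler_sqrt ?sqr_ge0//.
rewrite sqrrD !real_normK ?num_real// -addrA lerD2l lerDr mulrn_wge0//.
Qed.

Lemma normc_sum (I : Type) (s : seq I) (h : I -> R[i]) :
  normc (\sum_(i <- s) h i) <= \sum_(i <- s) normc (h i).
Proof.
elim: s => [|i s ih]; first by rewrite !big_nil Normc.normc0.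
by rewrite !big_cons (le_trans (le_normcD _ _))// lerD2l.
Qed.

Lemma normc_cexpi (t : R) : normc (cexpi t) = 1.
Proof. by rewrite /= cos2Dsin2 sqrtr1. Qed.

Lemma cexpiD (s t : R) : cexpi (s + t) = cexpi s * cexpi t.
Proof.
apply: complex_ReIm_eq; rewrite ?cReM ?cImM /= ?cosD ?sinD//.
by rewrite addrC.
Qed.

Section measurability.
Context d (T : measurableType d).
Implicit Types f g : T -> R[i].

Definition cmeasurable f :=
  measurable_fun setT (fun x => Re (f x)) /\ measurable_fun setT (fun x => Im (f x)).

Lemma cmeasurable_cst c : cmeasurable (fun=> c).
Proof. by split; exact: measurable_cst. Qed.

Lemma cmeasurable_real (f : T -> R) : measurable_fun setT f ->
  cmeasurable (fun x => (f x)%:C).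
Proof. by split => //; exact: measurable_cst. Qed.

Lemma cmeasurableM f g : cmeasurable f -> cmeasurable g ->
  cmeasurable (fun x => f x * g x).
Proof.
move=> [f1 f2] [g1 g2]; split.
  under eq_fun do rewrite cReM.
  by apply: measurable_funB; apply: measurable_funM.
under eq_fun do rewrite cImM.
by apply: measurable_funD; apply: measurable_funM.
Qed.

Lemma cmeasurable_cexpi (f : T -> R) : measurable_fun setT f ->
  cmeasurable (fun x => cexpi (f x)).
Proof.
move=> mf; split => /=.
  apply: (@measurableT_comp _ _ _ _ _ _ cos) => //.
  apply: continuous_measurable_fun; exact: continuous_cos.
apply: (@measurableT_comp _ _ _ _ _ _ sin) => //.
apply: continuous_measurable_fun; exact: continuous_sin.
Qed.

Lemma cmeasurable_comp d' (T' : measurableType d') f (g : T' -> T) :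
  cmeasurable f -> measurable_fun setT g ->
  measurable_fun setT (fun x => Re (f (g x))) /\ measurable_fun setT (fun x => Im (f (g x))).
Proof. by move=> [f1 f2] mg; split; [exact: measurableT_comp f1 mg|exact: measurableT_comp f2 mg]. Qed.

Lemma cmeasurable_normc f : cmeasurable f -> measurable_fun setT (fun x => normc (f x)).
Proof.
move=> [f1 f2].
rewrite (_ : (fun x => _) = Num.sqrt \o (fun x => Re (f x) ^+ 2 + Im (f x) ^+ 2)); last first.
  by apply/funext => x /=; case: (f x).
apply: measurableT_comp.
  by apply: continuous_measurable_fun => x; exact: sqrt_continuous.
by apply: measurable_funD; apply: measurable_funX.
Qed.

End measurability.

Section integrability.
Context {n : nat}.
Let mu := @lebesgue_rV R n.
Implicit Types f g : 'rV[R]_n -> R[i].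

Definition cintegrable f := intR mu (fun x => Re (f x)) /\ intR mu (fun x => Im (f x)).

Lemma cintegrable_measurable f : cintegrable f -> cmeasurable f.
Proof. by move=> [h1 h2]; split; exact: intR_measurable (_ : intR mu _). Qed.

Lemma cintegrable_dom f (g : 'rV[R]_n -> R) : cmeasurable f ->
  (forall x, normc (f x) <= g x) -> intR mu g -> cintegrable f.
Proof.
move=> [m1 m2] fg ig; split; apply: (intR_le _ _ ig) => // x.
  exact: le_trans (Re_le_normc _) (fg x).
exact: le_trans (Im_le_normc _) (fg x).
Qed.

Lemma cintegrable_normc f : cintegrable f -> intR mu (fun x => normc (f x)).
Proof.
move=> fi; have [h1 h2] := fi.
apply: (@intR_le _ _ _ _ _ (fun x => `|Re (f x)| + `|Im (f x)|)).
- exact/cmeasurable_normc/cintegrable_measurable.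
- by move=> x; rewrite ger0_norm ?normc_ge0//; exact: normc_le_ReIm.
- by apply: intRD; exact: intR_norm.
Qed.

Lemma cintegrableP f : cintegrable f <-> cmeasurable f /\ intR mu (fun x => normc (f x)).
Proof.
split=> [fi|[mf fi]]; last exact: (cintegrable_dom mf _ fi).
by split; [exact: cintegrable_measurable|exact: cintegrable_normc].
Qed.

Lemma cintegrable_real (f : 'rV[R]_n -> R) : intR mu f -> cintegrable (fun x => (f x)%:C).
Proof. by move=> fi; split => //=; exact: intR0. Qed.

Lemma cintegrableD f g : cintegrable f -> cintegrable g -> cintegrable (fun x => f x + g x).
Proof.
move=> [f1 f2] [g1 g2]; split.
  by under eq_fun do rewrite cReD; exact: intRD.
by under eq_fun do rewrite cImD; exact: intRD.
Qed.

Lemma cintegrableZ c f : cintegrable f -> cintegrable (fun x => c * f x).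
Proof.
move=> fi; apply/cintegrableP; split.
  apply: cmeasurableM; [exact: cmeasurable_cst|exact: cintegrable_measurable].
under eq_fun do rewrite Normc.normcM.
by apply: intRZ; exact: cintegrable_normc.
Qed.

Lemma cintegrableM_bounded f g (M : R) : cintegrable f -> cmeasurable g ->
  (forall x, normc (g x) <= M) -> cintegrable (fun x => g x * f x).
Proof.
move=> fi mg gM.
apply: (@cintegrable_dom _ (fun x => M * normc (f x))).
- by apply: cmeasurableM => //; exact: cintegrable_measurable.
- by move=> x; rewrite Normc.normcM ler_wpM2r ?normc_ge0.
- by apply: intRZ; exact: cintegrable_normc.
Qed.

Lemma eq_cintegral f g : f =1 g -> cintegral f = cintegral g.
Proof. by move=> /funext ->. Qed.

Lemma cintegralD f g : cintegrable f -> cintegrable g ->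
  cintegral (fun x => f x + g x) = cintegral f + cintegral g.
Proof.
move=> [f1 f2] [g1 g2]; rewrite /cintegral.
under eq_Rintegral do rewrite cReD.
under [X in _ +i* X]eq_Rintegral do rewrite cImD.
by rewrite !RintegralD.
Qed.

Lemma cintegralZ c f : cintegrable f -> cintegral (fun x => c * f x) = c * cintegral f.
Proof.
move=> [f1 f2]; case: c => a b; rewrite /cintegral.
under eq_Rintegral do rewrite cReM/=.
under [X in _ +i* X]eq_Rintegral do rewrite cImM/=.
rewrite RintegralB ?RintegralD ?RintegralZl//; exact: intRZ.
Qed.

Lemma cintegralZr c f : cintegrable f -> cintegral (fun x => f x * c) = cintegral f * c.
Proof.
by move=> fi; rewrite mulrC -cintegralZ//; apply: eq_cintegral => x; rewrite mulrC.
Qed.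

Lemma cintegral0 : cintegral (fun _ : 'rV[R]_n => 0 : R[i]) = 0.
Proof. by rewrite /cintegral /= Rintegral_cst// mul0r. Qed.

Lemma cintegral_real (f : 'rV[R]_n -> R) :
  cintegral (fun x => (f x)%:C) = (\int[mu]_x f x)%:C.
Proof. by apply: complex_ReIm_eq => //=; rewrite Rintegral_cst// mul0r. Qed.

Lemma cintegrable_sum (I : Type) (s : seq I) (h : I -> 'rV[R]_n -> R[i]) :
  (forall i, cintegrable (h i)) -> cintegrable (fun x => \sum_(i <- s) h i x).
Proof.
move=> hi; elim: s => [|i s ih].
  under [fun=> _]eq_fun do rewrite big_nil.
  by split; exact: intR0.
under [fun=> _]eq_fun do rewrite big_cons.
exact: cintegrableD.
Qed.

Lemma cintegral_sum (I : Type) (s : seq I) (h : I -> 'rV[R]_n -> R[i]) :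
  (forall i, cintegrable (h i)) ->
  cintegral (fun x => \sum_(i <- s) h i x) = \sum_(i <- s) cintegral (h i).
Proof.
move=> hi; elim: s => [|i s ih].
  under [fun=> _]eq_fun do rewrite big_nil.
  by rewrite big_nil cintegral0.
under [fun=> _]eq_fun do rewrite big_cons.
by rewrite big_cons cintegralD ?ih//; exact: cintegrable_sum.
Qed.

(** The factor 2 comes from bounding the real and the imaginary part separately, through |z| <= |Re
    z| + |Im z|. *)
Lemma normc_cintegral_le f (g : 'rV[R]_n -> R) : cmeasurable f ->
  (forall x, normc (f x) <= g x) -> intR mu g ->
  normc (cintegral f) <= 2 * \int[mu]_x g x.
Proof.
move=> mf fg gi; have [h1 h2] := cintegrable_dom mf fg gi.
apply: (le_trans (normc_le_ReIm _)); rewrite mulr_natl mulr2n /=.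
by apply: lerD; apply: le_trans (le_normr_Rintegral _ _) _ => //;
  apply: le_Rintegral => //; try exact: intR_norm; move=> x _;
  apply: le_trans (fg x); [exact: Re_le_normc|exact: Im_le_normc].
Qed.

Lemma cintegral_affine (a : R) (b : 'rV[R]_n) f : 0 < a -> cintegrable f ->
  cintegrable (fun x : 'rV[R]_n => f (a *: x + b)) /\
  cintegral (fun x : 'rV[R]_n => f (a *: x + b)) = (a ^- n)%:C * cintegral f.
Proof.
move=> a0 [f1 f2].
have [i1 e1] := Rint_affine b a0 f1; have [i2 e2] := Rint_affine b a0 f2.
split => //; rewrite /cintegral e1 e2.
by apply: complex_ReIm_eq; rewrite ?cReM ?cImM/= !mul0r ?subr0 ?addr0.
Qed.

Lemma cintegral_dct (f_ : nat -> 'rV[R]_n -> R[i]) f (g : 'rV[R]_n -> R) :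
  (forall m, cmeasurable (f_ m)) ->
  (forall x, Re (f_ m x) @[m --> \oo] --> Re (f x)) ->
  (forall x, Im (f_ m x) @[m --> \oo] --> Im (f x)) ->
  intR mu g -> (forall m x, normc (f_ m x) <= g x) ->
  [/\ cintegrable f,
   Re (cintegral (f_ m)) @[m --> \oo] --> Re (cintegral f) &
   Im (cintegral (f_ m)) @[m --> \oo] --> Im (cintegral f)].
Proof.
move=> mf cR cI gi fg.
have [||||i1 c1] := @Rint_dct _ _ _ mu (fun m x => Re (f_ m x)) (fun x => Re (f x)) g.
- by move=> m; case: (mf m).
- exact: cR.
- exact: gi.
- by move=> m x; apply: le_trans (Re_le_normc _) (fg m x).
have [||||i2 c2] := @Rint_dct _ _ _ mu (fun m x => Im (f_ m x)) (fun x => Im (f x)) g.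
- by move=> m; case: (mf m).
- exact: cI.
- exact: gi.
- by move=> m x; apply: le_trans (Im_le_normc _) (fg m x).
by split.
Qed.

End integrability.

Lemma cintegral_fubini n (h : 'rV[R]_n * 'rV[R]_n -> R[i]) (G H : 'rV[R]_n -> R) :
  cmeasurable h -> intR (lebesgue_rV n) G -> intR (lebesgue_rV n) H ->
  (forall x y, normc (h (x, y)) <= G x * H y) ->
  cintegral (fun x => cintegral (fun y => h (x, y))) =
  cintegral (fun y => cintegral (fun x => h (x, y))).
Proof.
move=> [m1 m2] Gi Hi hGH.
have h1 x y : `|Re (h (x, y))| <= G x * H y := le_trans (Re_le_normc _) (hGH x y).
have h2 x y : `|Im (h (x, y))| <= G x * H y := le_trans (Im_le_normc _) (hGH x y).
have [_ _ e1] := fubini_dom m1 Gi Hi h1.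
have [_ _ e2] := fubini_dom m2 Gi Hi h2.
by apply: complex_ReIm_eq.
Qed.

End complex_integrals.

(** * The Laplace kernel and its Fourier transform *)

Section one_dimensional_integrals.
Context {R : realType}.
Local Notation leb := (@lebesgue_measure R).

(** The fundamental theorem on the half-line, doubled by symmetry. The derivative of F is prescribed
    only for x > 0, so that |x| may be replaced by x when a primitive is sought. *)
Lemma even_integral (f F : R -> R) (l : R) :
  (forall x, 0 <= f x) -> continuous f -> f =1 f \o -%R ->
  continuous F -> (forall x : R, 0 < x -> is_derive x (1 : R) F (f x)) ->
  F x @[x --> +oo] --> l ->
  intR leb f /\ \int[leb]_x f x = 2 * (l - F 0).
Proof.
move=> f0 cf evf cF dF Fl.
have e : (\int[leb]_x (f x)%:E = (2 * (l - F 0))%:E)%E.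
  rewrite ge0_symfun_integralT// (_ : [set x | _] = `[0, +oo[%classic); last first.
    by apply/seteqP; split => x/=; rewrite in_itv/= andbT.
  rewrite (@ge0_continuous_FTC2y _ f F 0 l)//.
  - exact: continuous_subspaceT.
  - by move=> x /dF[].
  - by apply: cvg_at_right_filter; exact: cF.
  - by move=> x; rewrite in_itv/= andbT => /dF[_ <-]; rewrite derive1E.
split; last by apply: EFin_inj; rewrite /Rintegral e.
have mf : measurable_fun [set: R] f by exact: continuous_measurable_fun.
apply/integrableP; split; first exact/measurable_EFinP.
under eq_integral do rewrite /= ger0_norm//.
by rewrite e ltry.
Qed.

(** Reflection preserves Lebesgue measure and exchanges the positive and negative parts of f. *)
Lemma odd_integral (f : R -> R) : intR leb f -> (forall x, f (- x) = - f x) ->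
  \int[leb]_x f x = 0.
Proof.
move=> fi oddf.
have mf : measurable_fun [set: measurableTypeR R] (EFin \o f) by exact: (measurable_int leb fi).
have h : (\int[leb]_x (EFin \o f)^\+ x = \int[leb]_x (EFin \o f)^\- x)%E.
  transitivity (\int[pushforward leb (-%R : R -> measurableTypeR R)]_x (EFin \o f)^\+ x)%E.
    apply: eq_measure_integral => A mA _; apply/esym; exact: lebesgue_measureN.
  rewrite ge0_integral_pushforward//=; last exact: measurable_funepos.
  rewrite preimage_setT; apply: eq_integral => x _ /=.
  by rewrite funeposE funenegE /= oddf.
by rewrite /Rintegral integralE h subee//; apply: integrable_fin_num => //; exact: integrable_funeneg.
Qed.

Lemma cauchy_integral : intR leb (fun x => (1 + x ^+ 2)^-1) /\
  \int[leb]_x (1 + x ^+ 2)^-1 = pi.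
Proof.
have d0 (x : R) : 1 + x ^+ 2 != 0 by rewrite gt_eqF// ltr_pwDl// sqr_ge0.
have [| | | | |h1 h2] := @even_integral (fun x => (1 + x ^+ 2)^-1) atan (pi / 2).
- by move=> x; rewrite invr_ge0 addr_ge0// sqr_ge0.
- move=> x; apply: cvgV; first exact: d0.
  by apply: cvgD; [exact: cvg_cst|exact: exprn_continuous].
- by move=> x /=; rewrite sqrrN.
- by move=> x; exact: continuous_atan.
- exact: cvgy_atan.
by split => //; rewrite h2 atan0 subr0 mulrC mulfVK// pnatr_eq0.
Qed.

Section exponential.
Variables (e : R) (e0 : 0 < e).

Lemma cvg_expRNM : expR (- (e * x)) @[x --> +oo] --> 0.
Proof.
apply: (@cvg_comp _ _ _ (fun x => e * x) (fun x => expR (- x)) _ +oo); last exact: cvgr_expR.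
exact: gt0_cvgMry.
Qed.

Lemma continuous_expRN_norm : continuous (fun s : R => expR (- (e * `|s|))).
Proof.
move=> s; apply: continuous_comp; last exact: continuous_expR.
apply: cvgN; apply: cvgM; [exact: cvg_cst|exact: norm_continuous].
Qed.


Lemma continuous_mulr_comp (g : R -> R) (k : R) : continuous g -> continuous (fun s => g (k * s)).
Proof.
move=> cg s; apply: (@continuous_comp _ _ _ (fun s => k * s) g); last exact: cg.
by apply: cvgM; [exact: cvg_cst|exact: cvg_id].
Qed.

Lemma laplace_integral : intR leb (fun s => expR (- (e * `|s|))) /\
  \int[leb]_s expR (- (e * `|s|)) = 2 / e.
Proof.
have [| | | | | |h1 h2] := @even_integral (fun s => expR (- (e * `|s|)))
  (fun s => - (e^-1 * expR (- (e * s)))) 0.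
- by move=> s; exact: expR_ge0.
- exact: continuous_expRN_norm.
- by move=> s /=; rewrite normrN.
- move=> s; apply: cvgN; apply: cvgM; first exact: cvg_cst.
  apply: continuous_comp; last exact: continuous_expR.
  by apply: cvgN; apply: cvgM; [exact: cvg_cst|exact: cvg_id].
- move=> s s0; rewrite ger0_norm ?ltW//; apply: is_derive_eq.
  by rewrite -[LHS]/(- (e^-1 * (expR (- (e * s)) * - (e * 1)))); field; rewrite ?d0 ?gt_eqF.
- rewrite -[X in _ --> X]oppr0; apply: cvgN; rewrite -(mulr0 e^-1).
  by apply: cvgM; [exact: cvg_cst|exact: cvg_expRNM].
by split => //; rewrite h2 mulr0 oppr0 expR0; field; rewrite ?d0 ?gt_eqF.
Qed.

Lemma laplace_cos_integrable (t : R) :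
  intR leb (fun s => expR (- (e * `|s|)) * cos (s * t)).
Proof.
have cc := @continuous_mulr_comp _ t (@continuous_cos R).
have [i1 _] := laplace_integral; apply: (intR_le _ _ i1).
  apply: continuous_measurable_fun => s; apply: cvgM.
    exact: continuous_expRN_norm.
  by under [X in X @ _]eq_fun do rewrite mulrC; rewrite mulrC; exact: cc.
by move=> s; rewrite normrM ger0_norm ?expR_ge0// ler_piMr ?expR_ge0// ler_norml cos_geN1 cos_le1.
Qed.

(** [even_integral] requires a nonnegative integrand, hence the detour through 1 + cos, of whose
    product with the exponential F is a primitive for s > 0; the integral of the exponential alone
    is cancelled at the end. *)
Lemma laplace_cos_integral (t : R) :
  \int[leb]_s (expR (- (e * `|s|)) * cos (s * t)) = 2 * e / (e ^+ 2 + t ^+ 2).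
Proof.
have d0 : e ^+ 2 + t ^+ 2 != 0 by rewrite gt_eqF// ltr_pwDl ?exprn_gt0// sqr_ge0.
pose F s := - (e^-1 * expR (- (e * s))) +
   expR (- (e * s)) * ((e ^+ 2 + t ^+ 2)^-1 * (- (e * cos (t * s)) + t * sin (t * s))).
have cE : continuous (fun s => expR (- (e * s))).
  move=> s; apply: continuous_comp; last exact: continuous_expR.
  by apply: cvgN; apply: cvgM; [exact: cvg_cst|exact: cvg_id].
have ct : continuous (fun s : R => cos (s * t)).
  under eq_fun do rewrite mulrC.
  exact/continuous_mulr_comp/continuous_cos.
have cc := @continuous_mulr_comp _ t (@continuous_cos R).
have cs := @continuous_mulr_comp _ t (@continuous_sin R).
have [| | | | | |h1 h2] := @even_integral (fun s => expR (- (e * `|s|)) * (1 + cos (s * t))) F 0.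
- by move=> s; rewrite mulr_ge0 ?expR_ge0// -lerBlDl sub0r cos_geN1.
- move=> s; apply: cvgM; first exact: continuous_expRN_norm.
  by apply: cvgD; [exact: cvg_cst|exact: ct].
- by move=> s /=; rewrite normrN mulNr cosN.
- move=> s; apply: cvgD.
    by apply: cvgN; apply: cvgM; [exact: cvg_cst|exact: cE].
  apply: cvgM; first exact: cE.
  apply: cvgM; first exact: cvg_cst.
  apply: cvgD; [apply: cvgN|]; apply: cvgM; first exact: cvg_cst.
  + exact: cc.
  + exact: cvg_cst.
  + exact: cs.
- move=> s s0; rewrite ger0_norm ?ltW//; apply: is_derive_eq.
  rewrite -[LHS]/(- (e^-1 * (expR (- (e * s)) * - (e * 1))) +
    (expR (- (e * s)) * ((e ^+ 2 + t ^+ 2)^-1 *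
      (- (e * (- sin (t * s) * (t * 1))) + t * (cos (t * s) * (t * 1)))) +
    ((e ^+ 2 + t ^+ 2)^-1 * (- (e * cos (t * s)) + t * sin (t * s))) *
      (expR (- (e * s)) * - (e * 1)))) (mulrC s t).
  by field; rewrite d0 gt_eqF.
- rewrite -[X in _ --> X]addr0; apply: cvgD.
    rewrite -[X in _ --> X]oppr0; apply: cvgN; rewrite -(mulr0 e^-1).
    by apply: cvgM; [exact: cvg_cst|exact: cvg_expRNM].
  pose C := (e ^+ 2 + t ^+ 2)^-1 * (e + `|t|).
  have hC : expR (- (e * x)) * C @[x --> +oo] --> 0.
    by rewrite -(mul0r C); apply: cvgM; [exact: cvg_expRNM|exact: cvg_cst].
  have hCN : - (expR (- (e * x)) * C) @[x --> +oo] --> 0.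
    by rewrite -[X in _ --> X]oppr0; exact: cvgN.
  apply: (squeeze_cvgr _ hCN hC); apply: nearW => x.
  rewrite -ler_norml normrM ger0_norm ?expR_ge0// ler_wpM2l ?expR_ge0//.
  rewrite normrM ger0_norm ?invr_ge0 ?addr_ge0 ?sqr_ge0//.
  rewrite /C ler_wpM2l ?invr_ge0 ?addr_ge0 ?sqr_ge0//.
  apply: (le_trans (ler_normD _ _)); rewrite normrN !normrM (ger0_norm (ltW e0)).
  by apply: lerD; apply: ler_piMr; rewrite ?normr_ge0 ?(ltW e0)// ler_norml ?cos_geN1 ?cos_le1 ?sin_geN1 ?sin_le1.
have [i1 v1] := laplace_integral.
have i2 := laplace_cos_integrable t.
have := h2; under eq_Rintegral do rewrite mulrDr mulr1.
rewrite RintegralD// v1 /F !mulr0 oppr0 expR0 cos0 sin0 !mulr1 !mul1r !mulr0 addr0.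
move=> h; apply: (@addrI _ (2 / e)); rewrite h; field.
by rewrite d0 gt_eqF.
Qed.

Lemma laplace_sin_integral (t : R) :
  intR leb (fun s => expR (- (e * `|s|)) * sin (s * t)) /\
  \int[leb]_s (expR (- (e * `|s|)) * sin (s * t)) = 0.
Proof.
have cs := @continuous_mulr_comp _ t (@continuous_sin R).
have [i1 v1] := laplace_integral.
have i2 : intR leb (fun s => expR (- (e * `|s|)) * sin (s * t)).
  apply: (intR_le _ _ i1).
    apply: continuous_measurable_fun => s; apply: cvgM.
      exact: continuous_expRN_norm.
    by under [X in X @ _]eq_fun do rewrite mulrC; rewrite mulrC; exact: cs.
  by move=> s; rewrite normrM ger0_norm ?expR_ge0// ler_piMr ?expR_ge0// ler_norml sin_geN1 sin_le1.
split => //; apply: odd_integral => // s.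
by rewrite normrN mulNr sinN mulrN.
Qed.

End exponential.
End one_dimensional_integrals.

(** * Products over the coordinates: from dimension one to dimension n *)

Section tensor_products.
Context {R : realType}.
Local Notation leb := (@lebesgue_measure R).

Definition tailV n (x : 'rV[R]_n.+1) : 'rV[R]_n := \row_i x 0 (lift ord0 i).

Lemma tensor_integral n (a : R -> R) (b : 'rV[R]_n -> R) :
  intR leb a -> intR (lebesgue_rV n) b ->
  intR (lebesgue_rV n.+1) (fun x : 'rV[R]_n.+1 => a (x 0 0) * b (tailV x)) /\
  \int[lebesgue_rV n.+1]_x (a (x 0 0) * b (tailV x)) =
    (\int[leb]_t a t) * \int[lebesgue_rV n]_v b v.
Proof.
move=> ai bi.
pose f (x : 'rV[R]_n.+1) := a (x 0 0) * b (tailV x).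
have fE (p : R * 'rV[R]_n) : f (consrV p) = a p.1 * b p.2.
  have := consrVK p; rewrite /unconsrV; case: p => t v [e1 e2].
  by rewrite /f/= e1 /tailV e2.
have mf : measurable_fun [set: 'rV[R]_n.+1] f.
  have -> : f = (fun p => a p.1 * b p.2) \o @unconsrV R n by [].
  apply: measurableT_comp; last exact: measurable_unconsrV.
  apply: measurable_funM.
    exact: (measurableT_comp (intR_measurable ai) measurable_fst).
  exact: (measurableT_comp (intR_measurable bi) measurable_snd).
have mfc : measurable_fun [set: measurableTypeR R * 'rV[R]_n] (fun p : measurableTypeR R * 'rV[R]_n => f (consrV p)).
  by apply: (measurableT_comp mf); exact: measurable_consrV.
have fi : intR (lebesgue_rV n.+1) f.
  apply/integrableP; split; first exact/measurable_EFinP.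
  rewrite ge0_integral_rVS//; last first.
    by apply: measurableT_comp => //; exact/measurable_EFinP.
  under eq_integral => t _.
    under eq_integral do rewrite /= fE /= normrM EFinM.
    rewrite ge0_integralZl_EFin//; last first.
      by apply/measurable_EFinP; apply: measurableT_comp => //; exact: intR_measurable bi.
    over.
  rewrite /=.
  under eq_integral do rewrite -EFin_Rint ?intR_norm// muleC.
  rewrite ge0_integralZl_EFin//; last 2 first.
  - by apply/measurable_EFinP; apply: measurableT_comp => //; exact: intR_measurable ai.
  - by apply: Rintegral_ge0.
  by rewrite -EFin_Rint ?intR_norm// -EFinM ltry.
split => //; apply: EFin_inj; rewrite -/f EFin_Rint//.
have ifc : (leb \x lebesgue_rV n)%E.-integrable setT (fun p => (f (consrV p))%:E).
  apply/integrableP; split; first exact/measurable_EFinP.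
  case/integrableP : fi => _; rewrite /= ge0_integral_pushforward//; last 2 first.
  - exact: measurable_consrV.
  - by apply/measurable_EFinP; exact: measurableT_comp.
rewrite /= integral_pushforward//; last 2 first.
- exact: measurable_consrV.
- exact/measurable_EFinP.
rewrite preimage_setT -(integral12_prod_meas1 ifc) /fubini_F.
under eq_integral => t _.
  under eq_integral do rewrite fE /= EFinM.
  rewrite integralZl// -EFin_Rint// -EFinM mulrC EFinM.
  over.
by rewrite /= integralZl// -EFin_Rint// -EFinM mulrC.
Qed.

Definition prodV n (h : R -> R) (x : 'rV[R]_n) : R := \prod_(i < n) h (x 0 i).

Lemma prodVS n (h : R -> R) (x : 'rV[R]_n.+1) : prodV h x = h (x 0 0) * prodV h (tailV x).
Proof.
rewrite /prodV big_ord_recl; congr (_ * _); apply: eq_bigr => i _.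
by rewrite mxE.
Qed.

Lemma Rintegral_rV0 : \int[@lebesgue_rV R 0]_x 1 = 1.
Proof.
rewrite Rintegral_cst// mul1r.
have h : \d_(0 : 'rV[R]_0) [set: 'rV[R]_0] = 1%E :> \bar R by rewrite diracT.
exact: (congr1 fine h).
Qed.

Lemma prodV_integral n (h : R -> R) : intR leb h ->
  intR (lebesgue_rV n) (prodV h) /\
  \int[lebesgue_rV n]_x prodV h x = (\int[leb]_t h t) ^+ n.
Proof.
move=> hi; elim: n => [|n [ih1 ih2]].
  have e : prodV h = (fun=> 1) :> ('rV[R]_0 -> R) by apply/funext => x; rewrite /prodV big_ord0.
  rewrite e; split.
    by apply: measurable_bounded_integrable => //=; [rewrite diracT ltry|exists 1; split => // M M1 x _; rewrite /= normr1 ltW].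
  by rewrite Rintegral_rV0.
have [h1 h2] := tensor_integral hi ih1.
rewrite exprS -ih2 -h2; split.
  by move: h1; apply: eq_integrable => // x _ /=; rewrite prodVS.
by apply: eq_Rintegral => x _; rewrite prodVS.
Qed.

Lemma dotrS n (x y : 'rV[R]_n.+1) : dotr x y = x 0 0 * y 0 0 + dotr (tailV x) (tailV y).
Proof.
rewrite /dotr big_ord_recl; congr (_ + _); apply: eq_bigr => i _.
by rewrite !mxE.
Qed.

(** exp(- e |x|_1), used in place of a Gaussian as summation kernel: it splits over the coordinates,
    and its transform is a product of Poisson kernels obtained from elementary primitives. *)
Definition laplaceV n (e : R) : 'rV[R]_n -> R := prodV (fun s => expR (- (e * `|s|))).

(** The cosine and sine transforms go through the induction on the dimension together, since the
    addition formulas mix them. *)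
Lemma laplaceV_fourier n (e : R) (t : 'rV[R]_n) : 0 < e ->
  [/\ intR (lebesgue_rV n) (fun x => laplaceV e x * cos (dotr x t)),
      intR (lebesgue_rV n) (fun x => laplaceV e x * sin (dotr x t)),
      \int[lebesgue_rV n]_x (laplaceV e x * cos (dotr x t)) =
        prodV (fun s => 2 * e / (e ^+ 2 + s ^+ 2)) t &
      \int[lebesgue_rV n]_x (laplaceV e x * sin (dotr x t)) = 0].
Proof.
move=> e0; elim: n t => [|n ih] t.
  have e1 (x : 'rV[R]_0) : laplaceV e x = 1 by rewrite /laplaceV /prodV big_ord0.
  have e2 (x : 'rV[R]_0) : dotr x t = 0 by rewrite /dotr big_ord0.
  have i1 : intR (@lebesgue_rV R 0) (fun=> 1).
    have [] := prodV_integral 0 (@laplace_integral R e e0).1 => + _.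
    by apply: eq_integrable => // x _ /=; rewrite -(e1 x).
  split.
  - by apply: eq_integrable i1 => // x _ /=; rewrite e1 e2 cos0 mulr1.
  - by apply: eq_integrable (intR0 _) => // x _ /=; rewrite e2 sin0 mulr0.
  - under eq_Rintegral do rewrite e1 e2 cos0 mulr1.
    by rewrite Rintegral_rV0 /prodV big_ord0.
  - under eq_Rintegral do rewrite e2 sin0 mulr0.
    by rewrite Rintegral_cst// mul0r.
have [ic is_ vc vs] := ih (tailV t).
have lc := laplace_cos_integral e0 (t 0 0).
have [ils ls] := laplace_sin_integral e0 (t 0 0).
have ilc := laplace_cos_integrable e0 (t 0 0).
have [icc vcc] := tensor_integral ilc ic.
have [ics vcs] := tensor_integral ilc is_.
have [isc vsc] := tensor_integral ils ic.
have [iss vss] := tensor_integral ils is_.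
have ec (x : 'rV[R]_n.+1) : laplaceV e x * cos (dotr x t) =
    expR (- (e * `|x 0 0|)) * cos (x 0 0 * t 0 0) * (laplaceV e (tailV x) * cos (dotr (tailV x) (tailV t)))
  + -1 * (expR (- (e * `|x 0 0|)) * sin (x 0 0 * t 0 0) * (laplaceV e (tailV x) * sin (dotr (tailV x) (tailV t)))).
  by rewrite /laplaceV prodVS dotrS cosD; ring.
have es (x : 'rV[R]_n.+1) : laplaceV e x * sin (dotr x t) =
    expR (- (e * `|x 0 0|)) * sin (x 0 0 * t 0 0) * (laplaceV e (tailV x) * cos (dotr (tailV x) (tailV t)))
  + expR (- (e * `|x 0 0|)) * cos (x 0 0 * t 0 0) * (laplaceV e (tailV x) * sin (dotr (tailV x) (tailV t))).
  by rewrite /laplaceV prodVS dotrS sinD; ring.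
split.
- by under eq_fun do rewrite ec; apply: intRD => //; exact: intRZ.
- by under eq_fun do rewrite es; apply: intRD.
- under eq_Rintegral do rewrite ec.
  rewrite RintegralD// ?RintegralZl//; last exact: intRZ.
  by rewrite vcc vss vs mulr0 mulr0 addr0 lc vc prodVS.
- under eq_Rintegral do rewrite es.
  by rewrite RintegralD// vsc vcs vs ls mul0r mulr0 addr0.
Qed.

End tensor_products.

(** * Calculus of smooth functions *)

Section smooth_functions.
Context {R : realType} {n : nat}.
Implicit Types (f g : 'rV[R]_n -> R) (x y v : 'rV[R]_n).
Local Notation e_ k := (delta_mx 0 k : 'rV[R]_n).

(** A coinduction principle: P plays the role of an invariant stable under partial derivatives, and
    a smoothness proof amounts to guessing it. *)
Lemma smooth_coind (P : ('rV[R]_n -> R) -> Prop) :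
  (forall f, P f -> continuous f /\
     forall k, (forall x, derivable f x (e_ k)) /\ P (partial k f)) ->
  forall f, P f -> smooth f.
Proof.
move=> hP f Pf ks.
have Pks : P (partials ks f) by elim: ks => //= k ks /hP[_ /(_ k)[]].
by have [cks dks] := hP _ Pks; split => // k x; case: (dks k).
Qed.

Lemma smooth_continuous f : smooth f -> continuous f.
Proof. by move=> /(_ [::])[]. Qed.

Lemma smooth_derivable f k x : smooth f -> derivable f x (e_ k).
Proof. by move=> /(_ [::])[_]; exact. Qed.

Lemma smooth_partial f k : smooth f -> smooth (partial k f).
Proof. by move=> sf ks; have := sf (rcons ks k); rewrite /partials foldr_rcons. Qed.

Lemma partialD f g k : smooth f -> smooth g ->
  partial k (fun x => f x + g x) = (fun x => partial k f x + partial k g x).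
Proof.
by move=> sf sg; apply/funext => x; apply: deriveD; exact: smooth_derivable.
Qed.

Lemma partialM f g k : smooth f -> smooth g ->
  partial k (fun x => f x * g x) = (fun x => f x * partial k g x + g x * partial k f x).
Proof.
by move=> sf sg; apply/funext => x; apply: deriveM; exact: smooth_derivable.
Qed.

(** Differentiating a product or an inverse yields a larger expression, so the invariant for
    [smooth_coind] must be the whole algebra generated by the smooth functions under sums, products
    and inverses. *)
Inductive smooth_alg : ('rV[R]_n -> R) -> Prop :=
| SmoothBase f : smooth f -> smooth_alg f
| SmoothAdd f g : smooth_alg f -> smooth_alg g -> smooth_alg (fun x => f x + g x)
| SmoothMul f g : smooth_alg f -> smooth_alg g -> smooth_alg (fun x => f x * g x)
| SmoothInv f : smooth_alg f -> (forall x, f x != 0) -> smooth_alg (fun x => (f x)^-1).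

Lemma smooth_cst (c : R) : smooth (fun _ : 'rV[R]_n => c).
Proof.
apply: (@smooth_coind (fun f => exists c, f = fun=> c)); last by exists c.
move=> _ [d ->]; split; first exact: cst_continuous.
move=> k; split; first by move=> x; exact: derivable_cst.
by exists 0; apply/funext => x; exact: derive_cst.
Qed.

Lemma smooth_algP f : smooth_alg f -> smooth f.
Proof.
apply: smooth_coind => {}f; elim => {f}.
- move=> f sf; split; first exact: smooth_continuous.
  move=> k; split; first by move=> x; exact: smooth_derivable.
  exact/SmoothBase/smooth_partial.
- move=> f g fa [cf df] ga [cg dg]; split.
    by move=> x; exact: (cvgD (cf x) (cg x)).
  move=> k; have [{}df df'] := df k; have [{}dg dg'] := dg k; split.
    by move=> x; exact: derivableD.
  rewrite (_ : partial _ _ = fun x => partial k f x + partial k g x).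
    exact: SmoothAdd.
  by apply/funext => x; exact: deriveD.
- move=> f g fa [cf df] ga [cg dg]; split.
    by move=> x; exact: (cvgM (cf x) (cg x)).
  move=> k; have [{}df df'] := df k; have [{}dg dg'] := dg k; split.
    by move=> x; exact: derivableM.
  rewrite (_ : partial _ _ = fun x => f x * partial k g x + g x * partial k f x).
    by apply: SmoothAdd; exact: SmoothMul.
  by apply/funext => x; exact: deriveM.
- move=> f fa [cf df] f0; split.
    by move=> x; exact: (cvgV (f0 x) (cf x)).
  move=> k; have [{}df df'] := df k; split.
    by move=> x; exact: derivableV.
  rewrite (_ : partial _ _ = fun x => (-1 * ((f x)^-1 * (f x)^-1)) * partial k f x).
    have fVa : smooth_alg (fun x => (f x)^-1) by exact: SmoothInv.
    apply: SmoothMul => //; apply: SmoothMul; first exact/SmoothBase/smooth_cst.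
    exact: SmoothMul.
  by apply/funext => x; rewrite /partial deriveV// mulN1r -invfM -expr2.
Qed.

Lemma smoothD f g : smooth f -> smooth g -> smooth (fun x => f x + g x).
Proof. by move=> sf sg; apply/smooth_algP/SmoothAdd; exact: SmoothBase. Qed.

Lemma smoothM f g : smooth f -> smooth g -> smooth (fun x => f x * g x).
Proof. by move=> sf sg; apply/smooth_algP/SmoothMul; exact: SmoothBase. Qed.

Lemma smoothZ c f : smooth f -> smooth (fun x => c * f x).
Proof. by move=> sf; exact: (smoothM (smooth_cst c) sf). Qed.

Lemma smoothV f : smooth f -> (forall x, f x != 0) -> smooth (fun x => (f x)^-1).
Proof. by move=> sf f0; apply/smooth_algP/SmoothInv => //; exact: SmoothBase. Qed.

Lemma partialZ c f k : smooth f -> partial k (fun x => c * f x) = (fun x => c * partial k f x).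
Proof.
move=> sf; rewrite (partialM _ (@smooth_cst c) sf); apply/funext => x.
by rewrite [X in _ + _ * X]derive_cst mulr0 addr0.
Qed.

Lemma smooth_sum (I : Type) (s : seq I) (h : I -> 'rV[R]_n -> R) :
  (forall i, smooth (h i)) -> smooth (fun x => \sum_(i <- s) h i x).
Proof.
move=> hi; elim: s => [|i s ih].
  by under [fun=> _]eq_fun do rewrite big_nil; exact: smooth_cst.
under [fun=> _]eq_fun do rewrite big_cons.
exact: (smoothD (hi i) ih).
Qed.

Lemma partial_sum (I : Type) (s : seq I) (h : I -> 'rV[R]_n -> R) k :
  (forall i, smooth (h i)) ->
  partial k (fun x => \sum_(i <- s) h i x) = (fun x => \sum_(i <- s) partial k (h i) x).
Proof.
move=> hi; elim: s => [|i s ih].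
  under [fun=> _]eq_fun do rewrite big_nil.
  by apply/funext => x; rewrite big_nil; exact: derive_cst.
under [fun=> _]eq_fun do rewrite big_cons.
rewrite partialD//; last exact: smooth_sum.
by apply/funext => x; rewrite big_cons ih.
Qed.

(** Restriction to a line reduces a directional derivative to one real variable, where the
    derivative can be inferred from the expression. *)
Lemma is_derive_line f x v (d : R) :
  is_derive (0 : R) (1 : R) (fun h : R => f (h *: v + x)) d -> is_derive x v f d.
Proof.
move=> [d1 d2]; split; first exact/derivable1P.
have e : (fun h : R => h^-1 *: ((f \o shift x) (h *: v) - f x)) =
  (fun h : R => h^-1 *: (((fun h : R => f (h *: v + x)) \o shift 0) (h *: (1 : R)) - f (0 *: v + x))).
  by apply/funext => h /=; rewrite addr0 scale0r add0r [_%:A]mulr1.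
by rewrite /derive e.
Qed.

Lemma derivable_line f v x : (forall y, derivable f y v) ->
  forall s : R, is_derive s (1 : R) (fun h : R => f (h *: v + x)) ('D_v f (s *: v + x)).
Proof.
move=> df s; have h := derivableP (df (s *: v + x)).
have [d1 d2] := h.
have e : (fun h0 : R => h0^-1 *: ((f \o shift (s *: v + x)) (h0 *: v) - f (s *: v + x))) =
  (fun h0 : R => h0^-1 *: (((fun h : R => f (h *: v + x)) \o shift s) (h0 *: (1 : R)) - f (s *: v + x))).
  by apply/funext => h0 /=; rewrite [_%:A]mulr1 scalerDl addrA.
split; first by rewrite /derivable -e; exact: d1.
by rewrite /derive -e.
Qed.

Lemma dotrDl x y v : dotr (x + y) v = dotr x v + dotr y v.
Proof. by rewrite /dotr -big_split; apply: eq_bigr => i _; rewrite mxE mulrDl. Qed.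

Lemma dotrZl a x v : dotr (a *: x) v = a * dotr x v.
Proof. by rewrite /dotr mulr_sumr; apply: eq_bigr => i _; rewrite mxE mulrA. Qed.

Lemma dotrC x y : dotr x y = dotr y x.
Proof. by apply: eq_bigr => i _; rewrite mulrC. Qed.

Lemma dotrDr x y v : dotr v (x + y) = dotr v x + dotr v y.
Proof. by rewrite dotrC dotrDl !(dotrC v). Qed.

Lemma dotrZr a x v : dotr v (a *: x) = a * dotr v x.
Proof. by rewrite dotrC dotrZl (dotrC v). Qed.

Lemma dotr_delta k v : dotr (e_ k) v = v 0 k.
Proof.
rewrite /dotr (bigD1 k)//= mxE !eqxx mul1r big1 ?addr0// => i ik.
by rewrite mxE (negbTE ik) andbF mul0r.
Qed.

Lemma continuous_coord i : continuous (fun x => x 0 i).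
Proof. exact: coord_continuous. Qed.

Lemma smooth_coord i : smooth (fun x => x 0 i).
Proof.
pose P f := smooth f \/ f = (fun x => x 0 i).
apply: (@smooth_coind P); last by right.
move=> f [sf|->].
  split; first exact: smooth_continuous.
  move=> k; split; first by move=> x; exact: smooth_derivable.
  by left; exact: smooth_partial.
have dk k x : is_derive x (e_ k) (fun x : 'rV[R]_n => x 0 i) (e_ k 0 i : R).
  apply: is_derive_line; rewrite (_ : (fun _ => _) = fun h : R => h * e_ k 0 i + x 0 i); last first.
    by apply/funext => h; rewrite !mxE.
  by apply: is_derive_eq; rewrite addr0 -[LHS]/(0 * 0 + e_ k 0 i * 1) mulr1 mul0r add0r.
split; first exact: continuous_coord.
move=> k; split; first by move=> x; case: (dk k x).
left; rewrite (_ : partial _ _ = fun=> e_ k 0 i); first exact: smooth_cst.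
by apply/funext => x; rewrite /partial derive_val.
Qed.

Lemma smooth_dotr v : smooth (fun x => dotr x v).
Proof.
by apply: smooth_sum => i; exact: (smoothM (smooth_coord i) (smooth_cst _)).
Qed.

Lemma continuous_dotr v : continuous (fun x => dotr x v).
Proof. exact/smooth_continuous/smooth_dotr. Qed.

Lemma is_derive_cos_dotr v k x :
  is_derive x (e_ k) (fun x => cos (dotr x v)) (- v 0 k * sin (dotr x v)).
Proof.
apply: is_derive_line; rewrite (_ : (fun _ => _) = fun h : R => cos (h * v 0 k + dotr x v)); last first.
  by apply/funext => h; rewrite dotrDl dotrZl dotr_delta.
apply: is_derive_eq; rewrite mul0r add0r.
by rewrite -[LHS]/(- sin (dotr x v) * (0 * 0 + v 0 k * 1 + 0)); ring.
Qed.

Lemma is_derive_sin_dotr v k x :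
  is_derive x (e_ k) (fun x => sin (dotr x v)) (v 0 k * cos (dotr x v)).
Proof.
apply: is_derive_line; rewrite (_ : (fun _ => _) = fun h : R => sin (h * v 0 k + dotr x v)); last first.
  by apply/funext => h; rewrite dotrDl dotrZl dotr_delta.
apply: is_derive_eq; rewrite mul0r add0r.
by rewrite -[LHS]/(cos (dotr x v) * (0 * 0 + v 0 k * 1 + 0)); ring.
Qed.

Lemma partial_cos v k : partial k (fun x => cos (dotr x v)) = (fun x => - v 0 k * sin (dotr x v)).
Proof.
by apply/funext => x; have [_ <-] := is_derive_cos_dotr v k x.
Qed.

Lemma partial_sin v k : partial k (fun x => sin (dotr x v)) = (fun x => v 0 k * cos (dotr x v)).
Proof.
by apply/funext => x; have [_ <-] := is_derive_sin_dotr v k x.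
Qed.

(** The span of cos(x . v) and sin(x . v) is stable under partial derivatives, which neither
    function is alone. *)
Lemma smooth_trig v a b : smooth (fun x => a * cos (dotr x v) + b * sin (dotr x v)).
Proof.
apply: (@smooth_coind (fun f => exists a b, f = fun x => a * cos (dotr x v) + b * sin (dotr x v))); last by exists a, b.
have cc : continuous (fun x => cos (dotr x v)).
  by move=> x; apply: continuous_comp; [exact: continuous_dotr|exact: continuous_cos].
have cs : continuous (fun x => sin (dotr x v)).
  by move=> x; apply: continuous_comp; [exact: continuous_dotr|exact: continuous_sin].
move=> _ {a b} [a [b ->]]; split.
  by move=> x; exact: (cvgD (cvgM (cvg_cst a) (cc x)) (cvgM (cvg_cst b) (cs x))).
move=> k; split.
  move=> x; have [dc _] := is_derive_cos_dotr v k x.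
  have [ds _] := is_derive_sin_dotr v k x.
  exact: (derivableD (derivableM (derivable_cst a _ _) dc) (derivableM (derivable_cst b _ _) ds)).
exists (b * v 0 k), (- (a * v 0 k)); apply/funext => x.
have [dc vc] := is_derive_cos_dotr v k x.
have [ds vs] := is_derive_sin_dotr v k x.
have dac := derivableM (derivable_cst a x (e_ k)) dc.
have dbs := derivableM (derivable_cst b x (e_ k)) ds.
rewrite /partial; have -> := deriveD dac dbs.
have -> := deriveM (derivable_cst a x (e_ k)) dc.
have -> := deriveM (derivable_cst b x (e_ k)) ds.
rewrite vc vs !derive_cst.
rewrite -[LHS]/(a * (- v 0 k * sin (dotr x v)) + cos (dotr x v) * 0 + (b * (v 0 k * cos (dotr x v)) + sin (dotr x v) * 0)).
ring.
Qed.

Lemma smooth_cos v : smooth (fun x => cos (dotr x v)).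
Proof.
have := smooth_trig v 1 0; rewrite (_ : (fun _ => _) = fun x => cos (dotr x v))//.
by apply/funext => x; ring.
Qed.

Lemma smooth_sin v : smooth (fun x => sin (dotr x v)).
Proof.
have := smooth_trig v 0 1; rewrite (_ : (fun _ => _) = fun x => sin (dotr x v))//.
by apply/funext => x; ring.
Qed.

Lemma is_derive_dilation f a v x : (forall y, derivable f y v) ->
  is_derive x v (fun x => f (a *: x)) (a * 'D_v f (a *: x)).
Proof.
move=> df; apply: is_derive_line.
rewrite (_ : (fun _ => _) = (fun h => f (h *: v + a *: x)) \o (fun h : R => a * h)); last first.
  by apply/funext => h /=; rewrite scalerDr scalerA.
have := derivable_line (a *: x) df (a * 0); rewrite mulr0 scale0r add0r => h.
have d2 : is_derive (0 : R) (1 : R) (fun h : R => a * h) a.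
  by apply: is_derive_eq; rewrite -[LHS]/(a * 1); rewrite mulr1.
have := @is_derive1_comp _ (fun h => f (h *: v + a *: x)) (fun h : R => a * h) 0 _ _ _ d2.
by rewrite mulr0 mulrC; exact.
Qed.

Lemma partial_dilation f a k : smooth f ->
  partial k (fun x => f (a *: x)) = (fun x => a * partial k f (a *: x)).
Proof.
move=> sf; apply/funext => x.
by have [|_ <-//] := @is_derive_dilation f a (e_ k) x; move=> y; exact: smooth_derivable.
Qed.

Lemma smooth_dilation f a : smooth f -> smooth (fun x => f (a *: x)).
Proof.
(* The scalar c collects the factors a produced by the chain rule. *)
move=> sf; apply: (@smooth_coind (fun g => exists c f, smooth f /\ g = fun x => c * f (a *: x))); last first.
  by exists 1, f; split => //; apply/funext => x; rewrite mul1r.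
move=> _ [c [g [sg ->]]]; split.
  have cg : continuous (fun x => g (a *: x)).
    move=> x; apply: (@continuous_comp _ _ _ (fun x => a *: x) g); last exact: smooth_continuous.
    exact: scaler_continuous.
  by move=> x; exact: (cvgM (cvg_cst c) (cg x)).
have dg k x : is_derive x (e_ k) (fun x => g (a *: x)) (a * partial k g (a *: x)).
  by apply: is_derive_dilation => y; exact: smooth_derivable.
move=> k; split.
  by move=> x; have [d1 _] := dg k x; exact: (derivableM (derivable_cst c _ _) d1).
exists (c * a), (partial k g); split; first exact: smooth_partial.
apply/funext => x; have [d1 d2] := dg k x.
rewrite /partial; have -> := deriveM (derivable_cst c x (e_ k)) d1.
rewrite d2 derive_cst -[LHS]/(c * (a * partial k g (a *: x)) + g (a *: x) * 0).
by rewrite mulr0 addr0 mulrA.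
Qed.

End smooth_functions.

Arguments smooth_continuous {R n f} sf x : rename.
Arguments continuous_coord {R n} i x : rename.
Arguments continuous_dotr {R n} v x : rename.

(** * Compactly supported smooth functions *)

Section test_functions.
Context {R : realType} {n : nat}.
Implicit Types (f g : 'rV[R]_n -> R) (x y v : 'rV[R]_n).
Local Notation e_ k := (delta_mx 0 k : 'rV[R]_n).
Local Notation mu := (@lebesgue_rV R n).

Definition test_fun f :=
  smooth f /\ exists r : R, forall x i, r < `|x 0 i| -> f x = 0.

Lemma test_funD f g : test_fun f -> test_fun g -> test_fun (fun x => f x + g x).
Proof.
move=> [sf [r fr]] [sg [s gs]]; split; first exact: smoothD.
exists (Num.max r s) => x i; rewrite gt_max => /andP[rx sx].
by rewrite (fr x i)// (gs x i)// addr0.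
Qed.

Lemma test_funM f g : test_fun f -> smooth g -> test_fun (fun x => f x * g x).
Proof.
move=> [sf [r fr]] sg; split; first exact: smoothM.
by exists r => x i rx; rewrite (fr x i)// mul0r.
Qed.

Lemma test_funMl f g : smooth g -> test_fun f -> test_fun (fun x => g x * f x).
Proof. by move=> sg tf; under eq_fun do rewrite mulrC; exact: test_funM. Qed.

Lemma test_funZ c f : test_fun f -> test_fun (fun x => c * f x).
Proof. by move=> tf; exact: (test_funMl (smooth_cst c) tf). Qed.

Lemma test_fun0 : test_fun (fun=> 0).
Proof. by split; [exact: smooth_cst|exists 0]. Qed.

Lemma test_fun_sum (I : Type) (s : seq I) (h : I -> 'rV[R]_n -> R) :
  (forall i, test_fun (h i)) -> test_fun (fun x => \sum_(i <- s) h i x).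
Proof.
move=> hi; elim: s => [|i s ih].
  by under [fun=> _]eq_fun do rewrite big_nil; exact: test_fun0.
under [fun=> _]eq_fun do rewrite big_cons.
exact: (test_funD (hi i) ih).
Qed.

Lemma test_fun_dilation a f : a != 0 -> test_fun f -> test_fun (fun x => f (a *: x)).
Proof.
move=> a0 [sf [r fr]]; split; first exact: smooth_dilation.
exists (r / `|a|) => x i; rewrite ltr_pdivrMr ?normr_gt0// => h.
by apply: (fr _ i); rewrite mxE normrM mulrC.
Qed.

Lemma test_fun_partial k f : test_fun f -> test_fun (partial k f).
Proof.
move=> [sf [r fr]]; split; first exact: smooth_partial.
exists r => x i rx; rewrite /partial (@near_eq_derive _ _ _ f (cst 0)) ?derive_cst//.
have : \forall y \near x, r < `|(y : 'rV[R]_n) 0 i|.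
  have h : \forall y \near nbhs x, r < `|(y : 'rV[R]_n) 0 i|.
    apply: (@cvgr_gt R _ (nbhs x) _ (fun y : 'rV[R]_n => `|y 0 i|) `|x 0 i|); last exact: rx.
    by apply: cvg_norm; exact: continuous_coord.
  exact: h.
by apply: filterS => y /fr.
Qed.

Lemma test_fun_partials ks f : test_fun f -> test_fun (partials ks f).
Proof. by move=> tf; elim: ks => //= k ks ih; exact: test_fun_partial. Qed.

Lemma test_fun_bounded f : test_fun f -> exists2 M : R, 0 <= M & forall x, `|f x| <= M.
Proof.
move=> [sf [r fr]].
pose B := [set v : 'rV[R]_n | forall i, `[- `|r|, `|r|]%classic (v ord0 i)].
have cB : compact B by apply: (@rV_compact _ _ (fun=> `[- `|r|, `|r|]%classic)) => i; exact: segment_compact.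
have B0 : B 0.
  by move=> i; rewrite /= mxE in_itv/= oppr_le0 normr_ge0.
have cf : {within B, continuous (fun x => `|f x|)}.
  have cnf : continuous (fun x => `|f x|).
    move=> x; apply: (@continuous_comp _ _ _ f (fun t : R => `|t|)); last exact: norm_continuous.
    exact: (smooth_continuous sf x).
  exact: continuous_subspaceT.
have [c Bc hc] := @EVT_max_rV R n (fun x => `|f x|) B (ex_intro _ 0 B0) cB cf.
exists `|f c| => // x.
have [Bx|/existsNP[i hi]] := pselect (B x); first by apply: hc; rewrite inE.
rewrite (fr x i) ?normr0//.
move: hi; rewrite /= in_itv/= => /negP; rewrite negb_and -!ltNge => /orP[h|h].
  rewrite ltr0_norm; last by rewrite (lt_le_trans h)// oppr_le0.
  by rewrite (le_lt_trans (ler_norm r))// ltrNr.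
by rewrite (le_lt_trans (ler_norm r))// (lt_le_trans h)// ler_norm.
Qed.

(** Indicator of the cube of half-side r, written as a product so that its integral comes from
    [prodV_integral]; multiples of it dominate compactly supported functions. *)
Definition box (r : R) : 'rV[R]_n -> R := prodV \1_(`[- r, r] : set R).

Lemma box_ge0 r x : 0 <= box r x.
Proof. by apply: prodr_ge0 => i _; rewrite indicE ler0n. Qed.

Lemma box_in r x : (forall i, `|x 0 i| <= r) -> box r x = 1.
Proof.
move=> h; rewrite /box /prodV big1// => i _.
by rewrite indicE mem_set//= in_itv/= -ler_norml.
Qed.

Lemma intR_box r : intR mu (box r).
Proof.
have [] := @prodV_integral R n \1_(`[- r, r] : set R) _ => //.
exact: integrable_indic_itv.
Qed.

Lemma test_fun_dom f : test_fun f -> exists M r : R, 0 <= M /\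
  forall s x, r <= s -> `|f x| <= M * box s x.
Proof.
move=> tf; have [M M0 fM] := test_fun_bounded tf; have [_ [r fr]] := tf.
exists M, r; split => // s x rs.
have [h|/existsNP[i /negP]] := pselect (forall i, `|x 0 i| <= s).
  by rewrite box_in// mulr1.
rewrite -ltNge => si; rewrite (fr x i) ?normr0 ?mulr_ge0 ?box_ge0//.
exact: le_lt_trans si.
Qed.

Lemma test_fun_measurable f : test_fun f -> measurable_fun setT f.
Proof. by move=> [sf _]; apply: continuous_measurable_rV; exact: smooth_continuous. Qed.

Lemma test_fun_intR f : test_fun f -> intR mu f.
Proof.
move=> tf; have [M [r [M0 h]]] := test_fun_dom tf.
apply: (intR_le (test_fun_measurable tf) (fun x => h r x (lexx _))).
by apply: intRZ; exact: intR_box.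
Qed.

Lemma coord_le_enorm x i : `|x 0 i| <= enorm x.
Proof.
rewrite /enorm -sqrtr_sqr ler_wsqrtr// /dotr (bigD1 i)//= expr2 lerDl.
by apply: sumr_ge0 => j _; rewrite -expr2 sqr_ge0.
Qed.

Lemma dotr_ge0 x : 0 <= dotr x x.
Proof. by apply: sumr_ge0 => j _; rewrite -expr2 sqr_ge0. Qed.

Lemma enorm_le_sum x : enorm x <= \sum_i `|x 0 i|.
Proof.
have s0 : 0 <= \sum_i `|x 0 i| by apply: sumr_ge0.
rewrite /enorm -[leRHS]ger0_norm// -sqrtr_sqr ler_wsqrtr// expr2 mulr_suml.
apply: ler_sum => i _; apply: (@le_trans _ _ (`|x 0 i| * `|x 0 i|)).
  by rewrite -normrM ler_norm.
by rewrite ler_wpM2l// (bigD1 i)//= lerDl sumr_ge0.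
Qed.

Lemma test_fun_schwartz f : test_fun f -> schwartz f.
Proof.
move=> tf; split; first by case: tf.
move=> ks N; have := test_fun_partials ks tf => {}tf.
have [M M0 fM] := test_fun_bounded tf; have [_ [r fr]] := tf.
exists ((1 + \sum_(i < n) `|r|) ^+ N * M) => x.
have [h|/existsNP[i /negP]] := pselect (forall i, `|x 0 i| <= `|r|).
  apply: ler_pM => //; first by rewrite exprn_ge0// addr_ge0// sqrtr_ge0.
  rewrite lerXn2r ?nnegrE ?addr_ge0 ?sqrtr_ge0 ?sumr_ge0// lerD2l.
  by apply: (le_trans (enorm_le_sum x)); exact: ler_sum.
rewrite -ltNge => ri; rewrite (fr x i) ?normr0 ?mulr0.
  by rewrite mulr_ge0// exprn_ge0// addr_ge0// sumr_ge0.
exact: le_lt_trans (ler_norm _) ri.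
Qed.

Lemma difference_le f k (M : R) : smooth f -> (forall x, `|partial k f x| <= M) ->
  forall (h : R) x, 0 < h -> `|f (h *: e_ k + x) - f x| <= M * h.
Proof.
move=> sf fM h x h0.
have dF := @derivable_line _ _ f (e_ k) x (fun y => @smooth_derivable _ _ f k y sf).
have [|c _] := @MVT R (fun s => f (s *: e_ k + x)) (fun s => partial k f (s *: e_ k + x)) 0 h h0.
  by apply: derivable_within_continuous => s _; case: (dF s).
rewrite scale0r add0r subr0 => ->.
by rewrite normrM (ger0_norm (ltW h0)) ler_wpM2r// ltW.
Qed.

(** By translation invariance every difference quotient of f has integral zero, and dominated
    convergence passes to the derivative; the mean value theorem supplies the bound M. *)
Lemma Rint_partial f k : test_fun f -> \int[mu]_x partial k f x = 0.
Proof.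
move=> tf; have [sf [r fr]] := tf.
have [M M0 pM] := test_fun_bounded (test_fun_partial k tf).
pose g_ (m : nat) x := m.+1%:R * (f (m.+1%:R^-1 *: e_ k + x) - f x).
have fi := test_fun_intR tf.
have tfi m : intR mu (fun x => f (m.+1%:R^-1 *: e_ k + x)) /\
    \int[mu]_x f (m.+1%:R^-1 *: e_ k + x) = \int[mu]_x f x.
  have [h1 h2] := Rint_affine (m.+1%:R^-1 *: e_ k) (@ltr01 R) fi.
  split.
    by move: h1; apply: eq_integrable => // x _ /=; rewrite scale1r addrC.
  by rewrite expr1n invr1 mul1r in h2; rewrite -h2; apply: eq_Rintegral => x _; rewrite scale1r addrC.
have g0 m : \int[mu]_x g_ m x = 0.
  have [h1 h2] := tfi m.
  rewrite RintegralZl//; last first.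
    by apply: intRD => //; exact: intRN.
  by rewrite RintegralB// h2 subrr mulr0.
have gi m : measurable_fun setT (g_ m).
  have [h1 h2] := tfi m; apply: intR_measurable (_ : intR mu _).
  by apply: intRZ; apply: intRD => //; exact: intRN.
have cg x : g_ m x @[m --> \oo] --> partial k f x.
  have /cvg_ex[l hl] := @smooth_derivable _ _ f k x sf.
  have -> : partial k f x = l by apply: cvg_lim.
  have e m : g_ m x = (m.+1%:R^-1)^-1 *: ((f \o shift x) (m.+1%:R^-1 *: e_ k) - f x) by rewrite invrK.
  under eq_fun do rewrite e.
  apply: ((cvgr_dnbhsP (fun h : R => h^-1 *: ((f \o shift x) (h *: e_ k) - f x)) 0 l).1 hl (fun m => m.+1%:R^-1)).
  by split=> [m|]; [rewrite invr_eq0 pnatr_eq0|exact: cvg_harmonic].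
(* The increments are at most 1, so outside the cube of radius |r| + 1 both f and its translate
   vanish. *)
have dom m x : `|g_ m x| <= M * box (`|r| + 1) x.
  rewrite /g_ normrM ger0_norm//.
  have m1 : `|m.+1%:R^-1| <= 1 :> R by rewrite ger0_norm// invf_le1 ?ltr0n// ler1n.
  have [h|/existsNP[i /negP]] := pselect (forall i, `|x 0 i| <= `|r| + 1).
    rewrite box_in// mulr1 -ler_pdivlMl//.
    by rewrite mulrC; apply: difference_le => //; rewrite invr_gt0.
  rewrite -ltNge => ri.
  have rr : r < `|x 0 i| by rewrite (le_lt_trans _ ri)// (le_trans (ler_norm r))// lerDl.
  have r2 : r < `|(m.+1%:R^-1 *: e_ k + x) 0 i|.
    apply: (le_lt_trans (ler_norm r)); rewrite -(ltrD2r 1); apply: (lt_le_trans ri).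
    rewrite !mxE; set c := _ * _.
    have c1 : `|c| <= 1.
      rewrite normrM (le_trans (ler_wpM2r _ m1))// mul1r.
      by case: (_ && _); rewrite ?normr1 ?normr0.
    have := ler_normD (x 0 i + c) (- c); rewrite addrK normrN addrC => h.
    by rewrite (le_trans h)// addrC (addrC c) lerD2l.
  by rewrite (fr x i)// (fr _ i r2) subrr normr0 mulr0 mulr_ge0// box_ge0.
have [_] := Rint_dct gi cg (intRZ M (intR_box _)) dom.
rewrite (_ : (fun m => _) = fun=> 0); last by apply/funext => m; rewrite g0.
by move=> /(cvg_unique _ (cvg_cst _)) => <-.
Qed.

End test_functions.

(** * The Fourier transform *)

Section fourier_transform.
Context {R : realType} {n : nat}.
Local Open Scope complex_scope.
Implicit Types (x y xi : 'rV[R]_n).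
Local Notation mu := (@lebesgue_rV R n).
Local Notation normc := (@Normc.normc R).
Local Notation Re := (@complex.Re R).
Local Notation Im := (@complex.Im R).

Lemma dotr0 x : dotr x 0 = 0.
Proof. by rewrite /dotr big1// => i _; rewrite mxE mulr0. Qed.

Lemma dotrNr x y : dotr x (- y) = - dotr x y.
Proof. by rewrite -scaleN1r dotrZr mulN1r. Qed.

Lemma dotrNl x y : dotr (- x) y = - dotr x y.
Proof. by rewrite dotrC dotrNr dotrC. Qed.

Lemma measurable_dotr2 : measurable_fun setT (fun p : 'rV[R]_n * 'rV[R]_n => dotr p.1 p.2).
Proof.
apply: (@measurable_sum _ _ _ _ _ _ (fun i (p : 'rV[R]_n * 'rV[R]_n) => p.1 0 i * p.2 0 i)) => i.
apply: measurable_funM.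
  exact: (measurableT_comp (measurable_rV_coord i) measurable_fst).
exact: (measurableT_comp (measurable_rV_coord i) measurable_snd).
Qed.

Lemma measurable_dotr x : measurable_fun setT (fun y => dotr x y).
Proof.
apply: continuous_measurable_rV.
rewrite (_ : (fun y => dotr x y) = fun y => dotr y x); first exact: continuous_dotr.
by apply/funext => y; rewrite dotrC.
Qed.

Lemma measurable_dotrN x : measurable_fun setT (fun y => - dotr x y).
Proof.
apply: continuous_measurable_rV.
rewrite (_ : (fun y => - dotr x y) = fun y => dotr y (- x)); first exact: continuous_dotr.
by apply/funext => y; rewrite dotrNr dotrC.
Qed.

Lemma cmeasurable_character x : cmeasurable (fun xi : 'rV[R]_n => cexpi (dotr x xi)).
Proof. by apply: cmeasurable_cexpi; exact: measurable_dotr. Qed.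

(** A strictly positive integrable weight, serving as majorant of Fourier transforms and as the
    auxiliary factor that makes Fubini applicable to kernels of modulus one. *)
Definition decay : 'rV[R]_n -> R := prodV (fun t => (1 + t ^+ 2)^-1).

Lemma decay_gt0 x : 0 < decay x.
Proof.
by apply: prodr_gt0 => i _; rewrite invr_gt0 ltr_pwDl// sqr_ge0.
Qed.

Lemma intR_decay : intR mu decay.
Proof. by have [] := @prodV_integral R n _ cauchy_integral.1. Qed.

Lemma cintegrable_modulated (f : 'rV[R]_n -> R[i]) (t : 'rV[R]_n -> R) : cintegrable f ->
  measurable_fun setT t -> cintegrable (fun y => f y * cexpi (t y)).
Proof.
move=> fi mt; under eq_fun do rewrite mulrC.
apply: (@cintegrableM_bounded _ _ _ _ 1) => //; first exact: cmeasurable_cexpi.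
by move=> x; rewrite normc_cexpi.
Qed.

Lemma cintegrable_fourier (f : 'rV[R]_n -> R[i]) xi : cintegrable f ->
  cintegrable (fun y => f y * cexpi (- dotr y xi)).
Proof.
move=> fi; apply: cintegrable_modulated => //.
by under eq_fun do rewrite dotrC; exact: measurable_dotrN.
Qed.

(** The kernel f(x) e^(-i x . xi) is not integrable in (x, xi) jointly; multiplied by [decay] xi it
    is. Fubini then gives a measurable partial integral, which is divided by the positive weight
    again. *)
Lemma fourier_measurable (f : 'rV[R]_n -> R[i]) : cintegrable f -> cmeasurable (fourier f).
Proof.
move=> fi; pose h (p : 'rV[R]_n * 'rV[R]_n) := (f p.1 * cexpi (- dotr p.1 p.2)) * (decay p.2)%:C.
have mh : cmeasurable h.
  apply: cmeasurableM.
    apply: cmeasurableM.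
      exact: cmeasurable_comp (cintegrable_measurable fi) measurable_fst.
    by apply: cmeasurable_cexpi; apply: measurableT_comp => //; exact: measurable_dotr2.
  apply: cmeasurable_real.
  exact: (measurableT_comp (intR_measurable intR_decay) measurable_snd).
have hb x y : normc (h (x, y)) <= normc (f x) * decay y.
  by rewrite /h !Normc.normcM normc_cexpi mulr1 normc_real (gtr0_norm (decay_gt0 y)).
have nf := cintegrable_normc fi.
have e xi : cintegral (fun x => h (x, xi)) = fourier f xi * (decay xi)%:C.
  by rewrite /h /= cintegralZr//; exact: cintegrable_fourier.
have e2 xi : fourier f xi = ((decay xi)^-1)%:C * cintegral (fun x => h (x, xi)).
  rewrite e mulrC -mulrA -rmorphM/= divff ?mulr1// gt_eqF//; exact: decay_gt0.
have -> : fourier f = (fun xi => ((decay xi)^-1)%:C * cintegral (fun x => h (x, xi))).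
  by apply/funext => xi; exact: e2.
apply: cmeasurableM.
  apply: cmeasurable_real.
  rewrite (_ : (fun xi => _) = fun xi : 'rV[R]_n => \prod_i (1 + xi 0 i ^+ 2)); last first.
    apply/funext => xi; rewrite /decay /prodV -prodfV.
    by apply: eq_bigr => i _; rewrite invrK.
  apply: measurable_prod => i _; apply: measurable_funD => //.
  by apply: measurable_funX; exact: measurable_rV_coord.
have [_ i1 _] := fubini_dom mh.1 nf intR_decay (fun x y => le_trans (Re_le_normc _) (hb x y)).
have [_ i2 _] := fubini_dom mh.2 nf intR_decay (fun x y => le_trans (Im_le_normc _) (hb x y)).
by split; [exact: intR_measurable i1|exact: intR_measurable i2].
Qed.

Lemma fourier_bound (f : 'rV[R]_n -> R[i]) xi : cintegrable f ->
  normc (fourier f xi) <= 2 * \int[mu]_x normc (f x).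
Proof.
move=> fi; apply: normc_cintegral_le; last exact: cintegrable_normc.
  exact/cintegrable_measurable/cintegrable_fourier.
by move=> x; rewrite Normc.normcM normc_cexpi mulr1.
Qed.

Lemma fourierD (f g : 'rV[R]_n -> R[i]) xi : cintegrable f -> cintegrable g ->
  fourier (fun x => f x + g x) xi = fourier f xi + fourier g xi.
Proof.
move=> fi gi; rewrite /fourier -cintegralD; try exact: cintegrable_fourier.
by apply: eq_cintegral => x; rewrite mulrDl.
Qed.

Lemma fourierZ c (f : 'rV[R]_n -> R[i]) xi : cintegrable f ->
  fourier (fun x => c * f x) xi = c * fourier f xi.
Proof.
move=> fi; rewrite /fourier -cintegralZ; last exact: cintegrable_fourier.
by apply: eq_cintegral => x; rewrite mulrA.
Qed.

Lemma fourier_dilation (a : R) (f : 'rV[R]_n -> R[i]) xi : 0 < a -> cintegrable f ->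
  fourier (fun x => f (a *: x)) xi = (a ^- n)%:C * fourier f (a^-1 *: xi).
Proof.
move=> a0 fi; rewrite /fourier.
have [_ <-] := cintegral_affine 0 a0 (cintegrable_fourier (a^-1 *: xi) fi).
apply: eq_cintegral => x; rewrite addr0 dotrZr dotrZl mulrA mulVf ?mul1r//.
by rewrite gt_eqF.
Qed.

Lemma fourier_modulation (f : 'rV[R]_n -> R[i]) k xi : 
  fourier (fun x => f x * cexpi (dotr x k)) xi = fourier f (xi - k).
Proof.
apply: eq_cintegral => x; rewrite -mulrA -cexpiD; congr (_ * cexpi _).
by rewrite dotrDr dotrNr opprD opprK addrC.
Qed.

Definition ft (f : 'rV[R]_n -> R) : 'rV[R]_n -> R[i] := fourier (fun x => (f x)%:C).

Lemma test_cintegrable f : test_fun f -> cintegrable (fun x : 'rV[R]_n => (f x)%:C).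
Proof. by move=> tf; apply: cintegrable_real; exact: test_fun_intR. Qed.

(** Integration by parts in real form: [Rint_partial] is applied to f cos(x . xi) and to f sin(x .
    xi). *)
Lemma ft_partial f k xi : test_fun f ->
  ft (partial k f) xi = (0 +i* xi 0 k) * ft f xi.
Proof.
move=> tf.
have sf := tf.1.
have tc := test_funM tf (smooth_cos xi).
have ts := test_funM tf (smooth_sin xi).
have pc := Rint_partial k tc.
have ps := Rint_partial k ts.
have ipc : intR mu (fun x => partial k f x * cos (dotr x xi)).
  exact/test_fun_intR/test_funM/smooth_cos/test_fun_partial.
have ips : intR mu (fun x => partial k f x * sin (dotr x xi)).
  exact/test_fun_intR/test_funM/smooth_sin/test_fun_partial.
have ic := test_fun_intR tc; have is_ := test_fun_intR ts.
have ec x : partial k (fun x => f x * cos (dotr x xi)) x = partial k f x * cos (dotr x xi) + - xi 0 k * (f x * sin (dotr x xi)).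
  by rewrite (partialM _ sf (smooth_cos xi)) partial_cos; ring.
have es x : partial k (fun x => f x * sin (dotr x xi)) x = partial k f x * sin (dotr x xi) + xi 0 k * (f x * cos (dotr x xi)).
  by rewrite (partialM _ sf (smooth_sin xi)) partial_sin; ring.
move: pc; under eq_Rintegral do rewrite ec.
rewrite RintegralD//; last exact: intRZ.
rewrite RintegralZl// => pc.
move: ps; under eq_Rintegral do rewrite es.
rewrite RintegralD//; last exact: intRZ.
rewrite RintegralZl// => ps.
have fE (g : 'rV[R]_n -> R) : intR mu (fun x => g x * sin (dotr x xi)) ->
    ft g xi = (\int[mu]_x (g x * cos (dotr x xi))) +i* (- \int[mu]_x (g x * sin (dotr x xi))).
  move=> gi; rewrite /ft /fourier /cintegral; congr (_ +i* _).
    by apply: eq_Rintegral => x _; rewrite cReM/= mul0r subr0 cosN.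
  rewrite -mulN1r -RintegralZl//; apply: eq_Rintegral => x _.
  by rewrite cImM/= mul0r addr0 sinN; ring.
rewrite !fE//; apply: complex_ReIm_eq; rewrite ?cReM ?cImM /= mul0r.
  by rewrite add0r; lra.
by rewrite add0r; lra.
Qed.

Lemma fourier_real_normc f xi : test_fun f -> normc (ft f xi) <= 2 * \int[mu]_x `|f x|.
Proof.
move=> tf; have := fourier_bound xi (test_cintegrable tf).
by under eq_Rintegral do rewrite normc_real.
Qed.

(** The product of the operators 1 - d_i^2 over i in s. Taken over all coordinates, its Fourier
    symbol is the inverse of [decay], so the trivial bound on its transform becomes integrable decay
    for f. *)
Definition bessel (s : seq 'I_n) (f : 'rV[R]_n -> R) :=
  foldr (fun i g x => g x + -1 * partial i (partial i g) x) f s.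

Lemma test_fun_bessel s f : test_fun f -> test_fun (bessel s f).
Proof.
move=> tf; elim: s => //= i s ih; apply: test_funD => //.
by apply: test_funZ; do 2 apply: test_fun_partial.
Qed.

Lemma ftD f g xi : test_fun f -> test_fun g ->
  ft (fun x => f x + g x) xi = ft f xi + ft g xi.
Proof.
move=> tf tg; rewrite /ft -fourierD; try exact: test_cintegrable.
by congr fourier; apply/funext => x; rewrite rmorphD.
Qed.

Lemma ftZ c f xi : test_fun f -> ft (fun x => c * f x) xi = c%:C * ft f xi.
Proof.
move=> tf; rewrite /ft -fourierZ; last exact: test_cintegrable.
by congr fourier; apply/funext => x; rewrite rmorphM.
Qed.

Lemma ft_sum (I : Type) (s : seq I) (h : I -> 'rV[R]_n -> R) xi : (forall i, test_fun (h i)) ->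
  ft (fun x => \sum_(i <- s) h i x) xi = \sum_(i <- s) ft (h i) xi.
Proof.
move=> th; elim: s => [|i s ih].
  rewrite big_nil; under [fun=> _]eq_fun do rewrite big_nil.
  by rewrite -[in LHS](mul0r 0) (ftZ _ _ test_fun0) mul0r.
rewrite big_cons; under [fun=> _]eq_fun do rewrite big_cons.
by rewrite ftD ?ih//; exact: test_fun_sum.
Qed.

Lemma ft_bessel s f xi : test_fun f ->
  ft (bessel s f) xi = (\prod_(i <- s) (1 + xi 0 i ^+ 2))%:C * ft f xi.
Proof.
move=> tf; elim: s => [|i s ih]; first by rewrite big_nil mul1r.
have tb := test_fun_bessel s tf.
have tpb := test_fun_partial i tb.
rewrite big_cons /= ftD//; last by apply: test_funZ; exact: test_fun_partial.
rewrite ftZ; last exact: test_fun_partial.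
rewrite !ft_partial// ih rmorphM/= -[X in X + _]mul1r !mulrA -mulrDl -mulrDl.
congr (_ * _ * _); apply: complex_ReIm_eq; rewrite ?cReM ?cImM/=; ring.
Qed.

Lemma ft_decay f : test_fun f -> exists2 C : R, 0 <= C & forall xi, normc (ft f xi) <= C * decay xi.
Proof.
move=> tf; have tb := test_fun_bessel (index_enum 'I_n) tf.
exists (2 * \int[mu]_x `|bessel (index_enum 'I_n) f x|).
  by rewrite mulr_ge0// Rintegral_ge0.
move=> xi; have := fourier_real_normc xi tb.
rewrite ft_bessel// Normc.normcM normc_real ger0_norm; last first.
  by apply: prodr_ge0 => i _; rewrite addr_ge0// sqr_ge0.
have -> : decay xi = (\prod_i (1 + xi 0 i ^+ 2))^-1 by rewrite /decay /prodV prodfV.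
by rewrite ler_pdivlMr ?(mulrC (normc _))// prodr_gt0// => i _; rewrite ltr_pwDl// sqr_ge0.
Qed.

Lemma ft_cintegrable f : test_fun f -> cintegrable (ft f).
Proof.
move=> tf; have [C C0 hC] := ft_decay tf.
apply: (cintegrable_dom _ hC); first exact/fourier_measurable/test_cintegrable.
by apply: intRZ; exact: intR_decay.
Qed.

End fourier_transform.

(** * Fourier inversion by Abel summation *)

Section fourier_inversion.
Context {R : realType} {n : nat}.
Local Open Scope complex_scope.
Implicit Types (x y xi : 'rV[R]_n) (f : 'rV[R]_n -> R).
Local Notation mu := (@lebesgue_rV R n).
Local Notation normc := (@Normc.normc R).
Local Notation Re := (@complex.Re R).
Local Notation Im := (@complex.Im R).
Local Notation eps m := (m.+1%:R^-1 : R).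

Lemma cvg_ext (u v : nat -> R) (l : R) :
  u =1 v -> v m @[m --> \oo] --> l -> u m @[m --> \oo] --> l.
Proof. by move=> /funext ->. Qed.

Lemma intR_laplaceV (e : R) : 0 < e -> intR mu (laplaceV e).
Proof. by move=> e0; have [] := prodV_integral n (laplace_integral e0).1. Qed.

Lemma laplaceV_ge0 (e : R) x : 0 <= laplaceV e x.
Proof. by apply: prodr_ge0 => i _; exact: expR_ge0. Qed.

Lemma laplaceV_le1 (e : R) x : 0 < e -> laplaceV e x <= 1.
Proof.
move=> e0; apply: prodr_ile1 => i _; rewrite expR_ge0/= -expR0 ler_expR oppr_le0.
by rewrite mulr_ge0// ltW.
Qed.

Lemma laplaceV_cvg x : laplaceV (eps m) x @[m --> \oo] --> (1 : R).
Proof.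
rewrite /laplaceV /prodV; elim: (index_enum _) => [|i s ih].
  by apply: (cvg_ext (fun m => big_nil _ _ _ _)); exact: cvg_cst.
apply: (cvg_ext (fun m => big_cons _ _ _ _ _ _)); rewrite -[X in _ --> X](mulr1 1).
apply: cvgM => //.
rewrite -[X in _ --> X]expR0; apply: continuous_cvg; first exact: continuous_expR.
rewrite -[X in _ --> X]oppr0; apply: cvgN; rewrite -[X in _ --> X](mul0r `|x 0 i|).
by apply: cvgM; [exact: cvg_harmonic|exact: cvg_cst].
Qed.

Lemma laplaceV_character (e : R) x : 0 < e ->
  cintegral (fun xi => (laplaceV e xi)%:C * cexpi (dotr x xi)) =
  (prodV (fun s => 2 * e / (e ^+ 2 + s ^+ 2)) x)%:C.
Proof.
move=> e0; have [_ _ vc vs] := laplaceV_fourier x e0.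
apply: complex_ReIm_eq => /=.
  by rewrite -vc; apply: eq_Rintegral => xi _; rewrite mul0r subr0 dotrC.
by rewrite -[RHS]vs; apply: eq_Rintegral => xi _; rewrite mul0r addr0 dotrC.
Qed.

(** The transform of [laplaceV] 1. Its mass (2 pi)^n is the constant in Fourier inversion. *)
Definition cauchyV : 'rV[R]_n -> R := prodV (fun s => 2 * (1 + s ^+ 2)^-1).

Lemma cauchyV_integral : intR mu cauchyV /\ \int[mu]_x cauchyV x = (2 * pi) ^+ n.
Proof.
have [h1 h2] := @cauchy_integral R.
have [i1 i2] := @prodV_integral R n _ (intRZ 2 h1).
by split => //; rewrite i2 RintegralZl// h2.
Qed.

Lemma cauchyV_ge0 z : 0 <= cauchyV z.
Proof.
by apply: prodr_ge0 => i _; rewrite mulr_ge0// invr_ge0 addr_ge0// sqr_ge0.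
Qed.

(** The argument - e z is x - y after the substitution y = e z + x; the Poisson kernel of width e is
    the rescaled Cauchy kernel. *)
Lemma poisson_scaled (e : R) (z : 'rV[R]_n) : 0 < e ->
  prodV (fun s => 2 * e / (e ^+ 2 + s ^+ 2)) (- (e *: z)) = e ^- n * cauchyV z.
Proof.
move=> e0; have -> : e ^- n = \prod_(i < n) e^-1 by rewrite prodr_const card_ord exprVn.
rewrite /cauchyV /prodV -big_split/=.
apply: eq_bigr => i _; rewrite !mxE sqrrN.
have h : 1 + z 0 i ^+ 2 != 0 by rewrite gt_eqF// ltr_pwDl// sqr_ge0.
have h2 : e ^+ 2 + (e * z 0 i) ^+ 2 != 0.
  by rewrite exprMn -[X in X + _]mulr1 -mulrDr mulf_neq0// expf_neq0// gt_eqF.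
by field; rewrite h h2 gt_eqF.
Qed.

(** A factor [laplaceV] (1/(m+1)) is inserted and the limit computed in two ways: on the frequency
    side by dominated convergence, as the transform of a test function is integrable; on the space
    side as an average of f that concentrates at x. *)
Lemma fourier_inversion_real f x : test_fun f ->
  cintegral (fun xi => ft f xi * cexpi (dotr x xi)) = ((2 * pi) ^+ n * f x)%:C.
Proof.
move=> tf.
pose I_ m := cintegral (fun xi => ft f xi * cexpi (dotr x xi) * (laplaceV (eps m) xi)%:C).
have em m : 0 < eps m by rewrite invr_gt0.
have mft : cmeasurable (ft f) by exact: cintegrable_measurable (ft_cintegrable tf).
have nft := cintegrable_normc (ft_cintegrable tf).
have mL m : cmeasurable (fun xi => (laplaceV (eps m) xi)%:C : R[i]).
  by apply: cmeasurable_real; exact: intR_measurable (intR_laplaceV (em m)).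
have [|||||_ cRe cIm] := @cintegral_dct R n
  (fun m xi => ft f xi * cexpi (dotr x xi) * (laplaceV (eps m) xi)%:C)
  (fun xi => ft f xi * cexpi (dotr x xi)) (fun xi => normc (ft f xi)).
- move=> m; apply: cmeasurableM => //; apply: cmeasurableM => //.
  exact: cmeasurable_character.
- move=> xi; apply: (@cvg_ext _ (fun m => Re (ft f xi * cexpi (dotr x xi)) * laplaceV (eps m) xi)).
    by move=> m; rewrite cReM /= mulr0 subr0.
  rewrite -[X in _ --> X]mulr1; apply: cvgM; [exact: cvg_cst|exact: laplaceV_cvg].
- move=> xi; apply: (@cvg_ext _ (fun m => Im (ft f xi * cexpi (dotr x xi)) * laplaceV (eps m) xi)).
    by move=> m; rewrite cImM /= mulr0 add0r.
  rewrite -[X in _ --> X]mulr1; apply: cvgM; [exact: cvg_cst|exact: laplaceV_cvg].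
- exact: nft.
- move=> m xi; rewrite !Normc.normcM normc_cexpi mulr1 normc_real ger0_norm ?laplaceV_ge0//.
  by rewrite ler_piMr ?normc_ge0// laplaceV_le1.
(* Fubini integrates out xi first, leaving f against a Poisson kernel centred at x; rescaling then
   moves the dependence on m from the kernel into the argument of f. *)
have IE m : I_ m = (\int[mu]_z (f (eps m *: z + x) * cauchyV z))%:C.
  have fi := test_fun_intR tf.
  have li := intR_laplaceV (em m).
  pose h (p : 'rV[R]_n * 'rV[R]_n) : R[i] := ((f p.2)%:C * cexpi (- dotr p.1 p.2)) *
     (cexpi (dotr x p.1) * (laplaceV (eps m) p.1)%:C).
  have mh : cmeasurable h.
    apply: cmeasurableM; apply: cmeasurableM.
    + apply: cmeasurable_real; exact: (measurableT_comp (intR_measurable fi) measurable_snd).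
    + by apply: cmeasurable_cexpi; apply: measurableT_comp => //; exact: measurable_dotr2.
    + apply: cmeasurable_cexpi; exact: (measurableT_comp (measurable_dotr x) measurable_fst).
    + apply: cmeasurable_real; exact: (measurableT_comp (intR_measurable li) measurable_fst).
  have hb xi y : normc (h (xi, y)) <= laplaceV (eps m) xi * `|f y|.
    rewrite /h !Normc.normcM !normc_cexpi !normc_real mulr1 mul1r.
    by rewrite (ger0_norm (laplaceV_ge0 _ _)) mulrC.
  have := cintegral_fubini mh li (intR_norm fi) hb.
  rewrite /I_ => e.
  rewrite (_ : (fun xi => _) = (fun xi => cintegral (fun y => h (xi, y)))); last first.
    apply/funext => xi.
    have ei : cintegrable (fun y => (f y)%:C * cexpi (- dotr xi y)).
      apply: cintegrable_modulated; first exact: cintegrable_real.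
      exact: measurable_dotrN.
    rewrite (cintegralZr (cexpi (dotr x xi) * (laplaceV (eps m) xi)%:C) ei) mulrA.
    congr (_ * _ * _); apply: eq_cintegral => y; by rewrite dotrC.
  rewrite e.
  pose g y := f y * prodV (fun s => 2 * eps m / (eps m ^+ 2 + s ^+ 2)) (x - y).
  have hg y : cintegral (fun xi => h (xi, y)) = (g y)%:C.
    have li2 : cintegrable (fun xi => (laplaceV (eps m) xi)%:C * cexpi (dotr (x - y) xi)).
      apply: cintegrable_modulated; first exact: cintegrable_real.
      exact: measurable_dotr.
    have -> : (g y)%:C = (f y)%:C * cintegral (fun xi => (laplaceV (eps m) xi)%:C * cexpi (dotr (x - y) xi)).
      by rewrite (laplaceV_character (x - y) (em m)) /g rmorphM.
    rewrite -(cintegralZ (f y)%:C li2).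
    apply: eq_cintegral => xi; rewrite /h /= dotrDl dotrNl cexpiD (dotrC xi y).
    move: (cexpi (dotr x xi)) (cexpi (- dotr y xi)) ((laplaceV (eps m) xi)%:C) ((f y)%:C) => a b c d.
    by ring.
  under eq_cintegral do rewrite hg.
  have gi : intR mu g.
    have [_ i1 _] := fubini_dom mh.1 li (intR_norm fi) (fun x y => le_trans (Re_le_normc _) (hb x y)).
    have eg y : \int[mu]_xi Re (h (xi, y)) = g y by exact: (congr1 Re (hg y)).
    by rewrite -(funext eg); exact: i1.
  have [_] := Rint_affine x (em m) gi => ga.
  rewrite cintegral_real; congr (_%:C).
  (* The factor eps^-n is the Jacobian of y = eps z + x, and also the one released by
     [poisson_scaled]. *)
  apply: (@mulfI _ (eps m ^- n)); first by rewrite invr_eq0 expf_neq0// gt_eqF.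
  rewrite -ga.
  have ci : intR mu (fun z => f (eps m *: z + x) * cauchyV z).
    have [M M0 fM] := test_fun_bounded tf; have [ci _] := cauchyV_integral.
    apply: (intR_le _ _ (intRZ M ci)).
      apply: measurable_funM; last exact: intR_measurable ci.
      by apply: measurableT_comp; [exact: test_fun_measurable|exact: measurable_affine_rV].
    by move=> z; rewrite normrM (ger0_norm (cauchyV_ge0 z)) ler_wpM2r ?cauchyV_ge0.
  rewrite -(@RintegralZl _ _ _ mu setT _ (eps m ^- n) measurableT ci).
  apply: eq_Rintegral => z _.
  by rewrite /g opprD addrCA subrr addr0 (poisson_scaled z (em m)) mulrCA.
have r_ : (\int[mu]_z (f (eps m *: z + x) * cauchyV z)) @[m --> \oo] --> (2 * pi) ^+ n * f x.
  have [ci cv] := cauchyV_integral.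
  rewrite mulrC -cv -RintegralZl//.
  have [M M0 fM] := test_fun_bounded tf.
  have [||||_ //] := @Rint_dct R _ _ mu (fun m z => f (eps m *: z + x) * cauchyV z)
     (fun z => f x * cauchyV z) (fun z => M * cauchyV z).
  - move=> m; apply: measurable_funM; last exact: intR_measurable ci.
    by apply: measurableT_comp; [exact: test_fun_measurable|exact: measurable_affine_rV].
  - move=> z; apply: cvgM; last exact: cvg_cst.
    have hx : eps m *: (z : 'rV[R]_n) + x @[m --> \oo] --> 0 *: (z : 'rV[R]_n) + x.
      apply: cvgD; last exact: cvg_cst.
      by apply: cvgZ; [exact: cvg_harmonic|exact: cvg_cst].
    rewrite scale0r add0r in hx.
    exact: (cvg_comp _ _ hx (smooth_continuous tf.1 x)).
  - exact: intRZ.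
  - move=> m z; rewrite normrM (ger0_norm (cauchyV_ge0 z)) ler_wpM2r ?cauchyV_ge0//.
move: cRe cIm; rewrite -/I_.
rewrite [X in X @ _ --> _](_ : _ = fun m => \int[mu]_z (f (eps m *: z + x) * cauchyV z)); last first.
  by apply/funext => m; rewrite -/(I_ m) IE.
move=> /(cvg_unique _ r_) e1.
rewrite [X in X @ _ --> _](_ : _ = fun m => 0); last first.
  by apply/funext => m; rewrite -/(I_ m) IE.
move=> /(cvg_unique _ (cvg_cst _)) e2.
apply: complex_ReIm_eq; apply/esym.
  exact: (e1 (@norm_hausdorff _ _)).
exact: (e2 (@norm_hausdorff _ _)).
Qed.

End fourier_inversion.

(** * Littlewood-Paley projections *)

Section littlewood_paley.
Context {R : realType} {n : nat}.
Local Open Scope complex_scope.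
Implicit Types (x y xi : 'rV[R]_n).
Local Notation mu := (@lebesgue_rV R n).
Local Notation normc := (@Normc.normc R).
Local Notation Re := (@complex.Re R).
Local Notation Im := (@complex.Im R).

Lemma twopi_neq0 : (2 * pi) ^+ n != 0 :> R.
Proof. by rewrite expf_neq0// mulf_neq0// gt_eqF// pi_gt0. Qed.

Definition lp_mult (m : 'rV[R]_n -> R) (f : 'rV[R]_n -> R[i]) : 'rV[R]_n -> R[i] :=
  inv_fourier_distr (mul_distr (fun xi => (m xi)%:C) (fourier_distr (distr_of_fun f))).

(** For an integrable f the definition by duality unwinds, by Fubini, to the usual formula. This
    version serves the velocity. *)
Lemma lp_mult_fourier (m : 'rV[R]_n -> R) (f : 'rV[R]_n -> R[i]) x :
  test_fun m -> cintegrable f ->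
  lp_mult m f x = ((2 * pi) ^- n)%:C *
    cintegral (fun xi => (m xi)%:C * cexpi (dotr x xi) * fourier f xi).
Proof.
move=> tm fi; congr (_ * _).
pose h (p : 'rV[R]_n * 'rV[R]_n) : R[i] :=
  (f p.1 * cexpi (- dotr p.1 p.2)) * ((m p.2)%:C * cexpi (dotr x p.2)).
have mi := test_fun_intR tm.
have nf := cintegrable_normc fi.
have mh : cmeasurable h.
  apply: cmeasurableM; apply: cmeasurableM.
  - exact: cmeasurable_comp (cintegrable_measurable fi) measurable_fst.
  - apply: cmeasurable_cexpi; apply: (measurableT_comp (@oppr_measurable R setT)).
    exact: measurable_dotr2.
  - apply: cmeasurable_real; exact: (measurableT_comp (intR_measurable mi) measurable_snd).
  - apply: cmeasurable_cexpi; exact: (measurableT_comp (measurable_dotr x) measurable_snd).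
have hb y xi : normc (h (y, xi)) <= normc (f y) * `|m xi|.
  by rewrite /h !Normc.normcM !normc_cexpi normc_real !mulr1.
have e1 y : f y * fourier (fun xi => (m xi)%:C * cexpi (dotr x xi)) y = cintegral (fun xi => h (y, xi)).
  have i1 : cintegrable (fun xi => (m xi)%:C * cexpi (dotr x xi)).
    by apply: cintegrable_modulated; [exact: cintegrable_real|exact: measurable_dotr].
  rewrite /fourier -(cintegralZ (f y) (cintegrable_fourier y i1)).
  apply: eq_cintegral => xi; rewrite /h /= (dotrC y xi).
  move: ((m xi)%:C) (f y) (cexpi (dotr x xi)) (cexpi (- dotr xi y)) => a b c d.
  by ring.
have e2 xi : (m xi)%:C * cexpi (dotr x xi) * fourier f xi = cintegral (fun y => h (y, xi)).
  rewrite /fourier -(cintegralZ _ (cintegrable_fourier xi fi)).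
  by apply: eq_cintegral => y; rewrite /h /= mulrC.
rewrite /mul_distr /fourier_distr /distr_of_fun.
rewrite (eq_cintegral e1) (eq_cintegral e2).
exact: cintegral_fubini mh nf (intR_norm mi) hb.
Qed.

(** Here only the transform q is integrable, not the function to which the multiplier is applied.
    The integrability that Fubini needs comes from the transform of m, and Fourier inversion for m
    then gives m back. This version serves the pressure. *)
Lemma lp_mult_inv_fourier (m : 'rV[R]_n -> R) (q : 'rV[R]_n -> R[i]) x :
  test_fun m -> cintegrable q ->
  lp_mult m (inv_fourier q) x = ((2 * pi) ^- n)%:C *
    cintegral (fun xi => q xi * ((m xi)%:C * cexpi (dotr x xi))).
Proof.
move=> tm qi; congr (_ * _).
have mi := test_fun_intR tm.
have fmi := ft_cintegrable tm.
have [fsi _] := cintegral_affine (- x) (@ltr01 R) fmi.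
have {}fsi : cintegrable (fun y => ft m (y - x)).
  by move: fsi; under eq_fun do rewrite scale1r.
pose c : R[i] := ((2 * pi) ^- n)%:C.
have cqi : cintegrable (fun xi => c * q xi) by exact: cintegrableZ.
pose h (p : 'rV[R]_n * 'rV[R]_n) : R[i] :=
  (c * q p.2 * cexpi (dotr p.1 p.2)) * ft m (p.1 - x).
have nq := cintegrable_normc cqi.
have nfs := cintegrable_normc fsi.
have mh : cmeasurable h.
  apply: cmeasurableM; first apply: cmeasurableM.
  - exact: cmeasurable_comp (cintegrable_measurable cqi) measurable_snd.
  - by apply: cmeasurable_cexpi; exact: measurable_dotr2.
  - exact: cmeasurable_comp (cintegrable_measurable fsi) measurable_fst.
have hb y xi : normc (h (y, xi)) <= normc (ft m (y - x)) * normc (c * q xi).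
  by rewrite /h (Normc.normcM _ (ft m _)) (Normc.normcM (c * _)) normc_cexpi mulr1 mulrC.
have e1 y : inv_fourier q y * fourier (fun xi => (m xi)%:C * cexpi (dotr x xi)) y =
    cintegral (fun xi => h (y, xi)).
  have i1 : cintegrable (fun xi => q xi * cexpi (dotr y xi)).
    by apply: cintegrable_modulated => //; exact: measurable_dotr.
  have i3 : cintegrable (fun xi => c * q xi * cexpi (dotr y xi)).
    by apply: cintegrable_modulated => //; exact: measurable_dotr.
  rewrite /h /= (cintegralZr _ i3) /inv_fourier -(cintegralZ _ i1); congr (_ * _).
    by apply: eq_cintegral => xi; rewrite mulrA.
  rewrite /ft -fourier_modulation; congr (fourier _ y).
  by apply/funext => xi; rewrite dotrC.
have hc : c * ((2 * pi) ^+ n)%:C = 1 by rewrite /c -rmorphM/= mulVf// twopi_neq0.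
have e2 xi : cintegral (fun y => h (y, xi)) = q xi * ((m xi)%:C * cexpi (dotr x xi)).
  have i2 : cintegrable (fun y => ft m y * cexpi (dotr (y + x) xi)).
    apply: cintegrable_modulated => //.
    rewrite (_ : (fun y => _) = fun y => dotr xi y + dotr xi x); last first.
      by apply/funext => y; rewrite dotrC dotrDr.
    by apply: measurable_funD; [exact: measurable_dotr|exact: measurable_cst].
  have [i4 e3] := cintegral_affine (- x) (@ltr01 R) i2.
  rewrite (_ : cintegral _ = c * q xi * cintegral (fun y => ft m y * cexpi (dotr (y + x) xi))); last first.
    rewrite expr1n invr1 mul1r in e3; rewrite -e3 -(cintegralZ _ i4).
    apply: eq_cintegral => y; rewrite scale1r subrK /h /=.
    by rewrite -mulrA; congr (_ * _); rewrite mulrC.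
  have i5 : cintegrable (fun y => ft m y * cexpi (dotr xi y)).
    by apply: cintegrable_modulated => //; exact: measurable_dotr.
  have -> : cintegral (fun y => ft m y * cexpi (dotr (y + x) xi)) =
      cexpi (dotr x xi) * cintegral (fun y => ft m y * cexpi (dotr xi y)).
    rewrite -(cintegralZ _ i5).
    apply: eq_cintegral => y; rewrite dotrDl cexpiD (dotrC y xi).
    move: (ft m y) (cexpi (dotr xi y)) (cexpi (dotr x xi)) => a b d; by ring.
  rewrite fourier_inversion_real// rmorphM/=.
  have hr (c' a b d e : R[i]) : c' * b * (e * (a * d)) = (c' * a) * (b * (d * e)) by ring.
  by rewrite hr hc mul1r.
rewrite /mul_distr /fourier_distr /distr_of_fun.
rewrite (eq_cintegral e1) -(eq_cintegral e2).
exact: cintegral_fubini mh nfs nq hb.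
Qed.

(** It moves the transform from the velocity products, which spread out as the window widens, to the
    fixed symbol, whose transform is then the integrable majorant. *)
Lemma multiplication_formula (f g : 'rV[R]_n -> R) : test_fun f -> test_fun g ->
  cintegral (fun xi => (f xi)%:C * ft g xi) = cintegral (fun xi => (g xi)%:C * ft f xi).
Proof.
move=> tf tg.
pose h (p : 'rV[R]_n * 'rV[R]_n) : R[i] := (f p.1)%:C * ((g p.2)%:C * cexpi (- dotr p.1 p.2)).
have fi := test_fun_intR tf; have gi := test_fun_intR tg.
have mh : cmeasurable h.
  apply: cmeasurableM; last apply: cmeasurableM.
  - apply: cmeasurable_real; exact: (measurableT_comp (intR_measurable fi) measurable_fst).
  - apply: cmeasurable_real; exact: (measurableT_comp (intR_measurable gi) measurable_snd).
  - apply: cmeasurable_cexpi; apply: (measurableT_comp (@oppr_measurable R setT)).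
    exact: measurable_dotr2.
have hb x y : normc (h (x, y)) <= `|f x| * `|g y|.
  by rewrite /h !Normc.normcM normc_cexpi !normc_real !mulr1.
have e1 x : (f x)%:C * ft g x = cintegral (fun y => h (x, y)).
  rewrite /ft /fourier -(cintegralZ _ (cintegrable_fourier x (cintegrable_real gi))).
  by apply: eq_cintegral => y; rewrite /h /= (dotrC y x).
have e2 y : (g y)%:C * ft f y = cintegral (fun x => h (x, y)).
  rewrite /ft /fourier -(cintegralZ _ (cintegrable_fourier y (cintegrable_real fi))).
  apply: eq_cintegral => x; rewrite /h /=.
  move: ((f x)%:C) ((g y)%:C) (cexpi (- dotr x y)) => a b c; by ring.
rewrite (eq_cintegral e1) (eq_cintegral e2).
exact: cintegral_fubini mh (intR_norm fi) (intR_norm gi) hb.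
Qed.

Lemma box_integral (r : R) : 0 < r -> 0 < \int[mu]_x box r x.
Proof.
move=> r0; have [|_ ->] := @prodV_integral R n \1_(`[- r, r] : set R).
  exact: integrable_indic_itv.
rewrite exprn_gt0//.
have -> : \int[lebesgue_measure]_t \1_(`[- r, r] : set R) t = r - - r.
  transitivity (fine (lebesgue_measure (`[- r, r] : set R))).
    by rewrite /Rintegral integral_indic// setIT.
  by rewrite lebesgue_measure_itv/= lte_fin gtrN.
by rewrite opprK addr_gt0.
Qed.

Lemma box_supp (r : R) x : box r x != 0 -> forall i, `|x 0 i| <= r.
Proof.
move=> + i; rewrite /box /prodV prodf_seq_neq0 => /allP/(_ i (mem_index_enum _)).
rewrite indicE /=; case: (boolP (_ \in _)); last by rewrite eqxx.
by rewrite inE/= in_itv/= ler_norml.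
Qed.

(** Every cube around the origin has positive measure and so meets every set of full measure. *)
Lemma ae_near_origin (P : 'rV[R]_n -> Prop) : (\forall x \ae mu, P x) ->
  exists x_ : nat -> 'rV[R]_n,
    (forall m, P (x_ m)) /\ forall i, x_ m 0 i @[m --> \oo] --> 0.
Proof.
move=> aeP.
have h (m : nat) : exists x, P x /\ forall i, `|x 0 i| <= m.+1%:R^-1.
  apply: contrapT => /forallNP H.
  have m0 : 0 < m.+1%:R^-1 :> R by rewrite invr_gt0.
  have := box_integral m0; rewrite /Rintegral.
  rewrite (@ge0_ae_eq_integral _ _ _ mu setT _ (cst 0%E)) ?integral0 ?ltxx//.
  - by apply/measurable_EFinP; exact: intR_measurable (intR_box _).
  - by move=> x _; rewrite lee_fin box_ge0.
  - apply: filterS aeP => x Px _.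
    have [->//|/box_supp hx] := eqVneq (box m.+1%:R^-1 x) 0.
    by exfalso; apply: (H x).
have [x_ hx] := choice h.
exists x_; split; first by move=> m; case: (hx m).
move=> i; apply: (squeeze_cvgr _ _ (@cvg_harmonic R)); last first.
  by rewrite -[X in _ --> X]oppr0; apply: cvgN; exact: cvg_harmonic.
by apply: nearW => m; rewrite -ler_norml; case: (hx m) => _; exact.
Qed.

(** Along some sequence tending to the origin f stays below its essential supremum, and continuity
    carries the bound to f 0. Continuity is sequential and coordinatewise, the form that dominated
    convergence delivers. *)
Lemma Lnorm_oo_ge (f : 'rV[R]_n -> R) : (forall x, 0 <= f x) ->
  (forall x_ : nat -> 'rV[R]_n, (forall i, x_ m 0 i @[m --> \oo] --> 0) ->
     f (x_ m) @[m --> \oo] --> f 0) ->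
  ((f 0)%:E <= 'N[mu]_+oo[EFin \o f])%E.
Proof.
move=> f0 cf; rewrite unlock.
(* The sup norm is set to 0 when the whole space is null. That case is excluded by noting that
   [False] would hold almost everywhere. *)
have mu0 : (0 < mu [set: 'rV[R]_n])%E.
  rewrite lt0e measure_ge0 andbT; apply/eqP => mu0.
  have [|x_ []] := @ae_near_origin (fun=> False).
    by exists setT; split.
  by move=> /(_ 0%N).
rewrite mu0.
have [x_ [hx x0]] := ae_near_origin (ess_sup_inf.ess_sup_ge mu (abse \o (EFin \o f))).
move: hx; case: (ess_sup_inf.ess_sup mu _) => [r||] hx.
- have h := cf _ x0; rewrite lee_fin -(cvg_lim (@norm_hausdorff _ _) h).
  apply: limr_le; first by apply/cvg_ex; exists (f 0).
  apply: nearW => m; have := hx m.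
  by rewrite /= lee_fin ger0_norm.
- by rewrite leey.
- by have := hx 0%N.
Qed.

Lemma Lnorm_oo_le (f : 'rV[R]_n -> R) (c : R) : (forall x, `|f x| <= c) ->
  ('N[mu]_+oo[EFin \o f] <= c%:E)%E.
Proof.
move=> fc; rewrite unlock.
have c0 : 0 <= c by exact: le_trans (normr_ge0 _) (fc 0).
case: ifPn => _; last by rewrite lee_fin.
apply/ess_sup_inf.ess_supP; apply: nearW => x /=.
by rewrite lee_fin.
Qed.

Lemma cexpi_cvg (t_ : nat -> R) (t : R) : t_ m @[m --> \oo] --> t ->
  Re (cexpi (t_ m)) @[m --> \oo] --> Re (cexpi t) /\
  Im (cexpi (t_ m)) @[m --> \oo] --> Im (cexpi t).
Proof.
move=> h; split.
  exact: (continuous_cvg _ (@continuous_cos R t) h).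
exact: (continuous_cvg _ (@continuous_sin R t) h).
Qed.

Lemma dotr_cvg0 (x_ : nat -> 'rV[R]_n) xi : (forall i, x_ m 0 i @[m --> \oo] --> 0) ->
  dotr (x_ m) xi @[m --> \oo] --> 0.
Proof.
move=> hx; rewrite /dotr; elim: (index_enum _) => [|i s ih].
  by apply: (cvg_ext (fun m => big_nil _ _ _ _)); exact: cvg_cst.
apply: (cvg_ext (fun m => big_cons _ _ _ _ _ _)); rewrite -[X in _ --> X]addr0.
apply: cvgD => //; rewrite -[X in _ --> X](mul0r (xi 0 i)).
by apply: cvgM; [exact: hx|exact: cvg_cst].
Qed.

Lemma normc_cvg (z_ : nat -> R[i]) (z : R[i]) :
  Re (z_ m) @[m --> \oo] --> Re z -> Im (z_ m) @[m --> \oo] --> Im z ->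
  normc (z_ m) @[m --> \oo] --> normc z.
Proof.
move=> h1 h2.
have e (w : R[i]) : normc w = Num.sqrt (Re w ^+ 2 + Im w ^+ 2) by case: w.
rewrite e; apply: (cvg_ext (fun m => e _)).
apply: (continuous_cvg _ (@sqrt_continuous R _)).
by apply: cvgD; rewrite !expr2; apply: cvgM.
Qed.

Lemma character_integral_cvg (q : 'rV[R]_n -> R[i]) (x_ : nat -> 'rV[R]_n) (c : R[i]) :
  cintegrable q -> (forall i, x_ m 0 i @[m --> \oo] --> 0) ->
  normc (c * cintegral (fun xi => q xi * cexpi (dotr (x_ m) xi))) @[m --> \oo] -->
  normc (c * cintegral (fun xi => q xi * cexpi (dotr 0 xi))).
Proof.
move=> qi hx.
apply: (cvg_ext (fun m => Normc.normcM _ _)); rewrite Normc.normcM.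
apply: cvgM; first exact: cvg_cst.
have hxi xi := dotr_cvg0 xi hx.
have d0 xi : dotr 0 xi = 0 :> R by rewrite dotrC dotr0.
have [|||||_ h1 h2] := @cintegral_dct R n (fun m xi => q xi * cexpi (dotr (x_ m) xi))
  (fun xi => q xi * cexpi (dotr 0 xi)) (fun xi => normc (q xi)).
- move=> m; apply: cmeasurableM; first exact: cintegrable_measurable.
  exact: cmeasurable_character.
- move=> xi; have [h1 h2] := cexpi_cvg (hxi xi); rewrite cReM d0.
  apply: (cvg_ext (fun m => cReM _ _)).
  by apply: cvgB; apply: cvgM => //; exact: cvg_cst.
- move=> xi; have [h1 h2] := cexpi_cvg (hxi xi); rewrite cImM d0.
  apply: (cvg_ext (fun m => cImM _ _)).
  by apply: cvgD; apply: cvgM => //; exact: cvg_cst.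
- exact: cintegrable_normc.
- by move=> m xi; rewrite Normc.normcM normc_cexpi mulr1.
exact: normc_cvg.
Qed.

(** The left side is the modulus of the projection at x = 0, where the character equals 1 and the
    projection is continuous. *)
Lemma lp_mult_esssup (m : 'rV[R]_n -> R) (q : 'rV[R]_n -> R[i]) :
  test_fun m -> cintegrable q ->
  ((normc (((2 * pi) ^- n)%:C * cintegral (fun xi => q xi * (m xi)%:C)))%:E <=
    'N[mu]_+oo[EFin \o (fun x => normc (lp_mult m (inv_fourier q) x))])%E.
Proof.
move=> tm qi.
have qmi : cintegrable (fun xi => q xi * (m xi)%:C).
  under eq_fun do rewrite mulrC.
  have [M M0 mM] := test_fun_bounded tm.
  apply: (@cintegrableM_bounded _ _ _ _ M) => //.
    by apply: cmeasurable_real; exact: test_fun_measurable.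
  by move=> x; rewrite normc_real.
have e x : lp_mult m (inv_fourier q) x = ((2 * pi) ^- n)%:C *
    cintegral (fun xi => q xi * (m xi)%:C * cexpi (dotr x xi)).
  by rewrite lp_mult_inv_fourier//; congr (_ * _); apply: eq_cintegral => xi; rewrite mulrA.
have e0 : lp_mult m (inv_fourier q) 0 = ((2 * pi) ^- n)%:C * cintegral (fun xi => q xi * (m xi)%:C).
  rewrite e; congr (_ * _); apply: eq_cintegral => xi.
  have -> : cexpi (dotr 0 xi) = 1 :> R[i] by rewrite dotrC dotr0 /cexpi cos0 sin0.
  by rewrite mulr1.
rewrite -e0; apply: (@Lnorm_oo_ge (fun x => normc (lp_mult m (inv_fourier q) x))).
  by move=> x; exact: normc_ge0.
move=> x_ hx; rewrite e; apply: (cvg_ext (fun m => congr1 normc (e _))).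
exact: character_integral_cvg.
Qed.

End littlewood_paley.

(** * Cutoffs and two-dimensional curls *)

Section euclidean_norm.
Context {R : realType} {n : nat}.
Implicit Types (x y : 'rV[R]_n).

Lemma enorm_ge0 x : 0 <= enorm x.
Proof. exact: sqrtr_ge0. Qed.

Lemma enorm_sqr x : enorm x ^+ 2 = dotr x x.
Proof. by rewrite sqr_sqrtr// dotr_ge0. Qed.

Lemma enormZ a x : enorm (a *: x) = `|a| * enorm x.
Proof. by rewrite /enorm dotrZl dotrZr mulrA -expr2 sqrtrM ?sqr_ge0// sqrtr_sqr. Qed.

Lemma enormN x : enorm (- x) = enorm x.
Proof. by rewrite -scaleN1r enormZ normrN normr1 mul1r. Qed.

Lemma enorm0 : enorm (0 : 'rV[R]_n) = 0.
Proof. by rewrite /enorm dotr0 sqrtr0. Qed.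

Lemma cauchy_schwarz x y : dotr x y ^+ 2 <= dotr x x * dotr y y.
Proof.
have := dotr_ge0 y; rewrite le_eqVlt => /predU1P[y0|y0].
  have yi i : y 0 i = 0.
    apply/eqP; move/esym/eqP: y0; rewrite /dotr psumr_eq0 => [/allP/(_ i (mem_index_enum _))|j _].
      by rewrite mulf_eq0 orbb.
    by rewrite -expr2 sqr_ge0.
  have -> : dotr x y = 0 by rewrite /dotr big1// => i _; rewrite yi mulr0.
  by rewrite expr0n mulr_ge0// ?dotr_ge0// -y0.
have := dotr_ge0 (dotr y y *: x + (- dotr x y) *: y).
rewrite dotrDl !dotrDr !dotrZl !dotrZr (dotrC y x).
have -> : dotr y y * (dotr y y * dotr x x) + dotr y y * (- dotr x y * dotr x y) +
  (- dotr x y * (dotr y y * dotr x y) + - dotr x y * (- dotr x y * dotr y y)) =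
  dotr y y * (dotr x x * dotr y y - dotr x y ^+ 2) by ring.
by rewrite pmulr_rge0// subr_ge0.
Qed.

Lemma enormD x y : enorm (x + y) <= enorm x + enorm y.
Proof.
rewrite -[leRHS]ger0_norm ?addr_ge0 ?enorm_ge0// -sqrtr_sqr ler_wsqrtr//.
rewrite sqrrD !enorm_sqr dotrDl !dotrDr (dotrC y x).
have h : dotr x y <= enorm x * enorm y.
  rewrite (le_trans (ler_norm _))// -sqrtr_sqr /enorm -sqrtrM ?dotr_ge0// ler_wsqrtr//.
  exact: cauchy_schwarz.
rewrite mulr2n; lra.
Qed.

Lemma smooth_dotr_self : smooth (fun x : 'rV[R]_n => dotr x x).
Proof. by apply: smooth_sum => i; exact: (smoothM (smooth_coord i) (smooth_coord i)). Qed.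

(* A frequency [k] can only contribute to the shell [r <= |eta| <= 7r/3] through
   the spread [eta - k] of its wave packet, unless [|k|] is comparable to [r]. *)
Definition near_shell (r : R) (k : 'rV[R]_n) : bool :=
  (r / 2 <= enorm k) && (enorm k <= 14 / 3 * r).

(** Either |eta| <= 2 |eta - k|, or |eta| <= 2 |k| with k near the shell. The thresholds r/2 and
    14r/3 of [near_shell] are half the inner and twice the outer radius, and 7/3 is the ratio of the
    radii 7/6 and 1/2 of the cutoff. *)
Lemma shell_weight d (r : R) (eta k : 'rV[R]_n) : 0 < r ->
  r <= enorm eta -> enorm eta <= 7 / 3 * r ->
  enorm eta ^+ d <= 2 ^+ d * enorm (eta - k) ^+ d +
    (if near_shell r k then (2 * enorm k) ^+ d else 0).
Proof.
move=> r0 h1 h2.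
have t1 : enorm eta <= enorm (eta - k) + enorm k by rewrite -{1}(subrK k eta) enormD.
have t2 : enorm k <= enorm (eta - k) + enorm eta.
  by rewrite -(enormN (eta - k)) -{1}(subrK eta k) opprB enormD.
have p1 := enorm_ge0 eta; have p2 := enorm_ge0 (eta - k); have p3 := enorm_ge0 k.
have h (b : R) : 0 <= b -> enorm eta <= 2 * enorm (eta - k) ->
    enorm eta ^+ d <= 2 ^+ d * enorm (eta - k) ^+ d + b.
  move=> b0 h3; apply: (@le_trans _ _ (2 ^+ d * enorm (eta - k) ^+ d)); last by rewrite lerDl.
  by rewrite -exprMn lerXn2r// nnegrE// mulr_ge0.
case: ifPn => [_|].
  have [h3|h3] := leP (enorm eta) (2 * enorm (eta - k)).
    by apply: h => //; rewrite exprn_ge0// mulr_ge0.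
  apply: (@le_trans _ _ ((2 * enorm k) ^+ d)).
    by rewrite lerXn2r ?nnegrE ?mulr_ge0//; lra.
  by rewrite lerDr mulr_ge0// exprn_ge0.
rewrite negb_and -!ltNge => /orP h3; apply: h => //.
by case: h3 => h3; lra.
Qed.

End euclidean_norm.

(** * The Littlewood-Paley cutoff and sup bounds for its projections *)

Section cutoff.
Context {R : realType} {n : nat}.
Variable phi : 'rV[R]_n -> R.
Hypothesis phi_smooth : smooth phi.
Hypothesis phi_eq1 : forall xi, enorm xi <= 1 -> phi xi = 1.
Hypothesis phi_eq0 : forall xi, 7 / 6 < enorm xi -> phi xi = 0.
Implicit Types (x xi : 'rV[R]_n).
Local Notation mu := (@lebesgue_rV R n).
Local Notation normc := (@Normc.normc R).
Local Open Scope complex_scope.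

Lemma test_phi : test_fun phi.
Proof.
split => //; exists (7 / 6) => x i h; apply: phi_eq0.
exact: lt_le_trans h (coord_le_enorm x i).
Qed.

Lemma phi_origin : phi 0 = 1.
Proof. by apply: phi_eq1; rewrite enorm0. Qed.

Lemma lp_cutoff_test : test_fun (lp_cutoff phi).
Proof.
have -> : lp_cutoff phi = (fun xi => phi xi + -1 * phi (2 *: xi)).
  by apply/funext => xi; rewrite /lp_cutoff mulN1r.
apply: test_funD; first exact: test_phi.
by apply: test_funZ; apply: test_fun_dilation => //; exact: test_phi.
Qed.

Lemma lp_cutoff_supp xi : lp_cutoff phi xi != 0 -> 1 / 2 <= enorm xi <= 7 / 6.
Proof.
rewrite /lp_cutoff; have e2 : enorm (2 *: xi) = 2 * enorm xi by rewrite enormZ ger0_norm.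
have p := enorm_ge0 xi.
move=> h; apply/andP; split; rewrite leNgt; apply/negP => h1; move: h.
  by rewrite !phi_eq1 ?subrr ?eqxx// ?e2; lra.
by rewrite !phi_eq0 ?subrr ?eqxx// ?e2; lra.
Qed.

Lemma lp_cutoff_eq0 xi : 7 / 6 < enorm xi -> lp_cutoff phi xi = 0.
Proof.
move=> h; apply/eqP; rewrite -[_ == _]negbK; apply/negP => /lp_cutoff_supp/andP[_].
by rewrite leNgt h.
Qed.

Lemma lp_cutoff_eq1 xi : 7 / 12 < enorm xi -> enorm xi <= 1 -> lp_cutoff phi xi = 1.
Proof.
move=> h1 h2; have e2 : enorm (2 *: xi) = 2 * enorm xi by rewrite enormZ ger0_norm.
by rewrite /lp_cutoff phi_eq1// phi_eq0 ?subr0// e2; lra.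
Qed.

Definition lp_symbol (j : int) xi : R := lp_cutoff phi ((2 : R) ^ (- j) *: xi).

Lemma pow2_gt0 (j : int) : 0 < (2 : R) ^ j.
Proof. by rewrite exprz_gt0. Qed.

Lemma lp_symbol_test j : test_fun (lp_symbol j).
Proof. by apply: test_fun_dilation; [rewrite gt_eqF// pow2_gt0|exact: lp_cutoff_test]. Qed.

Lemma lp_projE j f : lp_proj phi j f = lp_mult (lp_symbol j) f.
Proof. by []. Qed.

Lemma lp_symbol_supp j xi : lp_symbol j xi != 0 ->
  2 ^ j / 2 <= enorm xi /\ enorm xi <= 7 / 6 * 2 ^ j.
Proof.
move=> /lp_cutoff_supp; rewrite enormZ gtr0_norm ?pow2_gt0// -invr_expz.
have h := pow2_gt0 j => /andP[h1 h2].
have -> : enorm xi = 2 ^ j * ((2 ^ j)^-1 * enorm xi) by rewrite mulrA mulfV ?mul1r ?gt_eqF.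
split; first by rewrite ler_pM2l//; move: h1; rewrite div1r.
by rewrite [leRHS]mulrC ler_pM2l.
Qed.

(** A projection is bounded by the L^1 norm of the transform over the annulus carrying the symbol,
    so the majorant H has to dominate only there. *)
Lemma lp_proj_bound j (f : 'rV[R]_n -> R) x (H : 'rV[R]_n -> R) (M : R) :
  test_fun f -> (forall xi, `|lp_cutoff phi xi| <= M) -> intR mu H ->
  (forall xi, 0 <= H xi) ->
  (forall xi, 2 ^ j / 2 <= enorm xi -> enorm xi <= 7 / 6 * 2 ^ j -> normc (ft f xi) <= H xi) ->
  normc (lp_proj phi j (fun y => (f y)%:C) x) <= (2 * pi) ^- n * (2 * (M * \int[mu]_xi H xi)).
Proof.
move=> tf hM Hi H0 fH.
have fi := test_cintegrable tf.
rewrite lp_projE (lp_mult_fourier x (lp_symbol_test j) fi).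
have M0 : 0 <= M := le_trans (normr_ge0 _) (hM 0).
have c0 : 0 <= (2 * pi) ^- n :> R by rewrite invr_ge0 exprn_ge0// mulr_ge0// pi_ge0.
rewrite Normc.normcM normc_real (ger0_norm c0) ler_wpM2l//.
rewrite -(@RintegralZl _ _ _ mu setT _ M measurableT Hi).
apply: normc_cintegral_le; last exact: intRZ.
  apply: cmeasurableM; last exact: fourier_measurable.
  apply: cmeasurableM; last exact: cmeasurable_character.
  by apply: cmeasurable_real; apply: test_fun_measurable; exact: lp_symbol_test.
move=> xi; rewrite !Normc.normcM normc_cexpi mulr1 normc_real.
have [->|s0] := eqVneq (lp_symbol j xi) 0.
  by rewrite normr0 mul0r mulr_ge0.
have [h1 h2] := lp_symbol_supp s0.
by apply: ler_pM => //; [exact: normc_ge0|exact: hM|exact: fH].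
Qed.

End cutoff.

(** * Divergence-free fields from a stream function *)

Section curl.
Context {R : realType} {n : nat}.
Variables i0 i1 : 'I_n.
Hypothesis i01 : i0 != i1.
Implicit Types (psi : 'rV[R]_n -> R) (x xi : 'rV[R]_n).
Local Notation mu := (@lebesgue_rV R n).
Local Notation normc := (@Normc.normc R).
Local Open Scope complex_scope.

(* Clairaut's theorem: both mixed derivatives have the same Fourier transform. *)
Lemma partialC (i j : 'I_n) psi : test_fun psi ->
  partial i (partial j psi) = partial j (partial i psi).
Proof.
move=> tp; apply/funext => x.
have tj := test_fun_partial j tp; have ti := test_fun_partial i tp.
have e xi : ft (partial i (partial j psi)) xi = ft (partial j (partial i psi)) xi.
  have e1 := etrans (ft_partial i xi tj) (congr1 (fun z => (0 +i* xi 0 i) * z) (ft_partial j xi tp)).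
  have e2 := etrans (ft_partial j xi ti) (congr1 (fun z => (0 +i* xi 0 j) * z) (ft_partial i xi tp)).
  exact: (etrans e1 (etrans (mulrCA _ _ _) (esym e2))).
have h1 := fourier_inversion_real x (test_fun_partial i tj).
have h2 := fourier_inversion_real x (test_fun_partial j ti).
have h3 := etrans (esym h1) (etrans (eq_cintegral
  (fun xi => congr1 (fun z => z * cexpi (dotr x xi)) (e xi))) h2).
exact: (mulfI (@twopi_neq0 R n) (congr1 (@complex.Re R) h3)).
Qed.

(** The rotated gradient in the plane of i0 and i1. The stream function may depend on all n
    coordinates, as it must in order to have compact support. *)
Definition curl psi x : 'rV[R]_n :=
  \row_k (if k == i0 then partial i1 psi x else if k == i1 then -1 * partial i0 psi x else 0).

Lemma curl0E psi : (fun x => curl psi x 0 i0) = partial i1 psi.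
Proof. by apply/funext => x; rewrite mxE eqxx. Qed.

Lemma curl1E psi : (fun x => curl psi x 0 i1) = (fun x => -1 * partial i0 psi x).
Proof. by apply/funext => x; rewrite mxE eq_sym (negbTE i01) eqxx. Qed.

Lemma curlE psi k : k != i0 -> k != i1 -> (fun x => curl psi x 0 k) = (fun=> 0).
Proof. by move=> k0 k1; apply/funext => x; rewrite mxE (negbTE k0) (negbTE k1). Qed.

Lemma curl_test psi k : test_fun psi -> test_fun (fun x => curl psi x 0 k).
Proof.
move=> tp; have [->|k0] := eqVneq k i0; first by rewrite curl0E; exact: test_fun_partial.
have [->|k1] := eqVneq k i1.
  by rewrite curl1E; apply: test_funZ; exact: test_fun_partial.
by rewrite curlE//; exact: test_fun0.
Qed.

Lemma curl_schwartz psi : test_fun psi -> schwartz_field (curl psi).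
Proof. by move=> tp k; apply: test_fun_schwartz; exact: curl_test. Qed.

Lemma sum_two (F : 'I_n -> R) : (forall k, k != i0 -> k != i1 -> F k = 0) ->
  \sum_k F k = F i0 + F i1.
Proof.
move=> h; rewrite (bigD1 i0)//= (bigD1 i1)/=; last by rewrite eq_sym.
by rewrite big1 ?addr0// => k /andP[k0 k1]; exact: h.
Qed.

Lemma curl_divergence_free psi : test_fun psi -> divergence_free (curl psi).
Proof.
move=> tp x; rewrite sum_two.
  rewrite curl0E curl1E partialZ; last by case: (test_fun_partial i0 tp).
  by rewrite (partialC i0 i1 tp) mulN1r subrr.
by move=> k k0 k1; rewrite curlE//; exact: derive_cst.
Qed.

Lemma ft_curl_bound psi k xi : test_fun psi ->
  normc (ft (fun x => curl psi x 0 k) xi) <= enorm xi * normc (ft psi xi).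
Proof.
move=> tp; have p0 : 0 <= enorm xi * normc (ft psi xi) by rewrite mulr_ge0 ?enorm_ge0 ?normc_ge0.
have hp i : normc (ft (partial i psi) xi) <= enorm xi * normc (ft psi xi).
  rewrite ft_partial// Normc.normcM ler_wpM2r ?normc_ge0//.
  by rewrite /= expr0n add0r sqrtr_sqr coord_le_enorm.
have [->|k0] := eqVneq k i0; first by rewrite curl0E.
have [->|k1] := eqVneq k i1.
  rewrite curl1E ftZ; last exact: test_fun_partial.
  by rewrite Normc.normcM normc_real normrN normr1 mul1r.
rewrite curlE// (_ : ft _ xi = 0) ?Normc.normc0//.
by rewrite -[LHS]mul1r -(mul0r (0 : R)); have := ftZ 0 xi test_fun0; rewrite mul0r => ->; rewrite mul0r mulr0.
Qed.

End curl.

(** * Wave packets *)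

Section wave_packets.
Context {R : realType} {n : nat}.
Variable phi : 'rV[R]_n -> R.
Hypothesis phi_smooth : smooth phi.
Hypothesis phi_eq1 : forall xi, enorm xi <= 1 -> phi xi = 1.
Hypothesis phi_eq0 : forall xi, 7 / 6 < enorm xi -> phi xi = 0.
Implicit Types (x xi eta : 'rV[R]_n).
Local Notation mu := (@lebesgue_rV R n).
Local Notation normc := (@Normc.normc R).
Local Open Scope complex_scope.

Lemma ft_cos_modulation (f : 'rV[R]_n -> R) k eta : test_fun f ->
  ft (fun x => f x * cos (dotr x k)) eta = (2^-1)%:C * (ft f (eta - k) + ft f (eta + k)).
Proof.
move=> tf; have fi := test_cintegrable tf.
have i1 : cintegrable (fun x => (f x)%:C * cexpi (dotr x k)).
  by apply: cintegrable_modulated => //; under eq_fun do rewrite dotrC; exact: measurable_dotr.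
have i2 : cintegrable (fun x => (f x)%:C * cexpi (dotr x (- k))).
  by apply: cintegrable_modulated => //; under eq_fun do rewrite dotrC; exact: measurable_dotr.
have e1 := fourier_modulation (fun x => (f x)%:C) k eta.
have e2 := fourier_modulation (fun x => (f x)%:C) (- k) eta.
rewrite opprK in e2; rewrite /ft -e1 -e2 -(fourierD eta i1 i2) -(fourierZ _ eta (cintegrableD i1 i2)).
congr (fourier _ eta); apply/funext => x.
by apply: complex_ReIm_eq; rewrite ?(cReM, cImM, cReD, cImD)/= dotrNr cosN sinN; field.
Qed.

(** The gain 1 + |eta|^2 over [ft_decay], obtained from the second derivatives of phi, is what
    absorbs the power |eta|^(s+1) for s <= 1. *)
Lemma ft_phi_decay : exists2 C : R, 0 <= C &
  forall eta, (1 + enorm eta ^+ 2) * normc (ft phi eta) <= C * decay eta.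
Proof.
have tp := test_phi phi_smooth phi_eq0.
have [C0 C00 h0] := ft_decay tp.
have hC i : exists C : R, 0 <= C /\ forall eta, normc (ft (partial i (partial i phi)) eta) <= C * decay eta.
  have [C C1 h] := ft_decay (test_fun_partial i (test_fun_partial i tp)).
  by exists C.
have [C hC'] := choice hC.
exists (C0 + \sum_i C i).
  by rewrite addr_ge0// sumr_ge0// => i _; case: (hC' i).
move=> eta; rewrite !mulrDl mul1r lerD// enorm_sqr /dotr !mulr_suml.
apply: ler_sum => i _; apply: le_trans (proj2 (hC' i) eta).
rewrite (ft_partial i eta (test_fun_partial i tp)) (ft_partial i eta tp) !Normc.normcM mulrA.
by rewrite /= expr0n add0r sqrtr_sqr -normrM ler_wpM2r ?normc_ge0// ler_norm.
Qed.

Variable I : finType.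
Variables (c : I -> R) (k : I -> 'rV[R]_n).

Definition trig_sum x : R := \sum_i c i * cos (dotr x (k i)).

(** The bump [phi] doubles as spatial window: it is smooth, compactly supported, and equal to 1 near
    the origin, where the pressure will be evaluated. *)
Definition packet (d : R) x : R := phi (d *: x) * trig_sum x.

Lemma smooth_trig_sum : smooth trig_sum.
Proof. by apply: smooth_sum => i; apply: smoothZ; exact: smooth_cos. Qed.

Lemma packet_test d : d != 0 -> test_fun (packet d).
Proof.
move=> d0; apply: test_funM; last exact: smooth_trig_sum.
by apply: test_fun_dilation => //; exact: test_phi.
Qed.

Section fixed_width.
Variables (d : R) (d0 : 0 < d).

(** Majorant for the transform of the window modulated to frequency q, scaled so that its integral
    does not depend on d. *)
Definition bump (q eta : 'rV[R]_n) : R := d ^- n * decay (d^-1 *: (eta - q)).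

Lemma bump_ge0 q eta : 0 <= bump q eta.
Proof. by rewrite mulr_ge0 ?invr_ge0 ?exprn_ge0// ltW// decay_gt0. Qed.

Lemma bump_integral q : intR mu (bump q) /\ \int[mu]_eta bump q eta = \int[mu]_eta decay eta.
Proof.
have dV0 : 0 < d^-1 by rewrite invr_gt0.
have [h1 h2] := Rint_affine (- (d^-1 *: q)) dV0 (@intR_decay R n).
have e eta : decay (d^-1 *: eta - d^-1 *: q) = decay (d^-1 *: (eta - q)) by rewrite scalerBr.
rewrite (eq_Rintegral _ (fun eta _ => e eta)) in h2.
have {}h1 : intR mu (fun eta => decay (d^-1 *: (eta - q))).
  by rewrite -(funext e).
split; first exact: intRZ.
by rewrite RintegralZl// h2 exprVn invrK mulrA mulVf ?mul1r// expf_neq0// gt_eqF.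
Qed.

(** With z = (eta - q)/d, the leak term of [shell_weight] is (2d)^(s+1) |z|^(s+1). One factor d is
    kept, the others are at most 1, and |z|^(s+1) is absorbed by the decay of the transform of
    phi. *)
Lemma ft_bump_bound (C : R) (s : nat) (r : R) (q eta : 'rV[R]_n) : d <= 1 ->
  (forall eta, (1 + enorm eta ^+ 2) * normc (ft phi eta) <= C * decay eta) ->
  (s <= 1)%N -> 0 < r -> r <= enorm eta -> enorm eta <= 7 / 3 * r ->
  enorm eta ^+ s.+1 * normc (ft (fun x => phi (d *: x)) (eta - q)) <=
  (2 ^+ s.+1 * d + (if near_shell r q then (2 * enorm q) ^+ s.+1 else 0)) * (C * bump q eta).
Proof.
move=> d1 hC s1 r0 h1 h2.
have tp := test_phi phi_smooth phi_eq0.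
have -> : ft (fun x => phi (d *: x)) (eta - q) = (d ^- n)%:C * ft phi (d^-1 *: (eta - q)).
  exact: (@fourier_dilation _ _ d (fun x => (phi x)%:C) (eta - q) d0 (test_cintegrable tp)).
have dn0 : 0 <= d ^- n by rewrite invr_ge0 exprn_ge0// ltW.
rewrite Normc.normcM normc_real (ger0_norm dn0).
set z := d^-1 *: (eta - q); set W := if _ then _ else _.
have W0 : 0 <= W by rewrite /W; case: ifP => // _; rewrite exprn_ge0// mulr_ge0// enorm_ge0.
have -> : (2 ^+ s.+1 * d + W) * (C * bump q eta) = d ^- n * ((2 ^+ s.+1 * d + W) * (C * decay z)).
  by rewrite /bump -/z (mulrCA C) (mulrCA (_ + W)).
rewrite mulrCA ler_wpM2l//.
have n0 := normc_ge0 (ft phi z); have z0 := enorm_ge0 z.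
apply: (@le_trans _ _ ((2 ^+ s.+1 * d + W) * ((1 + enorm z ^+ 2) * normc (ft phi z)))); last first.
  by rewrite ler_wpM2l// addr_ge0// mulr_ge0 ?exprn_ge0 ?(ltW d0).
rewrite mulrA ler_wpM2r//.
apply: (le_trans (shell_weight s.+1 q r0 h1 h2)); rewrite -/W mulrDl.
have eq1 : enorm (eta - q) = d * enorm z.
  by rewrite /z enormZ gtr0_norm ?invr_gt0// mulrA mulfV ?mul1r// gt_eqF.
apply: lerD; last by rewrite ler_peMr// lerDl sqr_ge0.
rewrite -mulrA ler_wpM2l ?exprn_ge0// eq1 exprMn.
apply: ler_pM; rewrite ?exprn_ge0 ?(ltW d0)//.
  by rewrite exprS -[leRHS]mulr1 ler_wpM2l ?(ltW d0)// exprn_ile1// ltW.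
(* For s = 0 this is |z| <= 1 + |z|^2, by completing the square; for s = 1 it is |z|^2 <= 1 +
   |z|^2. *)
move: s1; case: s {W W0} => [|[|//]] _.
  rewrite expr1; have := sqr_ge0 (enorm z - 1 / 2); rewrite sqrrB; move: (enorm z) => e.
  rewrite expr_div_n expr1n => h; nra.
by rewrite lerDr.
Qed.

(* The hypothesis on [near_shell] says that at most boundedly many of the packets,
   counted with weight [|c| |k|^(s+1)], meet a given dyadic shell. *)
Lemma packet_shell_bound (C B : R) (s : nat) (r : R) : d <= 1 -> 0 <= C ->
  (forall eta, (1 + enorm eta ^+ 2) * normc (ft phi eta) <= C * decay eta) ->
  (s <= 1)%N -> 0 < r -> d * \sum_i `|c i| <= 1 ->
  \sum_i `|c i| * (if near_shell r (k i) then (2 * enorm (k i)) ^+ s.+1 else 0) <= B ->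
  exists H : 'rV[R]_n -> R, [/\ intR mu H, forall eta, 0 <= H eta,
    \int[mu]_eta H eta <= (2 ^+ s.+1 + B) * (C * \int[mu]_eta decay eta) &
    forall eta, r <= enorm eta -> enorm eta <= 7 / 3 * r ->
      enorm eta ^+ s.+1 * normc (ft (packet d) eta) <= H eta].
Proof.
move=> d1 C0 hC s1 r0 dc hB.
pose W i := 2 ^+ s.+1 * d + (if near_shell r (k i) then (2 * enorm (k i)) ^+ s.+1 else 0).
have W0 i : 0 <= W i.
  rewrite addr_ge0 ?mulr_ge0 ?exprn_ge0 ?(ltW d0)//; case: ifP => // _.
  by rewrite exprn_ge0// mulr_ge0// enorm_ge0.
(* A cosine is half the sum of the characters of k and -k, whence two bumps per frequency and the
   factor 1/2. *)
pose H eta := \sum_i (`|c i| / 2 * W i * C) * (bump (k i) eta + bump (- k i) eta).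
have ib q := (bump_integral q).1.
exists H; split.
- by apply: intR_sum => i _; apply: intRZ; exact: intRD.
- move=> eta; apply: sumr_ge0 => i _.
  by rewrite mulr_ge0 ?addr_ge0 ?bump_ge0// !mulr_ge0.
- rewrite Rint_sum; last by move=> i _; apply: intRZ; exact: intRD.
  under eq_bigr => i _.
    rewrite RintegralZl//; last exact: intRD.
    rewrite RintegralD// (bump_integral (k i)).2 (bump_integral (- k i)).2.
    rewrite (_ : _ * (_ + _) = (`|c i| * W i) * (C * \int[mu]_eta decay eta)); last by field.
    over.
  rewrite -mulr_suml ler_wpM2r//.
    by rewrite mulr_ge0// Rintegral_ge0// => x _; rewrite ltW// decay_gt0.
  (* The leaks add up to 2^(s+1) d sum_i |c_i| <= 2^(s+1), and the frequencies near the shell to at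
     most B. *)
  under eq_bigr do rewrite /W mulrDr.
  rewrite big_split/= lerD// -mulr_suml mulrC -mulrA -[leRHS]mulr1 ler_wpM2l//.
- move=> eta h1 h2.
  have tp := packet_test (lt0r_neq0 d0).
  have tpd : test_fun (fun x => phi (d *: x)).
    by apply: test_fun_dilation; [rewrite gt_eqF|exact: test_phi].
  have e : ft (packet d) eta = \sum_i (c i)%:C * ((2^-1)%:C *
     (ft (fun x => phi (d *: x)) (eta - k i) + ft (fun x => phi (d *: x)) (eta + k i))).
    have -> : packet d = fun x => \sum_i c i * (phi (d *: x) * cos (dotr x (k i))).
      by apply/funext => x; rewrite /packet /trig_sum mulr_sumr; apply: eq_bigr => i _; rewrite mulrCA.
    have th i : test_fun (fun x => phi (d *: x) * cos (dotr x (k i))).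
      exact: (test_funM tpd (smooth_cos (k i))).
    rewrite ft_sum; last by move=> i; exact: test_funZ.
    apply: eq_bigr => i _; rewrite (ftZ _ _ (th i)); congr (_ * _).
    exact: ft_cos_modulation.
  rewrite e.
  apply: (@le_trans _ _ (enorm eta ^+ s.+1 * \sum_i `|c i| / 2 *
     (normc (ft (fun x => phi (d *: x)) (eta - k i)) + normc (ft (fun x => phi (d *: x)) (eta + k i))))).
    rewrite ler_wpM2l ?exprn_ge0 ?enorm_ge0//; apply: (le_trans (normc_sum _ _)).
    apply: ler_sum => i _; rewrite (Normc.normcM (c i)%:C) (Normc.normcM (2^-1)%:C) !normc_real.
    rewrite -[leRHS]mulrA (@ger0_norm _ 2^-1)//; apply: ler_wpM2l => //.
    by apply: ler_wpM2l => //; exact: le_normcD.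
  rewrite mulr_sumr; apply: ler_sum => i _.
  rewrite mulrCA -!mulrA ler_wpM2l// ler_wpM2l// mulrDr !mulrA mulrDr lerD//.
    by rewrite -mulrA; exact: (ft_bump_bound (k i)).
  rewrite -[X in eta + X]opprK -mulrA.
  have -> : W i = 2 ^+ s.+1 * d + (if near_shell r (- k i) then (2 * enorm (- k i)) ^+ s.+1 else 0).
    by rewrite /W /near_shell !enormN.
  exact: (ft_bump_bound (- k i)).
Qed.

End fixed_width.
End wave_packets.

(** * Besov and L^2 norms of dilated curls *)

Section field_norms.
Context {R : realType} {n : nat}.
Variable phi : 'rV[R]_n -> R.
Hypothesis phi_smooth : smooth phi.
Hypothesis phi_eq1 : forall xi, enorm xi <= 1 -> phi xi = 1.
Hypothesis phi_eq0 : forall xi, 7 / 6 < enorm xi -> phi xi = 0.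
Variables i0 i1 : 'I_n.
Hypothesis i01 : i0 != i1.
Implicit Types (x xi eta : 'rV[R]_n).
Local Notation mu := (@lebesgue_rV R n).
Local Notation normc := (@Normc.normc R).
Local Notation curl := (curl i0 i1).
Local Open Scope complex_scope.

Definition shell_controlled (s : nat) (K : R) (psi : 'rV[R]_n -> R) :=
  forall r : R, 0 < r -> exists H : 'rV[R]_n -> R,
    [/\ intR mu H, forall eta, 0 <= H eta, \int[mu]_eta H eta <= K &
    forall eta, r <= enorm eta -> enorm eta <= 7 / 3 * r ->
      enorm eta ^+ s.+1 * normc (ft psi eta) <= H eta].

Lemma cvec_norm_le m (z : 'I_m -> R[i]) : cvec_norm z <= \sum_k normc (z k).
Proof.
have -> : cvec_norm z = enorm (\row_k normc (z k)).
  by rewrite /cvec_norm /enorm /dotr; congr Num.sqrt; apply: eq_bigr => k _; rewrite mxE expr2.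
apply: (le_trans (enorm_le_sum _)); apply: ler_sum => k _.
by rewrite mxE ger0_norm// normc_ge0.
Qed.

Lemma besov_weight (s : nat) (j : int) : (2 : R) `^ (j%:~R * s%:R) = (2 ^ j) ^+ s.
Proof. by rewrite powRrM powR_intmul// powR_mulrn// ltW// pow2_gt0. Qed.

Section dilated.
Variables (a lam : R) (psi : 'rV[R]_n -> R).
Hypothesis a0 : 0 <= a.
Hypothesis lam0 : 0 < lam.
Hypothesis psi_test : test_fun psi.

Definition dilated x : R := a * psi (lam *: x).

Lemma dilated_test : test_fun dilated.
Proof. by apply: test_funZ; apply: test_fun_dilation; [rewrite gt_eqF|]. Qed.

Lemma ft_dilated xi : ft dilated xi = (a * lam ^- n)%:C * ft psi (lam^-1 *: xi).
Proof.
have td : test_fun (fun x => psi (lam *: x)).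
  by apply: test_fun_dilation; [rewrite gt_eqF|].
rewrite /dilated (ftZ _ _ td) rmorphM -mulrA; congr (_ * _).
exact: (fourier_dilation xi lam0 (test_cintegrable psi_test)).
Qed.

Lemma lp_proj_curl_bound (s : nat) (K M : R) j k x :
  (forall xi, `|lp_cutoff phi xi| <= M) -> shell_controlled s K psi ->
  (2 ^ j) ^+ s * normc (lp_proj phi j (fun y => (curl dilated y 0 k)%:C) x) <=
  (2 * pi) ^- n * (2 * (M * (a * lam ^+ s.+1 * 2 ^+ s * K))).
Proof.
move=> hM hK; have J0 := @pow2_gt0 R j; set J := 2 ^ j in J0 *.
(* The support J/2 <= |xi| <= 7J/6 of the symbol becomes, after undoing the dilation, the shell of
   inner radius r = J / (2 lam) and outer radius 7r/3. *)
have r0 : 0 < J / 2 / lam by rewrite !divr_gt0.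
have [H [Hi H0 HK hH]] := hK _ r0.
have lV0 : 0 < lam^-1 by rewrite invr_gt0.
(* On that shell 2 lam |eta| / J >= 1, so its power s can be inserted and raises |eta| to the
   controlled |eta|^(s+1). The other factors come from the dilation and from one derivative. *)
pose A := a * lam * lam ^- n * (2 * lam / J) ^+ s.
have A0 : 0 <= A.
  rewrite !mulr_ge0 ?invr_ge0 ?exprn_ge0 ?(ltW lam0)//.
  by rewrite divr_ge0 ?mulr_ge0// ltW.
pose H' xi := A * H (lam^-1 *: xi).
have [i1' e1] := Rint_affine 0 lV0 Hi.
rewrite (eq_Rintegral _ (g := fun xi => H (lam^-1 *: xi))) in e1; last by move=> xi _; rewrite addr0.
have {}i1' : intR mu (fun xi => H (lam^-1 *: xi)).
  by move: i1'; under eq_fun do rewrite addr0.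
have H'i : intR mu H' by exact: intRZ.
have H'0 xi : 0 <= H' xi by rewrite mulr_ge0.
have td := dilated_test.
have bound : normc (lp_proj phi j (fun y => (curl dilated y 0 k)%:C) x) <=
    (2 * pi) ^- n * (2 * (M * \int[mu]_xi H' xi)).
  apply: (lp_proj_bound phi_smooth phi_eq1 phi_eq0 x (curl_test i01 k td) hM H'i H'0) => xi h1 h2.
  apply: (le_trans (ft_curl_bound i01 k xi td)).
  rewrite ft_dilated Normc.normcM normc_real ger0_norm; last first.
    by rewrite mulr_ge0// invr_ge0 exprn_ge0// ltW.
  pose eta := lam^-1 *: xi.
  have exi : enorm xi = lam * enorm eta.
    by rewrite /eta enormZ gtr0_norm// mulrA mulfV ?mul1r// gt_eqF.
  have l1 : J / 2 / lam <= enorm eta.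
    rewrite ler_pdivrMr// [enorm eta * lam]mulrC -exi; exact: h1.
  have l2 : enorm eta <= 7 / 3 * (J / 2 / lam).
    rewrite /eta enormZ gtr0_norm// mulrC.
    have -> : 7 / 3 * (J / 2 / lam) = (7 / 6 * J) / lam by field; rewrite gt_eqF.
    by rewrite ler_wpM2r// ltW.
  have N0 := normc_ge0 (ft psi eta).
  rewrite -/eta exi /H' /A -/eta.
  have -> : lam * enorm eta * (a * lam ^- n * normc (ft psi eta)) =
    (a * lam * lam ^- n) * (enorm eta * normc (ft psi eta)) by ring.
  rewrite -[leRHS]mulrA ler_wpM2l ?mulr_ge0 ?invr_ge0 ?exprn_ge0 ?(ltW lam0)//.
  apply: (@le_trans _ _ ((2 * lam / J) ^+ s * (enorm eta ^+ s.+1 * normc (ft psi eta)))); last first.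
    by rewrite ler_wpM2l ?hH// exprn_ge0// divr_ge0 ?mulr_ge0// ltW.
  have -> : (2 * lam / J) ^+ s * (enorm eta ^+ s.+1 * normc (ft psi eta)) =
    enorm eta * normc (ft psi eta) * (2 * lam / J * enorm eta) ^+ s.
    by rewrite exprS [(_ * enorm eta) ^+ s]exprMn; ring.
  apply: ler_peMr; first exact: (mulr_ge0 (enorm_ge0 _) N0).
  apply: exprn_ege1.
  have E1 : 2 * lam / J * (J / 2 / lam) = 1 by field; rewrite !gt_eqF.
  rewrite -[leLHS]E1.
  apply: ler_wpM2l l1; apply: divr_ge0 (ltW J0); apply: mulr_ge0 (ltW lam0); exact: ler0n.
apply: (le_trans (ler_wpM2l _ bound)); first by rewrite exprn_ge0// ltW.
rewrite RintegralZl// e1 mulrCA ler_wpM2l//.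
  by rewrite invr_ge0 exprn_ge0// mulr_ge0// pi_ge0.
have M0 : 0 <= M := le_trans (normr_ge0 _) (hM 0).
rewrite mulrCA ler_wpM2l// mulrCA ler_wpM2l//.
have -> : J ^+ s * (A * (lam^-1 ^- n * \int[mu]_x H x)) = a * lam ^+ s.+1 * 2 ^+ s * \int[mu]_x H x.
  rewrite /A exprVn invrK !exprMn exprVn exprS.
  field; rewrite ?expf_neq0 ?gt_eqF//.
by rewrite ler_wpM2l// !mulr_ge0 ?exprn_ge0 ?(ltW lam0).
Qed.

Lemma besov_curl_bound (s : nat) (K M : R) :
  (forall xi, `|lp_cutoff phi xi| <= M) -> shell_controlled s K psi ->
  (besov_field phi s%:R (curl dilated) <=
    (n%:R * ((2 * pi) ^- n * (2 * (M * (a * lam ^+ s.+1 * 2 ^+ s * K)))))%:E)%E.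
Proof.
move=> hM hK; apply: ub_ereal_sup => _ [j _ <-].
rewrite besov_weight; set T := _ * _.
have J0 : 0 < ((2 : R) ^ j) ^+ s by rewrite exprn_gt0// pow2_gt0.
have -> : T = (2 ^ j) ^+ s * (((2 ^ j) ^+ s)^-1 * T) by rewrite mulrA mulfV ?mul1r// gt_eqF.
rewrite EFinM lee_wpmul2l ?lee_fin ?(ltW J0)//.
apply: Lnorm_oo_le => x; rewrite ger0_norm ?sqrtr_ge0//.
apply: (le_trans (cvec_norm_le _)).
rewrite -ler_pdivrMl ?invr_gt0// invrK mulr_sumr.
have -> : T = \sum_(k < n) ((2 * pi) ^- n * (2 * (M * (a * lam ^+ s.+1 * 2 ^+ s * K)))).
  by rewrite sumr_const card_ord /T mulr_natl.
by apply: ler_sum => k _; exact: lp_proj_curl_bound.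
Qed.

Lemma L2_curl (b : R) : 0 <= b ->
  a ^+ 2 * lam ^+ 2 * lam ^- n *
    \int[mu]_x (partial i0 psi x ^+ 2 + partial i1 psi x ^+ 2) <= b ^+ 2 ->
  (L2_norm (curl dilated) <= b%:E)%E.
Proof.
move=> b0 hb.
have sp := psi_test.1.
have sd : smooth (fun x => psi (lam *: x)) by exact: smooth_dilation.
have pE i x : partial i dilated x = a * lam * partial i psi (lam *: x).
  by rewrite (partialZ a i sd) (partial_dilation lam i sp) mulrA.
have cE x : enorm (curl dilated x) ^+ 2 = a ^+ 2 * lam ^+ 2 *
    (partial i0 psi (lam *: x) ^+ 2 + partial i1 psi (lam *: x) ^+ 2).
  rewrite enorm_sqr /dotr (sum_two i01); last first.
    by move=> k k0 k1; rewrite !mxE (negbTE k0) (negbTE k1) mul0r.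
  rewrite !mxE eqxx eq_sym (negbTE i01) eqxx !pE; ring.
pose G x := partial i0 psi x ^+ 2 + partial i1 psi x ^+ 2.
have Gi : intR mu G.
  apply: intRD; apply: test_fun_intR; rewrite /=.
    have t := test_fun_partial i0 psi_test.
    by under eq_fun do rewrite expr2; exact: (test_funM t t.1).
  have t := test_fun_partial i1 psi_test.
  by under eq_fun do rewrite expr2; exact: (test_funM t t.1).
have [Gai Ga] := Rint_affine 0 lam0 Gi.
have cEG x : enorm (curl dilated x) ^+ 2 = a ^+ 2 * lam ^+ 2 * G (lam *: x + 0).
  by rewrite cE addr0.
have ci : intR mu (fun x => enorm (curl dilated x) ^+ 2).
  by rewrite (funext cEG); exact: (intRZ _ Gai).
have cv : \int[mu]_x (enorm (curl dilated x) ^+ 2) <= b ^+ 2.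
  have -> : \int[mu]_x (enorm (curl dilated x) ^+ 2) =
      \int[mu]_x (a ^+ 2 * lam ^+ 2 * G (lam *: x + 0)).
    by congr Rintegral; apply/funext.
  have -> := @RintegralZl _ _ _ mu setT _ (a ^+ 2 * lam ^+ 2) measurableT Gai.
  by apply: le_trans hb; rewrite Ga mulrA.
rewrite /L2_norm unlock.
have E2 : (\int[mu]_x (`|(EFin \o (enorm \o curl dilated)) x| `^ 2) =
    (\int[mu]_x (enorm (curl dilated x) ^+ 2))%:E)%E.
  rewrite (EFin_Rint ci); apply: eq_integral => x _ /=.
  by rewrite ger0_norm ?enorm_ge0// powR_mulrn ?enorm_ge0.
rewrite E2 poweR_EFin lee_fin.
have i20 : 0 <= \int[mu]_x (enorm (curl dilated x) ^+ 2) by apply: Rintegral_ge0 => x _; rewrite sqr_ge0.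
rewrite -[leRHS]ger0_norm// -sqrtr_sqr -powR12_sqrt ?sqr_ge0//.
by apply: ge0_ler_powR; rewrite ?nnegrE ?sqr_ge0.
Qed.

End dilated.
End field_norms.

(** * Littlewood-Paley pieces of the pressure *)

Section pressure.
Context {R : realType} {n : nat}.
Variable phi : 'rV[R]_n -> R.
Hypothesis phi_smooth : smooth phi.
Hypothesis phi_eq1 : forall xi, enorm xi <= 1 -> phi xi = 1.
Hypothesis phi_eq0 : forall xi, 7 / 6 < enorm xi -> phi xi = 0.
Implicit Types (x xi eta : 'rV[R]_n) (l k : 'I_n).
Local Notation mu := (@lebesgue_rV R n).
Local Notation normc := (@Normc.normc R).
Local Open Scope complex_scope.

(* The summand [phi (4 xi) ^ 2] removes the singularity at the origin and vanishes
   on the support of the cutoff. *)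
Definition pressure_symbol l k xi : R :=
  lp_cutoff phi xi * (xi 0 l * xi 0 k * (dotr xi xi + phi (4 *: xi) ^+ 2)^-1).

Lemma pressure_symbol_test l k : test_fun (pressure_symbol l k).
Proof.
apply: test_funM; first exact: (lp_cutoff_test phi_smooth phi_eq0).
apply: smoothM; first exact: smoothM (smooth_coord l) (smooth_coord k).
have sd : smooth (fun xi => phi (4 *: xi)) by exact: smooth_dilation.
apply: smoothV => [|xi].
  apply: smoothD; first exact: smooth_dotr_self.
  have -> : (fun xi => phi (4 *: xi) ^+ 2) = (fun xi => phi (4 *: xi) * phi (4 *: xi)).
    by apply/funext => xi; rewrite expr2.
  exact: smoothM.
rewrite gt_eqF//; case: (ltP 1 (enorm (4 *: xi))) => h.
  apply: ltr_wpDr; first exact: sqr_ge0.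
  rewrite -enorm_sqr exprn_gt0//; move: h; rewrite enormZ ger0_norm//.
  by have := enorm_ge0 xi; lra.
by apply: ltr_wpDl; rewrite ?dotr_ge0// (phi_eq1 h) expr1n ltr01.
Qed.

Lemma pressure_symbolE l k xi : pressure_symbol l k xi =
  lp_cutoff phi xi * (xi 0 l * xi 0 k / enorm xi ^+ 2).
Proof.
rewrite /pressure_symbol enorm_sqr.
have [->|/lp_cutoff_supp h] := eqVneq (lp_cutoff phi xi) 0; first by rewrite !mul0r.
have /andP[h1 h2] := h phi_eq1 phi_eq0.
rewrite (phi_eq0 (xi := 4 *: xi)) ?expr0n ?addr0//.
by rewrite enormZ ger0_norm//; lra.
Qed.

Definition riesz l k xi : R := - (xi 0 l * xi 0 k / enorm xi ^+ 2).

Lemma riesz_bound l k xi : `|riesz l k xi| <= 1.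
Proof.
rewrite /riesz normrN normrM normrM normfV [`|enorm _ ^+ 2|]ger0_norm ?sqr_ge0//.
have := enorm_ge0 xi; rewrite le_eqVlt => /predU1P[<-|e0].
  (* At the origin the quotient is 0, the inverse of 0 being 0 by convention. *)
  by rewrite expr0n/= invr0 mulr0 ler01.
rewrite ler_pdivrMr ?exprn_gt0// mul1r expr2.
by apply: ler_pM => //; exact: coord_le_enorm.
Qed.

Lemma measurable_riesz l k : measurable_fun setT (riesz l k).
Proof.
have mc i : measurable_fun setT (fun xi => xi 0 i).
  by apply: continuous_measurable_rV; exact: continuous_coord.
rewrite /riesz; apply: measurable_funN.
apply: measurable_funM; first exact: measurable_funM.
(* The inverse is not continuous at the origin; as a real power it is still measurable. *)
have -> : (fun xi => (enorm xi ^+ 2)^-1) = (fun xi => dotr xi xi `^ (-1)).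
  by apply/funext => xi; rewrite enorm_sqr powR_inv1// dotr_ge0.
apply: (measurableT_comp (measurable_powR _)).
by apply: continuous_measurable_rV => xi; apply: (smooth_continuous smooth_dotr_self).
Qed.

Lemma riesz_dilation l k (a : R) xi : a != 0 -> riesz l k (a *: xi) = riesz l k xi.
Proof.
move=> a0; rewrite /riesz !enorm_sqr !mxE dotrZl dotrZr.
have [->|d0] := eqVneq (dotr xi xi) 0; first by rewrite !mulr0 invr0 !mulr0.
congr (- _); move: (dotr xi xi) (xi 0 l) (xi 0 k) d0 => d b c d0; by field; rewrite ?a0 ?d0.
Qed.

Section field.
Variable u : 'rV[R]_n -> 'rV[R]_n.
Hypothesis u_test : forall k, test_fun (fun x => u x 0 k).

Let uu l k x : R := u x 0 l * u x 0 k.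

Let uu_test l k : test_fun (uu l k).
Proof. exact: test_funM (u_test l) (u_test k).1. Qed.

Definition fourier_pressure xi : R[i] :=
  \sum_l \sum_k (riesz l k xi)%:C * ft (uu l k) xi.

Let term_cintegrable l k : cintegrable (fun xi => (riesz l k xi)%:C * ft (uu l k) xi).
Proof.
apply: (@cintegrableM_bounded _ _ _ _ 1); first exact: ft_cintegrable.
  exact: cmeasurable_real (measurable_riesz l k).
by move=> xi; rewrite normc_real; exact: riesz_bound.
Qed.

Lemma fourier_pressure_cintegrable : cintegrable fourier_pressure.
Proof. by apply: cintegrable_sum => l; apply: cintegrable_sum => k. Qed.

(** The Riesz symbols are bounded and the products of velocity components are test functions, so
    each term has an integrable transform and the sums can be taken under the integral. The pressure
    thereby falls under [lp_mult_esssup]. *)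
Lemma pressure_inv_fourier : pressure u = inv_fourier fourier_pressure.
Proof.
apply/funext => x; rewrite /pressure /inv_fourier.
have mx : measurable_fun setT (fun xi : 'rV[R]_n => dotr x xi) by exact: measurable_dotr.
have ti l k := cintegrable_modulated (term_cintegrable l k) mx.
under [in RHS]eq_cintegral do rewrite /fourier_pressure.
have -> : cintegral (fun xi => fourier_pressure xi * cexpi (dotr x xi)) =
    \sum_l \sum_k cintegral (fun xi => (riesz l k xi)%:C * ft (uu l k) xi * cexpi (dotr x xi)).
  rewrite (eq_cintegral (g := fun xi => \sum_l \sum_k (riesz l k xi)%:C * ft (uu l k) xi * cexpi (dotr x xi))).
    rewrite cintegral_sum => [|l]; last by apply: cintegrable_sum => k; exact: ti.
    by apply: eq_bigr => l _; rewrite cintegral_sum => [|k]; last exact: ti.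
  move=> xi; rewrite /fourier_pressure mulr_suml; apply: eq_bigr => l _.
  exact: mulr_suml.
rewrite mulr_sumr; apply: eq_bigr => l _; rewrite mulr_sumr.
by apply: eq_bigr => k _.
Qed.

(** The cutoff times the singular Riesz symbol is, up to sign, a smooth symbol; the sign disappears
    in the modulus. *)
Lemma lp_pressure_esssup j :
  ((normc (((2 * pi) ^- n)%:C * \sum_l \sum_k cintegral (fun xi =>
      (pressure_symbol l k ((2 : R) ^ (- j) *: xi))%:C * ft (uu l k) xi)))%:E <=
    'N[mu]_+oo[EFin \o (fun x => normc (lp_proj phi j (pressure u) x))])%E.
Proof.
have tm := lp_symbol_test phi_smooth phi_eq0 j.
have := lp_mult_esssup tm fourier_pressure_cintegrable.
rewrite -pressure_inv_fourier; apply: le_trans; rewrite lee_fin.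
rewrite !Normc.normcM ler_wpM2l ?normc_ge0//.
have st l k : test_fun (fun xi => pressure_symbol l k ((2 : R) ^ (- j) *: xi)).
  by apply: test_fun_dilation; [rewrite gt_eqF// pow2_gt0|exact: pressure_symbol_test].
have si l k : cintegrable (fun xi => (pressure_symbol l k ((2 : R) ^ (- j) *: xi))%:C * ft (uu l k) xi).
  have [M _ hM] := test_fun_bounded (st l k).
  apply: (@cintegrableM_bounded _ _ _ _ M); first exact: ft_cintegrable.
    by apply: cmeasurable_real; exact: test_fun_measurable.
  by move=> xi; rewrite normc_real.
have -> : cintegral (fun xi => fourier_pressure xi * (lp_symbol phi j xi)%:C) =
    -1 * \sum_l \sum_k cintegral (fun xi =>
      (pressure_symbol l k ((2 : R) ^ (- j) *: xi))%:C * ft (uu l k) xi).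
  rewrite (eq_cintegral (g := fun xi => -1 * \sum_l \sum_k
      (pressure_symbol l k ((2 : R) ^ (- j) *: xi))%:C * ft (uu l k) xi)); last first.
    move=> xi; rewrite /fourier_pressure mulr_suml mulr_sumr.
    apply: eq_bigr => l _; rewrite mulr_suml mulr_sumr; apply: eq_bigr => k _.
    have -> : pressure_symbol l k ((2 : R) ^ (- j) *: xi) =
        - (lp_symbol phi j xi * riesz l k xi).
      rewrite pressure_symbolE -/(lp_symbol phi j xi).
      rewrite -(@riesz_dilation l k (2 ^ (- j)) xi) ?gt_eqF ?pow2_gt0//.
      by rewrite /riesz mulrN opprK.
    have E (b c : R) : (- (b * c))%:C = - (b%:C * c%:C) :> R[i] by rewrite rmorphN rmorphM.
    rewrite E; move: (ft _ _) ((lp_symbol _ _ _)%:C) ((riesz _ _ _)%:C) => b c d; ring.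
  rewrite cintegralZ; last by apply: cintegrable_sum => l; apply: cintegrable_sum => k; exact: si.
  congr (_ * _); rewrite cintegral_sum => [|l]; last by apply: cintegrable_sum => k; exact: si.
  by apply: eq_bigr => l _; rewrite cintegral_sum => [|k]; last exact: si.
rewrite Normc.normcM.
have -> : normc (-1) = 1 by rewrite /= !oppr0 expr0n addr0 sqrrN expr1n sqrtr1.
by rewrite mul1r.
Qed.

End field.

Variables i0 i1 : 'I_n.
Hypothesis i01 : i0 != i1.
Local Notation curl := (curl i0 i1).

(** For a test function psi, the multiplication formula identifies this, up to a constant, with the
    unit-shell part of the pressure at the origin. With the transform on the symbol it also makes
    sense for a trigonometric sum psi, and so names the limit as well. *)
Definition pressure_form (psi : 'rV[R]_n -> R) : R[i] :=
  \sum_l \sum_k cintegral (fun z =>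
    (curl psi z 0 l * curl psi z 0 k)%:C * ft (pressure_symbol l k) z).

Lemma curl_dilated (a lam : R) psi x k : test_fun psi ->
  curl (dilated a lam psi) x 0 k = a * lam * curl psi (lam *: x) 0 k.
Proof.
move=> tp; have sd : smooth (fun x => psi (lam *: x)) by exact: smooth_dilation tp.1.
have pE i : partial i (dilated a lam psi) x = a * lam * partial i psi (lam *: x).
  by rewrite (partialZ a i sd) (partial_dilation lam i tp.1) mulrA.
rewrite !mxE !pE; case: ifP => // _; case: ifP => _; last by rewrite mulr0.
by rewrite mulrCA.
Qed.

(** Among all shells the one matching the dilation factor 2^j is kept. Undoing the dilation brings
    its symbol back to the unit shell, which leaves [pressure_form] of the undilated psi. *)
Lemma besov_pressure_lower (s : nat) (j : int) (a : R) psi : test_fun psi ->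
  ((((2 : R) ^ j) ^+ s * ((a * 2 ^ j) ^+ 2 * ((2 * pi) ^- n * normc (pressure_form psi))))%:E
    <= besov_scalar phi s%:R (pressure (curl (dilated a (2 ^ j) psi))))%E.
Proof.
move=> tp; have J0 := @pow2_gt0 R j.
have J0' : 0 < ((2 : R) ^ j)^-1 by rewrite invr_gt0.
have td : test_fun (dilated a (2 ^ j) psi) by exact: dilated_test.
pose N := ('N[mu]_+oo[EFin \o (fun x => cvec_norm (fun k : 'I_1 =>
  lp_proj phi j (pressure (curl (dilated a (2 ^ j) psi))) x))])%E.
apply: le_ereal_sup_tmp; exists ((2 `^ (j%:~R * s%:R))%:E * N)%E.
  by exists j.
rewrite besov_weight EFinM lee_wpmul2l ?lee_fin ?exprn_ge0 ?(ltW J0)//.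
have -> : N = ('N[mu]_+oo[EFin \o (fun x => normc
    (lp_proj phi j (pressure (curl (dilated a (2 ^ j) psi))) x))])%E.
  congr ('N[_]__[_])%E; apply/funext => x /=; congr _%:E.
  by rewrite /cvec_norm big_ord1 sqrtr_sqr ger0_norm// normc_ge0.
apply: le_trans (lp_pressure_esssup (fun k => curl_test i01 k td) j).
rewrite lee_fin le_eqVlt; apply/orP; left; apply/eqP.
have tW l k : test_fun (fun z => curl psi z 0 l * curl psi z 0 k).
  exact: test_funM (curl_test i01 l tp) (curl_test i01 k tp).1.
have ts := pressure_symbol_test.
have -> : \sum_l \sum_k cintegral (fun xi =>
      (pressure_symbol l k ((2 : R) ^ (- j) *: xi))%:C *
       ft (fun x => curl (dilated a (2 ^ j) psi) x 0 l * curl (dilated a (2 ^ j) psi) x 0 k) xi) =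
    ((a * 2 ^ j) ^+ 2)%:C * pressure_form psi.
  rewrite /pressure_form mulr_sumr; apply: eq_bigr => l _.
  rewrite mulr_sumr; apply: eq_bigr => k _.
  have -> : (fun x => curl (dilated a (2 ^ j) psi) x 0 l * curl (dilated a (2 ^ j) psi) x 0 k) =
      dilated ((a * 2 ^ j) ^+ 2) (2 ^ j) (fun z => curl psi z 0 l * curl psi z 0 k).
    apply/funext => x; rewrite /dilated expr2 -mulrACA.
    exact: (congr2 *%R (curl_dilated a (2 ^ j) x l tp) (curl_dilated a (2 ^ j) x k tp)).
  rewrite -(multiplication_formula (ts l k) (tW l k)).
  pose h xi := (pressure_symbol l k xi)%:C * ft (fun z => curl psi z 0 l * curl psi z 0 k) xi.
  have hi : cintegrable h.
    have [M _ hM] := test_fun_bounded (ts l k).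
    apply: (@cintegrableM_bounded _ _ _ _ M); first exact: ft_cintegrable.
      by apply: cmeasurable_real; exact: test_fun_measurable.
    by move=> xi; rewrite normc_real.
  have [hi' e] := cintegral_affine 0 J0' hi.
  (* The factor (2^j)^-n from the transform of a dilation cancels the Jacobian of the change of
     variable in xi. *)
  rewrite (eq_cintegral (g := fun xi => ((a * 2 ^ j) ^+ 2 * (2 ^ j) ^- n)%:C *
    h (((2 : R) ^ j)^-1 *: xi + 0))); last first.
    move=> xi; rewrite (ft_dilated _ J0 (tW l k)) /h addr0 -invr_expz.
    by move: (ft _ _) (_%:C) (_%:C) => b c d; ring.
  rewrite (cintegralZ _ hi') e mulrA -rmorphM exprVn invrK -mulrA mulVf ?mulr1//.
    by rewrite expf_neq0// gt_eqF.
rewrite !Normc.normcM !normc_real !ger0_norm ?sqr_ge0//; first by rewrite mulrCA.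
by rewrite invr_ge0 exprn_ge0// mulr_ge0// pi_ge0.
Qed.

End pressure.

(** * The limit of wide packets *)

Section pressure_limit.
Context {R : realType} {n : nat}.
Variable phi : 'rV[R]_n -> R.
Hypothesis phi_smooth : smooth phi.
Hypothesis phi_eq1 : forall xi, enorm xi <= 1 -> phi xi = 1.
Hypothesis phi_eq0 : forall xi, 7 / 6 < enorm xi -> phi xi = 0.
Variables i0 i1 : 'I_n.
Hypothesis i01 : i0 != i1.
Implicit Types (x xi eta v a b : 'rV[R]_n) (l m : 'I_n).
Local Notation mu := (@lebesgue_rV R n).
Local Notation normc := (@Normc.normc R).
Local Notation curl := (curl i0 i1).
Local Notation sigma := (pressure_symbol phi).
Local Open Scope complex_scope.

Lemma cos_ft_integral (f : 'rV[R]_n -> R) v : test_fun f ->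
  cintegrable (fun z => (cos (dotr z v))%:C * ft f z) /\
  cintegral (fun z => (cos (dotr z v))%:C * ft f z) =
    ((2 * pi) ^+ n * ((f v + f (- v)) / 2))%:C.
Proof.
move=> tf; have fi := ft_cintegrable tf.
have m1 : measurable_fun setT (fun z : 'rV[R]_n => dotr v z) by exact: measurable_dotr.
have m2 : measurable_fun setT (fun z : 'rV[R]_n => dotr (- v) z) by exact: measurable_dotr.
have j1 := cintegrable_modulated fi m1; have j2 := cintegrable_modulated fi m2.
have E z : (cos (dotr z v))%:C * ft f z =
    (2^-1)%:C * (ft f z * cexpi (dotr v z) + ft f z * cexpi (dotr (- v) z)).
  rewrite dotrNl (dotrC z v); move: (ft f z) (dotr v z) => w t.
  by apply: complex_ReIm_eq; rewrite ?(cReM, cImM, cReD, cImD)/= cosN sinN; field.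
have j12 := cintegrableD j1 j2.
rewrite (funext E); split; first exact: cintegrableZ.
rewrite (cintegralZ _ j12) (cintegralD j1 j2) !(fourier_inversion_real _ tf).
by rewrite -rmorphD -rmorphM; congr (_%:C); field.
Qed.

Lemma cvg_sumr (J : finType) (f : J -> nat -> R) (t : J -> R) :
  (forall i, f i p @[p --> \oo] --> t i) ->
  \sum_i f i p @[p --> \oo] --> \sum_i t i.
Proof.
move=> ft; elim: index_enum => [|i s ih].
  by rewrite big_nil; apply: (cvg_ext (fun p => big_nil _ _ _ _)); exact: cvg_cst.
rewrite big_cons; apply: (cvg_ext (fun p => big_cons _ _ _ _ _ _)).
by apply: cvgD.
Qed.

Section trigonometric.
Variables (I : finType) (c : I -> R) (k : I -> 'rV[R]_n).

Local Notation Theta := (trig_sum c k).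

(** The quarter turn of a in the plane of i0 and i1: the curl of cos(k . x) is [perp] k times sin(k
    . x). *)
Definition perp a : 'rV[R]_n :=
  a 0 i0 *: delta_mx 0 i1 - a 0 i1 *: delta_mx 0 i0.

Definition cross a b : R := a 0 i0 * b 0 i1 - a 0 i1 * b 0 i0.

Lemma dotr_perp a b : dotr (perp a) b = cross a b.
Proof.
by rewrite /perp dotrDl -scaleNr !dotrZl !dotr_delta mulNr.
Qed.

Lemma partial_trig_sum (j : 'I_n) x :
  partial j Theta x = \sum_i c i * (- k i 0 j * sin (dotr x (k i))).
Proof.
rewrite /trig_sum partial_sum; last by move=> i; apply: smoothZ; exact: smooth_cos.
by apply: eq_bigr => i _; rewrite (partialZ _ _ (smooth_cos (k i))) partial_cos.
Qed.

Lemma curl_trig_sum l x :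
  curl Theta x 0 l = \sum_i c i * perp (k i) 0 l * sin (dotr x (k i)).
Proof.
rewrite mxE !partial_trig_sum; case: (eqVneq l i0) => [->|l0].
  apply: eq_bigr => i _; rewrite !mxE !eqxx (negbTE i01)/= mulr0 mulr1 sub0r; ring.
case: (eqVneq l i1) => [->|l1].
  rewrite mulr_sumr; apply: eq_bigr => i _.
  rewrite !mxE !eqxx eq_sym (negbTE i01)/= mulr0 mulr1 subr0; ring.
rewrite big1// => i _.
by rewrite !mxE (negbTE l0) (negbTE l1)/= ?andbF !mulr0 subrr mulr0 mul0r.
Qed.

(* Each cosine contributes both [v] and [- v], and [phi] need not be even. *)
Definition mean_multiplier v : R :=
  (lp_cutoff phi v + lp_cutoff phi (- v)) / 2 / enorm v ^+ 2.

Lemma sum_perp_symbol a b v :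
  \sum_l \sum_m perp a 0 l * perp b 0 m * ((sigma l m v + sigma l m (- v)) / 2) =
  mean_multiplier v * (dotr (perp a) v * dotr (perp b) v).
Proof.
rewrite {1}/dotr mulr_suml mulr_sumr; apply: eq_bigr => l _.
rewrite /dotr !mulr_sumr; apply: eq_bigr => m _.
rewrite !(pressure_symbolE phi_eq1 phi_eq0) enormN !mxE /mean_multiplier; ring.
Qed.

Definition interaction : R := \sum_i \sum_j c i * c j / 2 * cross (k i) (k j) ^+ 2 *
  (mean_multiplier (k i - k j) + mean_multiplier (k i + k j)).

(** A product of sines is half the difference of the cosines at k_i - k_j and k_i + k_j. Contracting
    the symbol at v = k_i - k_j with [perp] k_i and [perp] k_j gives cross^2, at v = k_i + k_j it
    gives - cross^2; the two signs compensate, so differences and sums enter [interaction] alike. *)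
Lemma pressure_form_trig_sum :
  pressure_form phi i0 i1 Theta = ((2 * pi) ^+ n * interaction)%:C.
Proof.
pose S l m v := (sigma l m v + sigma l m (- v)) / 2.
pose X l m i j := c i * c j / 2 * (perp (k i) 0 l * perp (k j) 0 m * (S l m (k i - k j) - S l m (k i + k j))).
have ts := pressure_symbol_test phi_smooth phi_eq1 phi_eq0.
have E l m : cintegral (fun z => (curl Theta z 0 l * curl Theta z 0 m)%:C * ft (sigma l m) z) =
    ((2 * pi) ^+ n * \sum_i \sum_j X l m i j)%:C.
  pose C i j := c i * c j / 2 * (perp (k i) 0 l * perp (k j) 0 m).
  pose h i j z := (C i j)%:C * ((cos (dotr z (k i - k j)))%:C * ft (sigma l m) z +
     (-1)%:C * ((cos (dotr z (k i + k j)))%:C * ft (sigma l m) z)).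
  have p1 i j := cos_ft_integral (k i - k j) (ts l m).
  have p2 i j := cos_ft_integral (k i + k j) (ts l m).
  have hi i j : cintegrable (h i j).
    apply: cintegrableZ; apply: cintegrableD; first exact: (p1 i j).1.
    by apply: cintegrableZ; exact: (p2 i j).1.
  have hE i j : cintegral (h i j) = ((2 * pi) ^+ n * X l m i j)%:C.
    have q := cintegrableZ (-1)%:C (p2 i j).1.
    rewrite /h (cintegralZ _ (cintegrableD (p1 i j).1 q)) (cintegralD (p1 i j).1 q).
    rewrite (cintegralZ _ (p2 i j).1) (p1 i j).2 (p2 i j).2 -!rmorphM -rmorphD -rmorphM.
    by congr (_%:C); rewrite /X /C /S; ring.
  rewrite (eq_cintegral (g := fun z => \sum_i \sum_j h i j z)); last first.
    move=> z; rewrite !curl_trig_sum.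
    have -> : (\sum_i c i * perp (k i) 0 l * sin (dotr z (k i))) *
       (\sum_i c i * perp (k i) 0 m * sin (dotr z (k i))) =
       \sum_i \sum_j C i j * (cos (dotr z (k i - k j)) - cos (dotr z (k i + k j))).
      rewrite mulr_suml; apply: eq_bigr => i _; rewrite mulr_sumr; apply: eq_bigr => j _.
      rewrite !dotrDr dotrNr cosB cosD /C.
      by move: (sin _) (sin _) (cos _) (cos _) => s1 s2 c1 c2; field.
    rewrite rmorph_sum mulr_suml; apply: eq_bigr => i _.
    rewrite rmorph_sum mulr_suml; apply: eq_bigr => j _.
    have EC (b c1 d : R) : (b * (c1 - d))%:C = b%:C * (c1%:C - d%:C) :> R[i] by rewrite rmorphM rmorphB.
    have -> : h i j z = (C i j)%:C * ((cos (dotr z (k i - k j)))%:C * ft (sigma l m) z +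
     -1 * ((cos (dotr z (k i + k j)))%:C * ft (sigma l m) z)) by rewrite /h rmorphN rmorph1.
    transitivity ((C i j)%:C * ((cos (dotr z (k i - k j)))%:C - (cos (dotr z (k i + k j)))%:C) *
      ft (sigma l m) z); first exact: (congr1 ( *%R^~ _) (EC _ _ _)).
    move: (ft _ _) ((C i j)%:C) ((cos _)%:C) ((cos _)%:C) => w q1 q2 q3.
    ring.
  rewrite cintegral_sum => [|i]; last by apply: cintegrable_sum => j; exact: hi.
  rewrite mulr_sumr rmorph_sum; apply: eq_bigr => i _.
  rewrite cintegral_sum => [|j]; last exact: hi.
  by rewrite mulr_sumr rmorph_sum; apply: eq_bigr => j _; exact: hE.
rewrite /pressure_form.
transitivity (\sum_l \sum_m ((2 * pi) ^+ n * \sum_i \sum_j X l m i j)%:C : R[i]).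
  by apply: eq_bigr => l _; apply: eq_bigr => m _; exact: E.
transitivity (((2 * pi) ^+ n * \sum_l \sum_m \sum_i \sum_j X l m i j)%:C : R[i]).
  rewrite mulr_sumr rmorph_sum; apply: eq_bigr => l _.
  by rewrite mulr_sumr rmorph_sum.
congr ((_ * _)%:C).
transitivity (\sum_l \sum_i \sum_m \sum_j X l m i j).
  by apply: eq_bigr => l _; rewrite exchange_big.
rewrite exchange_big; apply: eq_bigr => i _.
transitivity (\sum_l \sum_j \sum_m X l m i j).
  by apply: eq_bigr => l _; rewrite exchange_big.
rewrite exchange_big; apply: eq_bigr => j _.
have -> : \sum_l \sum_m X l m i j = c i * c j / 2 *
   (\sum_l \sum_m perp (k i) 0 l * perp (k j) 0 m * S l m (k i - k j) -
    \sum_l \sum_m perp (k i) 0 l * perp (k j) 0 m * S l m (k i + k j)).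
  rewrite -sumrB mulr_sumr; apply: eq_bigr => l _.
  rewrite -sumrB mulr_sumr; apply: eq_bigr => m _.
  by rewrite /X mulrBr.
rewrite !sum_perp_symbol !dotr_perp /cross !mxE; ring.
Qed.

(** Width in frequency: the spatial window has size of order p + 1. *)
Definition width (p : nat) : R := p.+1%:R^-1.

Lemma width_gt0 p : 0 < width p. Proof. by rewrite invr_gt0 ltr0n. Qed.

Lemma width_le1 p : width p <= 1.
Proof. by rewrite invf_le1 ?ltr0n// ler1n. Qed.

Lemma width_cvg : width p @[p --> \oo] --> 0.
Proof. exact: cvg_harmonic. Qed.

Lemma partial_packet d j x : partial j (packet phi c k d) x =
  phi (d *: x) * partial j Theta x + Theta x * (d * partial j phi (d *: x)).
Proof.
have sd : smooth (fun x => phi (d *: x)) by exact: smooth_dilation.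
rewrite /packet (partialM j sd (smooth_trig_sum c k)).
by rewrite (partial_dilation d j phi_smooth).
Qed.

Lemma partial_packet_cvg j x :
  partial j (packet phi c k (width p)) x @[p --> \oo] --> partial j Theta x.
Proof.
apply: (cvg_ext (fun p => partial_packet (width p) j x)).
have wc (f : 'rV[R]_n -> R) : smooth f -> f (width p *: x) @[p --> \oo] --> f 0.
  move=> sf; have <- : 0 *: x = 0 by rewrite scale0r.
  have fc : continuous (fun t : R => f (t *: x)).
    move=> t; apply: (@continuous_comp _ _ _ (fun t : R => t *: x) f); first exact: scalel_continuous.
    exact: smooth_continuous.
  exact: (cvg_comp _ _ width_cvg (fc 0)).
have h : phi (width p *: x) * partial j Theta x +
    Theta x * (width p * partial j phi (width p *: x)) @[p --> \oo] -->
    phi 0 * partial j Theta x + Theta x * (0 * partial j phi 0).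
  apply: cvgD; first exact: cvgM (wc _ phi_smooth) (cvg_cst _).
  exact: cvgM (cvg_cst _) (cvgM width_cvg (wc _ (smooth_partial j phi_smooth))).
by move: h; rewrite (phi_origin phi_eq1) mul1r mul0r mulr0 addr0.
Qed.

Lemma curl_packet_cvg l x :
  curl (packet phi c k (width p)) x 0 l @[p --> \oo] --> curl Theta x 0 l.
Proof.
rewrite mxE; apply: (cvg_ext (fun p => mxE _ _ _ _)).
case: ifP => _; first exact: partial_packet_cvg.
case: ifP => _; last exact: cvg_cst.
by apply: cvgM; [exact: cvg_cst|exact: partial_packet_cvg].
Qed.

Lemma curl_packet_bound : exists2 A : R, 0 <= A &
  forall p x l, `|curl (packet phi c k (width p)) x 0 l| <= A.
Proof.
have tp := test_phi phi_smooth phi_eq0.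
have [M0 M00 h0] := test_fun_bounded tp.
have hT x : `|Theta x| <= \sum_i `|c i|.
  apply: (le_trans (ler_norm_sum _ _ _)); apply: ler_sum => i _.
  by rewrite normrM ler_piMr// ler_norml cos_geN1 cos_le1.
have hP j : exists A : R, 0 <= A /\ forall p x, `|partial j (packet phi c k (width p)) x| <= A.
  have [M1 M10 h1] := test_fun_bounded (test_fun_partial j tp).
  have hD x : `|partial j Theta x| <= \sum_i `|c i| * `|k i 0 j|.
    rewrite partial_trig_sum; apply: (le_trans (ler_norm_sum _ _ _)); apply: ler_sum => i _.
    by rewrite normrM ler_wpM2l// normrM normrN ler_piMr// ler_norml sin_geN1 sin_le1.
  exists (M0 * (\sum_i `|c i| * `|k i 0 j|) + (\sum_i `|c i|) * M1); split.
    by rewrite addr_ge0// mulr_ge0// sumr_ge0// => i _; rewrite mulr_ge0.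
  move=> p x; rewrite partial_packet; apply: (le_trans (ler_normD _ _)).
  rewrite !normrM; apply: lerD; first by apply: ler_pM.
  have w1 : `|width p| <= 1 by rewrite ger0_norm ?width_le1// ltW// width_gt0.
  apply: ler_pM (normr_ge0 _) (mulr_ge0 (normr_ge0 _) (normr_ge0 _)) (hT x) _.
  by rewrite -[leRHS]mul1r; apply: ler_pM.
have [A0 [A00 a0]] := hP i0; have [A1 [A10 a1]] := hP i1.
exists (A0 + A1); first exact: addr_ge0.
move=> p x l; rewrite mxE; case: ifP => _; first by apply: (le_trans (a1 p x)); rewrite lerDr.
case: ifP => _; last by rewrite normr0 addr_ge0.
by rewrite mulN1r normrN; apply: (le_trans (a0 p x)); rewrite lerDl.
Qed.

(** The curls converge pointwise with a bound uniform in p, and the transform of the symbol is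
    integrable, so dominated convergence applies to each pair of components. *)
Lemma pressure_form_cvg :
  complex.Re (pressure_form phi i0 i1 (packet phi c k (width p))) @[p --> \oo] -->
  (2 * pi) ^+ n * interaction.
Proof.
have ReS (J : finType) (f : J -> R[i]) : complex.Re (\sum_i f i) = \sum_i complex.Re (f i).
  exact: (big_morph (@complex.Re R) (@cReD R) (erefl _)).
pose T psi l m := complex.Re (cintegral (fun z =>
    (curl psi z 0 l * curl psi z 0 m)%:C * ft (sigma l m) z)).
have E psi : complex.Re (pressure_form phi i0 i1 psi) = \sum_l \sum_m T psi l m.
  etransitivity; first exact: ReS.
  by apply: eq_bigr => l _; exact: ReS.
have EL : (2 * pi) ^+ n * interaction = \sum_l \sum_m T Theta l m.
  exact: etrans (esym (congr1 (@complex.Re R) pressure_form_trig_sum)) (E Theta).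
rewrite EL; apply: (@cvg_ext _ (fun p => complex.Re (pressure_form phi i0 i1 (packet phi c k (width p))))
  (fun p => \sum_l \sum_m T (packet phi c k (width p)) l m) _ (fun p => E _)).
apply: cvg_sumr => l; apply: cvg_sumr => m; rewrite /T.
have ts := pressure_symbol_test phi_smooth phi_eq1 phi_eq0 l m.
have fi := ft_cintegrable ts.
have [A A0 hA] := curl_packet_bound.
have gi : intR mu (fun z => A * A * normc (ft (sigma l m) z)).
  by apply: intRZ; exact: cintegrable_normc.
have ReZ (r : R) (w : R[i]) : complex.Re (r%:C * w) = r * complex.Re w.
  by case: w => w1 w2 /=; rewrite mul0r subr0.
have ImZ (r : R) (w : R[i]) : complex.Im (r%:C * w) = r * complex.Im w.
  by case: w => w1 w2 /=; rewrite mul0r addr0.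
have cc x : curl (packet phi c k (width p)) x 0 l * curl (packet phi c k (width p)) x 0 m
    @[p --> \oo] --> curl Theta x 0 l * curl Theta x 0 m.
  by apply: cvgM; exact: curl_packet_cvg.
have wt p : test_fun (packet phi c k (width p)).
  by apply: packet_test => //; rewrite gt_eqF// width_gt0.
pose f_ p z := (curl (packet phi c k (width p)) z 0 l * curl (packet phi c k (width p)) z 0 m)%:C
   * ft (sigma l m) z.
have [] := @cintegral_dct _ _ f_ (fun z => (curl Theta z 0 l * curl Theta z 0 m)%:C * ft (sigma l m) z)
   (fun z => A * A * normc (ft (sigma l m) z)) _ _ _ gi _ => //.
- move=> p; apply: cmeasurableM; last exact: ((cintegrableP _).1 fi).1.
  apply: cmeasurable_real; apply: test_fun_measurable.
  exact: test_funM (curl_test i01 l (wt p)) (curl_test i01 m (wt p)).1.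
- move=> x; rewrite ReZ; apply: (cvg_ext (fun p => ReZ _ _)); by apply: cvgM; [exact: cc|exact: cvg_cst].
- move=> x; rewrite ImZ; apply: (cvg_ext (fun p => ImZ _ _)); by apply: cvgM; [exact: cc|exact: cvg_cst].
- move=> p x; rewrite /f_ Normc.normcM normc_real; apply: ler_wpM2r; first exact: normc_ge0.
  by rewrite normrM; apply: ler_pM.
Qed.

End trigonometric.
End pressure_limit.

(** * Norm inflation *)

Section norm_inflation.
Context {R : realType} {n : nat}.
Variable phi : 'rV[R]_n -> R.
Hypothesis phi_smooth : smooth phi.
Hypothesis phi_eq1 : forall xi, enorm xi <= 1 -> phi xi = 1.
Hypothesis phi_eq0 : forall xi, 7 / 6 < enorm xi -> phi xi = 0.
Variables i0 i1 : 'I_n.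
Hypothesis i01 : i0 != i1.
Local Notation mu := (@lebesgue_rV R n).
Local Notation normc := (@Normc.normc R).
Local Notation curl := (curl i0 i1).

Definition shell_sum (I : finType) (c : I -> R) (k : I -> 'rV[R]_n) (s : nat) (r : R) : R :=
  \sum_i `|c i| * (if near_shell r (k i) then (2 * enorm (k i)) ^+ s.+1 else 0).

(** The order of quantifiers is the point: K depends neither on the family nor on d. *)
Lemma packet_shell_controlled (s : nat) (B : R) : (s <= 1)%N -> 0 <= B ->
  exists2 K : R, 0 <= K &
  forall (I : finType) (c : I -> R) (k : I -> 'rV[R]_n) (d : R), 0 < d -> d <= 1 ->
    d * \sum_i `|c i| <= 1 -> (forall r : R, 0 < r -> shell_sum c k s r <= B) ->
    shell_controlled s K (packet phi c k d).
Proof.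
move=> s1 B0; have [C C0 hC] := ft_phi_decay phi_smooth phi_eq0.
exists ((2 ^+ s.+1 + B) * (C * \int[mu]_eta decay eta)).
  have d0 : 0 <= \int[mu]_eta decay eta.
    by apply: Rintegral_ge0 => x _; rewrite ltW// decay_gt0.
  apply: mulr_ge0; last exact: mulr_ge0.
  by apply: addr_ge0 => //; apply: exprn_ge0; exact: ler0n.
move=> I c k d d0 d1 dc hB r r0.
exact: (packet_shell_bound phi_smooth phi_eq0 d0 d1 C0 hC s1 r0 dc (hB r r0)).
Qed.

Lemma packet_pressure_lower (I : finType) (c : I -> R) (k : I -> 'rV[R]_n) (T : R) :
  T < interaction phi i0 i1 c k ->
  \forall p \near \oo, T <= (2 * pi) ^- n *
    normc (pressure_form phi i0 i1 (packet phi c k (width p))).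
Proof.
move=> hT; have q0 : 0 < (2 * pi : R) ^+ n by rewrite exprn_gt0// mulr_gt0// pi_gt0.
have h := @pressure_form_cvg _ _ _ phi_smooth phi_eq1 phi_eq0 _ _ i01 _ c k.
have hT' : (2 * pi) ^+ n * T < (2 * pi) ^+ n * interaction phi i0 i1 c k by rewrite ltr_pM2l.
near=> p.
have hp : (2 * pi) ^+ n * T < complex.Re (pressure_form phi i0 i1 (packet phi c k (width p))).
  by near: p; exact: (cvgr_gt _ h _ hT').
rewrite mulrC ler_pdivlMr// mulrC; apply: (le_trans (ltW hp)).
by apply: le_trans (ler_norm _) _; exact: Re_le_normc.
Unshelve. all: by end_near. Qed.

(** Order of choices: K from B, the amplitude factor [kap] from K, the size N of the family from eps
    and [kap], the window from the family. The dilation comes last, as it must beat the L^2 norm of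
    the undilated field. *)
Lemma norm_inflation (s : nat) (B : R) : (0 < n)%N -> (s <= 1)%N -> 0 <= B ->
  (forall N : nat, exists (I : finType) (c : I -> R) (k : I -> 'rV[R]_n),
    N%:R <= interaction phi i0 i1 c k /\ forall r : R, 0 < r -> shell_sum c k s r <= B) ->
  forall eps : R, 0 < eps ->
    exists u : 'rV[R]_n -> 'rV[R]_n,
      [/\ schwartz_field u, divergence_free u,
          (besov_field phi s%:R u + L2_norm u <= 1)%E &
          ((1 / eps)%:E < besov_scalar phi (2 * s)%:R (pressure u))%E].
Proof.
move=> n0 s1 B0 family eps eps0.
have [K K0 hK] := packet_shell_controlled s1 B0.
have [M M0 hM] := test_fun_bounded (lp_cutoff_test phi_smooth phi_eq0).
pose Q : R := n%:R * ((2 * pi) ^- n * (2 * (M * (2 ^+ s * K)))).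
have Q0 : 0 <= Q.
  have p0 : 0 <= (2 * pi : R) ^- n by rewrite invr_ge0 exprn_ge0// mulr_ge0// pi_ge0.
  have e0 : 0 <= 2 ^+ s :> R by apply: exprn_ge0; exact: ler0n.
  exact: mulr_ge0 (ler0n _ _) (mulr_ge0 p0 (mulr_ge0 (ler0n _ 2) (mulr_ge0 M0 (mulr_ge0 e0 K0)))).
(* The Besov norm will be [kap] Q <= 1/2, which leaves 1/2 for the L^2 norm; Q + 1 avoids dividing
   by zero. *)
pose kap : R := (2 * (Q + 1))^-1.
have Q1 : 0 < Q + 1 by rewrite ltr_wpDl.
have kap0 : 0 < kap by rewrite invr_gt0 mulr_gt0.
have kapQ : kap * Q <= 1 / 2.
  rewrite /kap mulrC ler_pdivrMr ?mulr_gt0//; move: (Q) Q0 => q q0; lra.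
(* The pressure norm will be at least kap^2 ((eps kap^2)^-1 + 1) = 1/eps + kap^2; the summand 1
   makes the inequality strict, and the successors make N exceed this threshold. *)
pose N := (Num.truncn ((eps * kap ^+ 2)^-1)).+3.
have hN : (eps * kap ^+ 2)^-1 + 1 < N%:R.
  have p0 : 0 <= (eps * kap ^+ 2)^-1 by rewrite invr_ge0 mulr_ge0 ?sqr_ge0// ltW.
  have /andP[_] := truncn_itv p0.
  rewrite /N; move: ((eps * _)^-1) => y.
  have -> : (Num.truncn y).+3%:R = (Num.truncn y).+1%:R + 2 :> R by rewrite -natrD addn2.
  by move: ((Num.truncn y).+1%:R : R) => t h; lra.
have [I [c [k [hL hB]]]] := family N.
have hT : (eps * kap ^+ 2)^-1 + 1 < interaction phi i0 i1 c k by apply: lt_le_trans hN hL.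
have [p [hp1 hp2]] : exists p, @width R p * \sum_i `|c i| <= 1 /\
    (eps * kap ^+ 2)^-1 + 1 <= (2 * pi) ^- n *
    normc (pressure_form phi i0 i1 (packet phi c k (width p))).
  have wc : @width R p * \sum_i `|c i| @[p --> \oo] --> 0.
    rewrite -[X in _ --> X](mul0r (\sum_i `|c i|)).
    by apply: cvgM; [exact: width_cvg|exact: cvg_cst].
  near \oo => p; exists p; split; last by near: p; exact: packet_pressure_lower.
  by apply: ltW; near: p; exact: (cvgr_lt _ wc _ ltr01).
pose psi := packet phi c k (width p).
have w0 := @width_gt0 R p; have w1 := @width_le1 R p.
have tp : test_fun psi by apply: packet_test => //; rewrite gt_eqF.
pose G := \int[mu]_x (partial i0 psi x ^+ 2 + partial i1 psi x ^+ 2).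
have G0 : 0 <= G by apply: Rintegral_ge0 => x _; rewrite addr_ge0// sqr_ge0.
(* Since 2^j > j, the factor lam = 2^j is at least 4 kap^2 G. The squared L^2 norm kap^2 G
   lam^-(2s+n) is then at most 1/4, as n > 0. *)
pose j := (Num.truncn (4 * kap ^+ 2 * G)).+1.
pose lam : R := 2 ^ j%:Z.
have lam0 : 0 < lam by exact: pow2_gt0.
have hlam : 4 * kap ^+ 2 * G <= lam.
  have p0 : 0 <= 4 * kap ^+ 2 * G by rewrite mulr_ge0// mulr_ge0// sqr_ge0.
  have /andP[_ /ltW h] := truncn_itv p0.
  apply: (le_trans h); rewrite /lam -exprnP -natrX ler_nat.
  by rewrite ltnW// ltn_expl.
have lam1 : 1 <= lam by rewrite /lam -exprnP exprn_ege1// ler1n.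
(* This power of lam cancels the factor lam^(s+1) in the Besov bound, and turns lam^(2s) (a lam)^2
   in the pressure bound into kap^2. *)
pose a := kap * lam ^- s.+1.
have a0 : 0 <= a by rewrite mulr_ge0 ?(ltW kap0)// invr_ge0 exprn_ge0// ltW.
exists (curl (dilated a lam psi)).
have td : test_fun (dilated a lam psi) by exact: dilated_test.
split; first exact: curl_schwartz.
- exact: curl_divergence_free.
- have b1 := besov_curl_bound phi_smooth phi_eq1 phi_eq0 i01 a0 lam0 tp hM
    (hK I c k (@width R p) w0 w1 hp1 hB).
  have b2 : (L2_norm (curl (dilated a lam psi)) <= (1 / 2)%:E)%E.
    apply: (L2_curl i01 lam0 tp); first by rewrite divr_ge0.
    rewrite -/G; have -> : a ^+ 2 * lam ^+ 2 * lam ^- n * G = kap ^+ 2 * G * (lam ^- (s + s + n)).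
      rewrite /a !exprD (exprS lam s).
      have : lam ^+ s != 0 by rewrite expf_neq0// gt_eqF.
      have : lam ^+ n != 0 by rewrite expf_neq0// gt_eqF.
      have : lam != 0 by rewrite gt_eqF.
      by move: (lam ^+ s) (lam ^+ n) => L1 L2 l0 l1 l2; field; rewrite ?l0 ?l1 ?l2.
    have l1 : lam ^- (s + s + n) <= lam^-1.
      rewrite lef_pV2 ?posrE ?exprn_gt0//; case: (n) n0 => // n' _.
      by rewrite addnS exprS ler_peMr ?(ltW lam0)// exprn_ege1.
    have kG : 0 <= kap ^+ 2 * G by rewrite mulr_ge0// sqr_ge0.
    apply: (le_trans (ler_wpM2l kG l1)); rewrite ler_pdivrMr//.
    have -> : (1 / 2 : R) ^+ 2 = 1 / 4 by field.
    by move: hlam; rewrite -mulrA; move: (kap ^+ 2 * G) => x; lra.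
  have E : (1 = (1 / 2)%:E + (1 / 2)%:E :> \bar R)%E by rewrite -EFinD; congr EFin; field.
  rewrite E; apply: leeD b2; apply: (le_trans b1); rewrite lee_fin.
  apply: le_trans kapQ; rewrite le_eqVlt; apply/orP; left; apply/eqP.
  rewrite /Q /a; have l0 : lam ^+ s.+1 != 0 by rewrite expf_neq0// gt_eqF.
  by move: (lam ^+ s.+1) l0 ((2 * pi) ^- n) => L l0 q; field.
- have b3 := besov_pressure_lower phi_smooth phi_eq1 phi_eq0 i01 (2 * s) j a tp.
  apply: lt_le_trans b3; rewrite lte_fin -/lam -/psi.
  move: hp2; rewrite -/psi; move: (_ * normc _) => Y hY.
  have -> : lam ^+ (2 * s) * ((a * lam) ^+ 2 * Y) = kap ^+ 2 * Y.
    rewrite /a mul2n -addnn exprD (exprS lam s).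
    have : lam ^+ s != 0 by rewrite expf_neq0// gt_eqF.
    have : lam != 0 by rewrite gt_eqF.
    by move: (lam ^+ s) => L l0 L0; field; rewrite ?l0 ?L0.
  have k2 : 0 < kap ^+ 2 by rewrite exprn_gt0.
  apply: (@lt_le_trans _ _ (kap ^+ 2 * ((eps * kap ^+ 2)^-1 + 1))); last by rewrite ler_wpM2l// ltW.
  have -> : kap ^+ 2 * ((eps * kap ^+ 2)^-1 + 1) = 1 / eps + kap ^+ 2.
    by move: (kap ^+ 2) k2 => y y0; field; rewrite ?gt_eqF.
  by rewrite ltrDl.
Unshelve. all: by end_near. Qed.

End norm_inflation.

(** * Two lacunary families of frequencies *)

Section lacunary_families.
Context {R : realType} {n : nat}.
Variable phi : 'rV[R]_n -> R.
Hypothesis phi_eq1 : forall xi, enorm xi <= 1 -> phi xi = 1.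
Hypothesis phi_eq0 : forall xi, 7 / 6 < enorm xi -> phi xi = 0.
Variables i0 i1 : 'I_n.
Hypothesis i01 : i0 != i1.
Local Notation mean_multiplier := (mean_multiplier phi).
Local Notation cross := (cross i0 i1).

Definition plane (x y : R) : 'rV[R]_n := x *: delta_mx 0 i0 + y *: delta_mx 0 i1.

Lemma plane0E x y : plane x y 0 i0 = x.
Proof. by rewrite !mxE !eqxx/= (negbTE i01) mulr0 mulr1 addr0. Qed.

Lemma plane1E x y : plane x y 0 i1 = y.
Proof. by rewrite !mxE !eqxx/= eq_sym (negbTE i01) mulr0 mulr1 add0r. Qed.

Lemma planeD x y x' y' : plane x y + plane x' y' = plane (x + x') (y + y').
Proof. by rewrite /plane !scalerDl addrACA. Qed.

Lemma planeN x y : - plane x y = plane (- x) (- y).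
Proof. by rewrite /plane !scaleNr opprD. Qed.

Lemma planeB x y x' y' : plane x y - plane x' y' = plane (x - x') (y - y').
Proof. by rewrite planeN planeD. Qed.

Lemma enorm_plane x y : enorm (plane x y) ^+ 2 = x ^+ 2 + y ^+ 2.
Proof.
rewrite enorm_sqr /plane !dotrDl !dotrZl !dotr_delta -/(plane x y).
by rewrite plane0E plane1E !expr2.
Qed.

Lemma enorm_plane_x x : enorm (plane x 0) = `|x|.
Proof.
have h := enorm_ge0 (plane x 0).
by rewrite -[LHS]ger0_norm// -sqrtr_sqr enorm_plane expr0n addr0 sqrtr_sqr.
Qed.

Lemma enorm_plane_y y : enorm (plane 0 y) = `|y|.
Proof.
have h := enorm_ge0 (plane 0 y).
by rewrite -[LHS]ger0_norm// -sqrtr_sqr enorm_plane expr0n add0r sqrtr_sqr.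
Qed.

Lemma cross_plane x y x' y' : cross (plane x y) (plane x' y') = x * y' - y * x'.
Proof. by rewrite /cross !plane0E !plane1E. Qed.

Lemma mean_multiplier_far x y : 7 / 6 < `|x| -> mean_multiplier (plane x y) = 0.
Proof.
move=> hx; have h : 7 / 6 < enorm (plane x y).
  by apply: lt_le_trans hx _; rewrite -[X in `|X|](plane0E x y) coord_le_enorm.
rewrite /mean_multiplier !lp_cutoff_eq0// ?enormN//.
by rewrite addr0 !mul0r.
Qed.

Lemma mean_multiplier_unit v : 7 / 12 < enorm v -> enorm v <= 1 ->
  mean_multiplier v = (enorm v ^+ 2)^-1.
Proof.
move=> h1 h2; rewrite /mean_multiplier !lp_cutoff_eq1 ?enormN//.
by rewrite (_ : (1 + 1) / 2 = 1) ?mul1r//; field.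
Qed.

(** The separation factor 10 exceeds 28/3, the ratio of the radii 14r/3 and r/2 in [near_shell], so
    at most one q_j is near a given shell. *)
Lemma lacunary_shell_sum N (q : 'I_N -> 'rV[R]_n) (w : 'I_N -> R) (B r : R) (s : nat) :
  0 <= B -> (forall j, w j * (2 * enorm (q j)) ^+ s.+1 <= B) ->
  (forall i j : 'I_N, (i < j)%N ->
     10 * enorm (q i) < enorm (q j) \/ 10 * enorm (q j) < enorm (q i)) ->
  \sum_j w j * (if near_shell r (q j) then (2 * enorm (q j)) ^+ s.+1 else 0) <= B.
Proof.
move=> B0 hw sep.
have sep2 i j : near_shell r (q i) -> near_shell r (q j) -> ~ 10 * enorm (q i) < enorm (q j).
  rewrite /near_shell; move: (enorm_ge0 (q i)) (enorm (q i)) (enorm (q j)) => _ x y.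
  by move=> /andP[h1 h2] /andP[h3 h4] h5; lra.
have uniq_shell i j : near_shell r (q i) -> near_shell r (q j) -> i = j.
  move=> hi hj; apply/val_inj; case: (ltngtP i j) => // /sep[] h.
  - by case: (sep2 i j).
  - by case: (sep2 j i).
  - by case: (sep2 j i).
  - by case: (sep2 i j).
case: (pickP (fun j => near_shell r (q j))) => [j hj|none].
  rewrite (bigD1 j)//= hj big1 ?addr0// => i ij; case: ifP => hi; last by rewrite mulr0.
  by move: ij; rewrite (uniq_shell i j hi hj) eqxx.
by rewrite big1// => i _; rewrite none mulr0.
Qed.

Lemma sum_diagonal N (F : 'I_N -> 'I_N -> R) (a : R) :
  (forall i j, F i j = if i == j then a else 0) ->
  \sum_i \sum_j F i j = N%:R * a.
Proof.
move=> hF; under eq_bigr => i _ do under eq_bigr do rewrite hF.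
under eq_bigr => i _ do rewrite -big_mkcond (big_pred1 i)//.
by rewrite sumr_const card_ord mulr_natl.
Qed.

(** The ratio 16 leaves room above the separation factor 10 for the perturbation by e1. Starting at
    16 keeps distinct scales more than 7/6 apart and the inverse scales small. *)
Definition scale (j : nat) : R := 16 ^+ j.+1.

Lemma scale_ge16 j : 16 <= scale j.
Proof. by rewrite /scale exprS ler_peMr// exprn_ege1// ler1n. Qed.

Lemma scale_gt0 j : 0 < scale j.
Proof. by rewrite (lt_le_trans _ (scale_ge16 j)). Qed.

Lemma scale_lt i j : (i < j)%N -> 16 * scale i <= scale j.
Proof. by move=> ij; rewrite /scale -exprS ler_eXn2l ?ltr1n. Qed.

Lemma scale_gap (i j : nat) : i != j -> 7 / 6 < `|scale i - scale j|.
Proof.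
have gi := scale_ge16 i; have gj := scale_ge16 j.
rewrite neq_ltn => /orP[/scale_lt h|/scale_lt h]; rewrite lter_normr; apply/orP.
  by right; move: (scale i) (scale j) gi gj h => x y *; lra.
by left; move: (scale i) (scale j) gi gj h => x y *; lra.
Qed.

Definition osc_amplitude N (i : 'I_N + 'I_N) : R :=
  match i with inl j | inr j => (scale j)^-1 end.

Definition osc_frequency N (i : 'I_N + 'I_N) : 'rV[R]_n :=
  match i with inl j => plane (scale j) 0 | inr j => plane (scale j) 1 end.

(** Two frequencies of the same kind are parallel or differ by more than 7/6 along e0, except that
    those of the first kind are always parallel; all sums are too long for the cutoff. A mixed pair
    of equal scale g has cross product of modulus g against amplitudes 1/g, which gives 1/2 in each
    of the two orders. *)
Lemma osc_interaction N :
  interaction phi i0 i1 (@osc_amplitude N) (@osc_frequency N) = N%:R.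
Proof.
pose F (i j : 'I_N + 'I_N) := osc_amplitude i * osc_amplitude j / 2 *
  cross (osc_frequency i) (osc_frequency j) ^+ 2 *
  (mean_multiplier (osc_frequency i - osc_frequency j) +
   mean_multiplier (osc_frequency i + osc_frequency j)).
rewrite /interaction -/(\sum_i \sum_j F i j) big_sumType/=.
under eq_bigr do rewrite big_sumType/=.
under [X in _ + X]eq_bigr do rewrite big_sumType/=.
have far i j y : mean_multiplier (plane (scale i + scale j) y) = 0.
  apply: mean_multiplier_far; rewrite ger0_norm; last first.
    by rewrite addr_ge0// ltW// scale_gt0.
  by move: (scale_ge16 i) (scale_ge16 j); lra.
have aa i j : F (inl i) (inl j) = 0.
  by rewrite /F /= cross_plane mulr0 mul0r subrr expr0n !(mulr0, mul0r).
have bb i j : F (inr i) (inr j) = 0.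
  rewrite /F /= cross_plane planeB planeD far subrr mulr1 mul1r addr0.
  have [->|ij] := eqVneq i j; first by rewrite subrr expr0n !(mulr0, mul0r).
  by rewrite mean_multiplier_far ?mulr0// scale_gap.
have unit y : y ^+ 2 = 1 -> mean_multiplier (plane 0 y) = 1.
  move=> y1; have e : enorm (plane 0 y) = 1.
    by rewrite enorm_plane_y -sqrtr_sqr y1 sqrtr1.
  by rewrite mean_multiplier_unit e// ?expr1n ?invr1//; lra.
have ab i j : F (inl i) (inr j) = if i == j then 1 / 2 else 0.
  rewrite /F /= cross_plane planeB planeD far addr0 mulr1 mul0r subr0 sub0r.
  have [->|ij] := eqVneq i j; last by rewrite mean_multiplier_far ?mulr0// scale_gap.
  rewrite subrr unit ?sqrrN ?expr1n// mulr1.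
  by have := scale_gt0 j; move: (scale j) => g g0; field; rewrite gt_eqF.
have ba i j : F (inr i) (inl j) = if i == j then 1 / 2 else 0.
  rewrite /F /= cross_plane planeB planeD far addr0 mul1r mulr0 sub0r subr0.
  have [->|ij] := eqVneq i j; last by rewrite mean_multiplier_far ?mulr0// scale_gap.
  rewrite subrr unit ?sqrrN ?expr1n// mulr1.
  by have := scale_gt0 j; move: (scale j) => g g0; field; rewrite gt_eqF.
rewrite !big_split/= (sum_diagonal ab) (sum_diagonal ba).
rewrite (big1 _ _ _ (fun i _ => big1 _ _ _ (fun j _ => aa i j))).
rewrite (big1 _ _ _ (fun i _ => big1 _ _ _ (fun j _ => bb i j))).
by move: (N%:R : R) => x; field.
Qed.

Lemma osc_shell_sum N (r : R) : shell_sum (@osc_amplitude N) (@osc_frequency N) 0 r <= 2 + 3.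
Proof.
rewrite /shell_sum big_sumType/=.
have hn j : enorm (plane (scale j) 0) = scale j.
  by rewrite enorm_plane_x gtr0_norm// scale_gt0.
have h1 j : scale j <= enorm (plane (scale j) 1).
  by rewrite -[leLHS]gtr0_norm ?scale_gt0// -[X in `|X|](plane0E (scale j) 1) coord_le_enorm.
have h2 j : enorm (plane (scale j) 1) <= scale j + 1.
  have -> : plane (scale j) 1 = plane (scale j) 0 + plane 0 1 by rewrite planeD addr0 add0r.
  by apply: (le_trans (enormD _ _)); rewrite hn enorm_plane_y normr1.
have an j : `|(scale j)^-1| = (scale j)^-1 by rewrite ger0_norm// invr_ge0 ltW// scale_gt0.
(* The weights are (1/g) 2g = 2 for the frequencies along e0, and at most (1/g) 2(g + 1) <= 3 for
   the shifted ones. *)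
apply: lerD; apply: lacunary_shell_sum => //.
- by move=> j; rewrite an hn expr1 mulrC -mulrA mulfV ?mulr1// gt_eqF// scale_gt0.
- move=> i j ij; left; rewrite !hn; have := scale_lt ij; have := scale_gt0 i.
  by move: (scale i) (scale j) => x y *; lra.
- move=> j; rewrite an expr1 mulrC ler_pdivrMr ?scale_gt0//.
  by move: (h2 j) (scale_ge16 j); lra.
- move=> i j ij; left; move: (h2 i) (h1 j) (scale_ge16 i) (scale_lt ij); lra.
Qed.

Definition grad_amplitude N (i : 'I_N + unit) : R :=
  match i with inl j => scale j ^+ 2 | inr _ => 1 end.

Definition grad_frequency N (i : 'I_N + unit) : 'rV[R]_n :=
  match i with inl j => plane 0 (scale j)^-1 | inr _ => plane (3 / 4) 0 end.

(** Low frequencies are mutually parallel, so only low-high pairs interact. The amplitude g^2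
    compensates the squared cross product (3/(4g))^2, and each ordered pair contributes at least
    (9/32)(16/5) = 9/10, of which 1/2 is used. *)
Lemma grad_interaction N :
  N%:R <= interaction phi i0 i1 (@grad_amplitude N) (@grad_frequency N).
Proof.
pose F (i j : 'I_N + unit) := grad_amplitude i * grad_amplitude j / 2 *
  cross (grad_frequency i) (grad_frequency j) ^+ 2 *
  (mean_multiplier (grad_frequency i - grad_frequency j) +
   mean_multiplier (grad_frequency i + grad_frequency j)).
have bigU (G : unit -> R) : \sum_i G i = G tt.
  by rewrite (big_pred1 tt)// => -[].
rewrite /interaction -/(\sum_i \sum_j F i j) big_sumType/= bigU.
under eq_bigr do rewrite big_sumType/= bigU.
rewrite big_sumType/= bigU.
have ll i j : F (inl i) (inl j) = 0.
  by rewrite /F /= cross_plane mul0r mulr0 subrr expr0n !(mulr0, mul0r).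
have hh : F (inr tt) (inr tt) = 0.
  by rewrite /F /= cross_plane mul0r mulr0 subrr expr0n !(mulr0, mul0r).
(* The squared length lies between 9/16 and 10/16, where the cutoff equals 1; this is the reason for
   the high frequency 3/4, and 8/5 is the inverse of 10/16. *)
have val x y : x ^+ 2 = 9 / 16 -> y ^+ 2 <= 1 / 16 ->
    8 / 5 <= mean_multiplier (plane x y).
  move=> hx hy; have e := enorm_plane x y; have p := enorm_ge0 (plane x y).
  have y0 := sqr_ge0 y.
  rewrite mean_multiplier_unit.
  - have d0 : 0 < 9 / 16 + y ^+ 2 by lra.
    rewrite e hx -[leRHS]mul1r ler_pdivlMr//; lra.
  - rewrite -(@ltr_pXn2r _ 2)// ?nnegrE//; rewrite e hx; lra.
  - rewrite -(@ler_pXn2r _ 2)// ?nnegrE// e hx expr1n; lra.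
have ts j : (scale j)^-1 ^+ 2 <= 1 / 16.
  have h := scale_ge16 j; have g0 := scale_gt0 j.
  rewrite exprVn -[leLHS]mul1r ler_pdivrMr ?exprn_gt0// expr2; nra.
have lh j : 1 / 2 <= F (inl j) (inr tt).
  rewrite /F /= cross_plane planeB planeD mul0r sub0r mulr1 sqrrN.
  rewrite !sub0r !add0r subr0 addr0.
  have v1 := val (- (3 / 4)) (scale j)^-1 _ (ts j).
  have v2 := val (3 / 4) (scale j)^-1 _ (ts j).
  have {}v1 := v1 ltac:(by field); have {}v2 := v2 ltac:(by field).
  have -> : scale j ^+ 2 / 2 * ((scale j)^-1 * (3 / 4)) ^+ 2 = 9 / 32.
    by have := scale_gt0 j; move: (scale j) => g g0; field; rewrite gt_eqF.
  by move: (mean_multiplier _) (mean_multiplier _) v1 v2 => y1 y2; lra.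
have hl j : 1 / 2 <= F (inr tt) (inl j).
  rewrite /F /= cross_plane planeB planeD mul0r subr0.
  rewrite !sub0r !add0r subr0 addr0.
  have v1 := val (3 / 4) (- (scale j)^-1) _ _.
  have v2 := val (3 / 4) (scale j)^-1 _ (ts j).
  have {}v1 := v1 ltac:(by field) ltac:(by rewrite sqrrN; exact: ts); have {}v2 := v2 ltac:(by field).
  have -> : 1 * scale j ^+ 2 / 2 * (3 / 4 * (scale j)^-1) ^+ 2 = 9 / 32.
    by have := scale_gt0 j; move: (scale j) => g g0; field; rewrite gt_eqF.
  by move: (mean_multiplier _) (mean_multiplier _) v1 v2 => y1 y2; lra.
rewrite hh addr0 big_split/= big1 ?add0r; last by move=> i _; rewrite big1.
have -> : N%:R = \sum_(j < N) (1 / 2 : R) + \sum_(j < N) (1 / 2 : R).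
  by rewrite -big_split/= -splitr sumr_const card_ord.
by apply: lerD; apply: ler_sum => j _.
Qed.

Lemma grad_shell_sum N (r : R) : shell_sum (@grad_amplitude N) (@grad_frequency N) 1 r <= 4 + 9 / 4.
Proof.
rewrite /shell_sum big_sumType/=.
have hn j : enorm (plane 0 (scale j)^-1) = (scale j)^-1.
  by rewrite enorm_plane_y ger0_norm// invr_ge0 ltW// scale_gt0.
(* The weights are g^2 (2/g)^2 = 4 for a low frequency and (2 . 3/4)^2 = 9/4 for the high one. The
   low frequencies decrease with the index, hence the second alternative of the separation. *)
apply: lerD.
  apply: lacunary_shell_sum => //.
  - move=> j; rewrite ger0_norm ?sqr_ge0// hn; have := scale_gt0 j.
    move: (scale j) => g g0; rewrite (_ : _ * _ = 4)//; field; rewrite gt_eqF//.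
  - move=> i j ij; right; rewrite !hn ltr_pdivrMr ?scale_gt0// mulrC ltr_pdivlMr ?scale_gt0//.
    have := scale_lt ij; have := scale_gt0 i.
    by move: (scale i) (scale j) => x y *; lra.
rewrite (big_pred1 tt) => [|[]//]; rewrite normr1 mul1r; case: ifP => _; last lra.
rewrite enorm_plane_x ger0_norm; last lra.
by rewrite le_eqVlt; apply/orP; left; apply/eqP; field.
Qed.

End lacunary_families.

(** With eps = 1/C, a Besov norm at most 1 would force the pressure norm below C, while inflation
    makes it exceed C. *)
Lemma pressure_estimate_fails (R : realType) (n : nat) (phi : 'rV[R]_n -> R) (s : R) :
  (forall eps : R, 0 < eps -> exists u : 'rV[R]_n -> 'rV[R]_n,
     [/\ schwartz_field u, divergence_free u,
         (besov_field phi s u + L2_norm u <= 1)%E &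
         ((1 / eps)%:E < besov_scalar phi (2 * s) (pressure u))%E]) ->
  ~ pressure_estimate phi s.
Proof.
move=> inflation [C C0 hC].
have CV0 : 0 < C^-1 by rewrite invr_gt0.
have [u [su du hu lu]] := inflation _ CV0.
have f0 : (0 <= besov_field phi s u)%E.
  (* Nonnegativity of the supremum is read off from the single shell j = 0. *)
  apply: le_ereal_sup_tmp; eexists; first by exists 0%R.
  by apply: mule_ge0; rewrite ?lee_fin ?powR_ge0// Lnorm_ge0.
have f1 : (besov_field phi s u <= 1)%E.
  by apply: le_trans hu; rewrite leeDl// Lnorm_ge0.
have := lt_le_trans lu (hC u su du); apply/negP; rewrite -leNgt.
rewrite div1r invrK -[leRHS]mule1; apply: lee_wpmul2l; first by rewrite lee_fin ltW.
by rewrite expe2 -[leRHS]mule1; exact: lee_pmul.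
Qed.

Theorem theorem1p4 (R : realType) (n : nat) (phi : 'rV[R]_n -> R)
    (n_ge2 : (2 <= n)%N)
    (phi_smooth : smooth phi)
    (phi_eq1 : forall xi, enorm xi <= 1 -> phi xi = 1)
    (phi_eq0 : forall xi, 7 / 6 < enorm xi -> phi xi = 0) :
  [/\ ~ pressure_estimate phi 0,
      ~ pressure_estimate phi 1,
      forall eps : R, 0 < eps ->
        exists u : 'rV[R]_n -> 'rV[R]_n,
          [/\ schwartz_field u, divergence_free u,
              (besov_field phi 1 u + L2_norm u <= 1)%E &
              ((1 / eps)%:E < besov_scalar phi 2 (pressure u))%E] &
      forall eps : R, 0 < eps ->
        exists u : 'rV[R]_n -> 'rV[R]_n,
          [/\ schwartz_field u, divergence_free u,
              (besov_field phi 0 u + L2_norm u <= 1)%E &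
              ((1 / eps)%:E < besov_scalar phi 0 (pressure u))%E]].
Proof.
have n1 : (0 < n)%N by exact: leq_trans n_ge2.
pose i0 := Ordinal n1; pose i1 := Ordinal n_ge2.
have i01 : i0 != i1 by [].
have A1 := @norm_inflation _ _ _ phi_smooth phi_eq1 phi_eq0 i0 i1 i01 1 (4 + 9 / 4) n1 isT _ _.
have A0 := @norm_inflation _ _ _ phi_smooth phi_eq1 phi_eq0 i0 i1 i01 0 (2 + 3) n1 isT _ _.
have {}A1 : forall eps : R, 0 < eps -> exists u : 'rV[R]_n -> 'rV[R]_n,
    [/\ schwartz_field u, divergence_free u, (besov_field phi 1 u + L2_norm u <= 1)%E &
        ((1 / eps)%:E < besov_scalar phi 2 (pressure u))%E].
  apply: A1; first lra.
  move=> N; exists ('I_N + unit)%type, (@grad_amplitude R N), (@grad_frequency R n i0 i1 N).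
  by split=> [|r _]; [exact: grad_interaction|exact: grad_shell_sum].
have {}A0 : forall eps : R, 0 < eps -> exists u : 'rV[R]_n -> 'rV[R]_n,
    [/\ schwartz_field u, divergence_free u, (besov_field phi 0 u + L2_norm u <= 1)%E &
        ((1 / eps)%:E < besov_scalar phi 0 (pressure u))%E].
  apply: A0; first lra.
  move=> N; exists ('I_N + 'I_N)%type, (@osc_amplitude R N), (@osc_frequency R n i0 i1 N).
  by split=> [|r _]; [rewrite osc_interaction|exact: osc_shell_sum].
split=> //; apply: pressure_estimate_fails; first by rewrite mulr0.
by rewrite mulr1.
Qed.
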